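(* Let $V:\mathbb{R}^2\to\mathbb{R}$ be an even nonpositive Schwartz class function, let $\omega>0$, $0<\beta<\frac16$, and suppose $\|V\|_{L^1}<\frac{2\alpha}{C_{gn}^4}$ for some $\alpha\in(0,1)$. Let $$H_N=\sum_{j=1}^{N}\left(-\Delta_{x_j}+\omega^2|x_j|^2\right)+\frac1N\sum_{1\le i<j\le N}N^{2\beta}V(N^\beta(x_i-x_j)),\qquad x_j\in\mathbb{R}^2.$$ Then for every $C_0>0$ there exists an $N_0>0$ such that $$\left\langle\psi_N,\left(N^{-1}H_N+C_0\right)\psi_N\right\rangle\ge(1-\alpha)\left\|S_1\psi_N\right\|_{L^2}^2$$ for all $N>N_0$ and for all $\psi_N\in L^2_s(\mathbb{R}^{2N})$. Here $N_0=N_0(C_0)$ grows to infinity as $C_0$ approaches $0$. In particular, the $N$-body system is stable (that is, $\langle\psi_N,H_N\psi_N\rangle\ge -CN\|\psi_N\|_{L^2}^2$ for all $\psi_N\in L^2_s(\mathbb{R}^{2N})$, with $C$ independent of $N$) provided $N$ is larger than a threshold.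
   Context: $L^2_s(\mathbb{R}^{2N})$ is the space of $L^2$ functions of $(x_1,\dots,x_N)$, $x_j\in\mathbb{R}^2$, symmetric under permutations of $x_1,\dots,x_N$. $C_{gn}$ is the sharp (smallest) constant in the 2D Gagliardo--Nirenberg inequality $\|\phi\|_{L^4}\le C_{gn}\|\phi\|_{L^2}^{1/2}\|\nabla\phi\|_{L^2}^{1/2}$. $S_j=\left(-\Delta_{x_j}+\omega^2|x_j|^2\right)^{1/2}$. Inequalities are understood in the quadratic form sense. *)

(* Defs.v *)
From HB Require Import structures.
From mathcomp Require Import all_boot all_order all_algebra.
From mathcomp Require Import all_classical all_reals all_analysis.
From mathcomp Require Import perm complex.

Set Implicit Arguments.
Unset Strict Implicit.
Unset Printing Implicit Defensive.

Import Order.TTheory GRing.Theory Num.Theory.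
Import numFieldNormedType.Exports.

Local Open Scope classical_set_scope.
Local Open Scope ring_scope.

Definition measure_matrix_display : measure_display -> measure_display.
Proof. exact. Qed.

Definition mx_coord (T : Type) m n (ij : 'I_m * 'I_n) (A : 'M[T]_(m, n)) : T :=
  A ij.1 ij.2.

(* The product sigma-algebra: the smallest one making the entries measurable. *)
Definition mx_measurable d (T : measurableType d) m n : set (set 'M[T]_(m, n)) :=
  <<s \bigcup_(ij in [set: 'I_m * 'I_n])
        preimage_set_system setT (mx_coord ij) measurable >>.

Section measurable_matrix.
Context d (T : measurableType d).
Variables m n : nat.

Let mx0 : mx_measurable (T := T) (m := m) (n := n) set0.
Proof. exact: sigma_algebra0. Qed.

Let mxC A : mx_measurable A -> mx_measurable (T := T) (m := m) (n := n) (~` A).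
Proof. exact: sigma_algebraC. Qed.

Let mxU (F : (set 'M[T]_(m, n))^nat) : (forall i, mx_measurable (F i)) ->
  mx_measurable (\bigcup_i F i).
Proof. exact: sigma_algebra_bigcup. Qed.

HB.instance Definition _ := Pointed.on 'M[T]_(m, n).
HB.instance Definition _ := @isMeasurable.Build (measure_matrix_display d)
  'M[T]_(m, n) (@mx_measurable d T m n) mx0 mxC mxU.

End measurable_matrix.


Section measurable_matrix_theory.
Context d (T : measurableType d).

Lemma measurable_mx_coord m n (i : 'I_m) (j : 'I_n) :
  measurable_fun setT (fun A : 'M[T]_(m, n) => A i j).
Proof.
move=> _ Y mY; apply: sub_sigma_algebra; exists (i, j) => //.
by exists Y.
Qed.

Lemma measurable_mx d' (X : measurableType d') m n (f : X -> 'M[T]_(m, n)) :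
  (forall i j, measurable_fun setT (fun x => f x i j)) -> measurable_fun setT f.
Proof.
move=> mf _ Y mY; rewrite setTI.
suff : @mx_measurable d T m n `<=` [set A | measurable (f @^-1` A)] by exact.
apply: smallest_sub.
  split=> [|A mA|F mF] /=.
  - by rewrite preimage_set0.
  - by rewrite setTD preimage_setC; exact: measurableC.
  - by rewrite preimage_bigcup; apply: bigcup_measurable => k _; exact: mF.
move=> _ [[i j] _ [B mB <-]] /=; rewrite setTI.
by have := mf i j measurableT B mB; rewrite setTI.
Qed.

End measurable_matrix_theory.

Section image_measure.
Local Open Scope ereal_scope.
Context d1 d2 (T1 : measurableType d1) (T2 : measurableType d2) (R : realType).
Variables (mu : {sigma_finite_measure set T1 -> \bar R}).
Variables (f : T1 -> T2) (g : T2 -> T1).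
Hypotheses (mf : measurable_fun setT f) (mg : measurable_fun setT g).
Hypothesis fK : cancel f g.

Definition image_measure of measurable_fun setT f & measurable_fun setT g
  & cancel f g : set T2 -> \bar R := pushforward mu f.

Local Notation nu := (image_measure mf mg fK).

Let nu0 : nu set0 = 0.
Proof. by rewrite /image_measure /pushforward preimage_set0 measure0. Qed.

Let nu_ge0 A : 0 <= nu A. Proof. exact: measure_ge0. Qed.

Let nu_sigma_additive : semi_sigma_additive nu.
Proof.
move=> F mF tF mUF; rewrite /image_measure /pushforward preimage_bigcup.
apply: measure_semi_sigma_additive.
- by move=> n; rewrite -[X in measurable X]setTI; exact: mf.
- apply/trivIsetP => /= i j _ _ ij; rewrite -preimage_setI.
  by move/trivIsetP : tF => /(_ _ _ _ _ ij) ->//; rewrite preimage_set0.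
- by rewrite -preimage_bigcup -[X in measurable X]setTI; exact: mf.
Qed.

HB.instance Definition _ := isMeasure.Build _ _ _ nu
  nu0 nu_ge0 nu_sigma_additive.

Let nu_sigma_finite : sigma_finite setT nu.
Proof.
have [F FT Foo] := sigma_finiteT mu.
exists (fun n => g @^-1` F n); first by rewrite -preimage_bigcup -FT preimage_setT.
move=> n; have [mF muF] := Foo n; split.
  by rewrite -[X in measurable X]setTI; exact: mg.
rewrite /image_measure /pushforward (_ : _ @^-1` _ = F n)//.
by apply/seteqP; split => x /=; rewrite fK.
Qed.

HB.instance Definition _ := Measure_isSigmaFinite.Build _ _ _ nu nu_sigma_finite.

End image_measure.

(* The library's sigma-finite instance for [m1 \x m2] is only inferred for
   subprobability measures, hence this alias. *)
Section sigma_finite_product.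
Local Open Scope ereal_scope.
Context d1 d2 (T1 : measurableType d1) (T2 : measurableType d2) (R : realType).
Variables (m1 : {sigma_finite_measure set T1 -> \bar R}).
Variables (m2 : {sigma_finite_measure set T2 -> \bar R}).

Definition prod_measure : set (T1 * T2) -> \bar R := m1 \x m2.

HB.instance Definition _ := Measure.on prod_measure.

Let prod_measure_sigma_finite : sigma_finite setT prod_measure.
Proof.
have /sigma_finiteP[F [TF ndF Foo]] := sigma_finiteT m1.
have /sigma_finiteP[G [TG ndG Goo]] := sigma_finiteT m2.
exists (fun n => F n `*` G n).
  rewrite -setXTT TF TG predeqE => -[x y]; split.
    move=> [/= [n _ Fnx] [k _ Gky]]; exists (maxn n k) => //; split.
    - by move: x Fnx; exact/subsetPset/ndF/leq_maxl.
    - by move: y Gky; exact/subsetPset/ndG/leq_maxr.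
  by move=> [n _ []/= ? ?]; split; exists n.
move=> k; have [? ?] := Foo k; have [? ?] := Goo k.
split; first exact: measurableX.
by rewrite /prod_measure product_measure1E// lte_mul_pinfty// ge0_fin_numE.
Qed.

HB.instance Definition _ := Measure_isSigmaFinite.Build _ _ _ prod_measure
  prod_measure_sigma_finite.

End sigma_finite_product.

Section lebesgue_measure_on_configurations.
Context {R : realType}.

Definition mkpoint (p : measurableTypeR R * measurableTypeR R) : 'rV[R]_2 :=
  \row_(k < 2) (if k == 0 then p.1 else p.2).
Definition point_coords (x : 'rV[R]_2) : measurableTypeR R * measurableTypeR R :=
  (x 0 0, x 0 1).

Definition add_particle n (p : 'rV[R]_2 * 'M[R]_(n, 2)) : 'M[R]_(n.+1, 2) :=
  col_mx p.1 p.2.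
Definition first_particle n (x : 'M[R]_(n.+1, 2)) : 'rV[R]_2 * 'M[R]_(n, 2) :=
  (usubmx (x : 'M[R]_(1 + n, 2)), dsubmx (x : 'M[R]_(1 + n, 2))).

Let mkpoint_meas : measurable_fun setT mkpoint.
Proof.
apply: measurable_mx => i k; under eq_fun do rewrite mxE.
by case: (k == 0); [exact: measurable_fst|exact: measurable_snd].
Qed.

Let point_coords_meas : measurable_fun setT point_coords.
Proof. by apply: measurable_fun_pair; exact: measurable_mx_coord. Qed.

Let mkpointK : cancel mkpoint point_coords.
Proof. by case=> a b; rewrite /point_coords !mxE. Qed.

Let add_particle_meas n : measurable_fun setT (@add_particle n).
Proof.
apply: measurable_mx => i k; rewrite /add_particle.
under eq_fun do rewrite mxE.
case: (fintype.split _) => j.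
- exact: (measurableT_comp (measurable_mx_coord j k) measurable_fst).
- exact: (measurableT_comp (measurable_mx_coord j k) measurable_snd).
Qed.

Let first_particle_meas n : measurable_fun setT (@first_particle n).
Proof.
apply: measurable_fun_pair; apply: measurable_mx => i k;
  by under eq_fun do rewrite mxE; exact: measurable_mx_coord.
Qed.

Let add_particleK n : cancel (@add_particle n) (@first_particle n).
Proof. by case=> x y; rewrite /first_particle /add_particle col_mxKu col_mxKd. Qed.

Definition lebesgue_plane : {sigma_finite_measure set 'rV[R]_2 -> \bar R} :=
  image_measure (prod_measure (@lebesgue_measure R) (@lebesgue_measure R))
    mkpoint_meas point_coords_meas mkpointK.

(* Lebesgue measure on (R^2)^n; row [j] of an n x 2 matrix is the position [x_j]. *)
Fixpoint leb n : {sigma_finite_measure set 'M[R]_(n, 2) -> \bar R} :=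
  if n is n'.+1 then
    image_measure (prod_measure lebesgue_plane (leb n'))
      (@add_particle_meas n') (@first_particle_meas n') (@add_particleK n')
  else \d_(0 : 'M[R]_(0, 2)).

End lebesgue_measure_on_configurations.

Section differential_calculus.
Context {R : realType} (n : nat).
Implicit Types (f phi : 'M[R]_(n, 2) -> R).

(* The pair (j, k) stands for the k-th coordinate of the j-th particle. *)
Definition pder (s : seq ('I_n * 'I_2)) f : 'M[R]_(n, 2) -> R :=
  foldr (fun jk h => 'D_(delta_mx jk.1 jk.2) h) f s.

Definition smooth f := forall s, continuous (pder s f) /\
  forall x j k, derivable (pder s f) x (delta_mx j k).

Definition test_function phi :=
  smooth phi /\ exists M : R, forall x, M < `|x| -> phi x = 0.

Definition laplacian (j : 'I_n) f : 'M[R]_(n, 2) -> R :=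
  fun x => \sum_(k < 2) pder [:: (j, k); (j, k)] f x.

(* The squared Euclidean length; the library's norm on matrices is the sup norm. *)
Definition sqlen (v : 'rV[R]_2) : R := \sum_(k < 2) v 0 k ^+ 2.

End differential_calculus.

Definition schwartz {R : realType} (V : 'rV[R]_2 -> R) :=
  smooth V /\ forall (m : nat) s,
    exists C : R, forall x, (1 + sqlen x) ^+ m * `|pder s V x| <= C.

Section L2.
Context {R : realType} (n : nat).
Local Notation X := 'M[R]_(n, 2).
Implicit Types (psi chi : X -> R[i]) (phi : X -> R).

Local Notation modulus := (@ComplexField.Normc.normc R).

Definition Lp_norm (p : R) psi : \bar R :=
  'N[leb n]_p%:E[(fun x => (modulus (psi x))%:E)]%E.

Definition sqnorm psi : \bar R := (Lp_norm 2 psi ^+ 2)%E.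

Definition is_L2 psi :=
  [/\ measurable_fun setT (fun x => complex.Re (psi x)),
      measurable_fun setT (fun x => complex.Im (psi x)) &
      (Lp_norm 2 psi < +oo)%E].

Definition L2_sym psi := is_L2 psi /\
  forall s : 'S_n, {ae leb n, forall x, psi (row_perm s x) = psi x}.

Definition cintegral psi : R[i] :=
  Complex (\int[leb n]_x complex.Re (psi x)) (\int[leb n]_x complex.Im (psi x)).

Definition inner psi chi : R[i] := cintegral (fun x => (psi x)^*%C * chi x).

Definition weak_derivative j k psi g := forall phi, test_function phi ->
  cintegral (fun x => psi x * (pder [:: (j, k)] phi x)%:C%C) =
  - cintegral (fun x => g x * (phi x)%:C%C).

(* |d psi / d(x_j)_k|^2, equal to +oo when psi has no L^2 weak derivative: the
   infimum is over at most one function, up to null sets. *)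
Definition dirichlet_form j k psi : \bar R :=
  ereal_inf [set sqnorm g | g in [set g | is_L2 g /\ weak_derivative j k psi g]].

Definition gradient_form j psi : \bar R := (\sum_(k < 2) dirichlet_form j k psi)%E.

Definition oscillator_form (omega : R) j psi : \bar R :=
  (gradient_form j psi +
   \int[leb n]_x (omega ^+ 2 * sqlen (row j x) * modulus (psi x) ^+ 2)%:E)%E.

Definition interaction (V : 'rV[R]_2 -> R) (beta : R) (x : X) : R :=
  n%:R^-1 * \sum_(i < n) \sum_(j < n | (i < j)%N)
    n%:R `^ (2 * beta) * V (n%:R `^ beta *: (row i x - row j x)).

Definition hamiltonian_form V (omega beta : R) psi : \bar R :=
  (\sum_(j < n) oscillator_form omega j psi +
   \int[leb n]_x (interaction V beta x * modulus (psi x) ^+ 2)%:E)%E.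

(* Unbounded operators on L^2 are given by their graphs, as relations between
   functions that respect equality almost everywhere. *)
Definition operator := (X -> R[i]) -> (X -> R[i]) -> Prop.
Implicit Types S T : operator.

Definition densely_defined T := forall psi, is_L2 psi ->
  forall e : R, 0 < e -> exists psi' chi, T psi' chi /\
    (Lp_norm 2 (fun x => (psi x - psi' x)%R) < e%:E)%E.

Definition adjoint T : operator := fun psi chi =>
  [/\ is_L2 psi, is_L2 chi &
      forall psi' chi', T psi' chi' -> inner chi' psi = inner psi' chi].

Definition self_adjoint T := densely_defined T /\
  forall psi chi, T psi chi <-> adjoint T psi chi.

Definition nonnegative T := forall psi chi, T psi chi -> 0 <= inner psi chi.

Definition opcomp S T : operator :=
  fun psi chi => exists2 eta, T psi eta & S eta chi.

(* S = T^{1/2}: by the spectral theorem a nonnegative self-adjoint operator has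
   exactly one nonnegative self-adjoint square root. *)
Definition is_sqrt_op S T := [/\ self_adjoint S, nonnegative S &
  forall psi chi, opcomp S S psi chi <-> T psi chi].

(* - Delta_{x_j} + omega^2 |x_j|^2 acting in the sense of distributions, on the
   maximal domain; it is the closure of its restriction to test functions. *)
Definition oscillator (omega : R) j : operator := fun psi chi =>
  [/\ is_L2 psi, is_L2 chi & forall phi, test_function phi ->
    cintegral (fun x => psi x *
      (- laplacian j phi x + omega ^+ 2 * sqlen (row j x) * phi x)%:C%C) =
    cintegral (fun x => chi x * (phi x)%:C%C)].

(* |T psi|^2, with value +oo when psi is not in the domain of T *)
Definition op_sqnorm T psi : \bar R := ereal_inf [set sqnorm chi | chi in T psi].

End L2.

(* [gradient_form ord0 phi] is the square of |grad phi|_2; its finiteness says that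
   phi is in H^1(R^2). *)
Definition gagliardo_nirenberg {R : realType} (C : R) :=
  forall phi : 'rV[R]_2 -> R[i], is_L2 phi -> (gradient_form ord0 phi < +oo)%E ->
  (Lp_norm 4 phi <=
   C%:E * Lp_norm 2 phi `^ 2^-1 * (gradient_form ord0 phi `^ 2^-1) `^ 2^-1)%E.

Definition Cgn (R : realType) : R :=
  inf [set C : R | 0 <= C /\ gagliardo_nirenberg C].

(* Main.v *)
Require Import Defs.
From HB Require Import structures.
From mathcomp Require Import all_boot all_order all_algebra.
From mathcomp Require Import all_classical all_reals all_analysis.
From mathcomp Require Import measurable_realfun.
From mathcomp Require Import perm complex lra ring.

(** The potential energy is controlled by the gradient of a single particle. Write W for -V
    and let means be taken with respect to |psi|^2. It is enough to show that the mean of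
    (1/N) sum_{i<j} N^(2 beta) W(N^beta (x_i - x_j)) is at most alpha N |grad_1 psi|^2 plus a
    constant times N^(2 beta) |psi|^2: by symmetry the kinetic and trapping energy is N times
    that of the first particle, and after division by N the error is of order N^(2 beta - 1),
    hence below C_0 for large N.

    Smear each particle over a square of side l = d N^(-beta). Since V decreases rapidly with
    its gradient, W has a majorant g that absorbs displacements of size d and whose integral is
    at most some k with k C^4 <= 2 alpha, where C is a Gagliardo-Nirenberg constant close to
    the sharp one ([schwartz_majorant], [near_optimal_constant]). Rescaling g and applying Young's
    inequality to the sum F of all the smeared particles gives the pointwise bound
    sum_{i<>j} N^(2 beta) W(N^beta (x_i - x_j)) <= k |F|^2 ([pair_bound]). The square |F|^2 is
    the sum of the overlaps of all pairs of squares; the diagonal overlaps are l^(-2).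

    Let A be the mean of the sum of the overlaps of the first square with the m = N - 1
    others, and u the sum of these others divided by m. With the other particles frozen,
    the Gagliardo-Nirenberg inequality in the first variable bounds A/m by half the mean of
    |u|^2 plus (C^4/2) |grad_1 psi|^2 ([one_body_config]). By symmetry the mean of |u|^2 is again
    expressed by A: it is ((m - 1) A + m l^(-2) |psi|^2) / m^2. The factor one half lets A be
    absorbed, and A <= l^(-2) |psi|^2 + C^4 m |grad_1 psi|^2 ([mean_overlap_le]), which is the
    required bound ([interaction_mean_ge], [hamiltonian_form_ge]).

    The right-hand side of the theorem involves the operator S_1 and not the oscillator form,
    so finite form energy must imply that psi is in the domain of S_1, with |S_1 psi|^2 at most
    that energy ([oscillator_form_ge]). Such a psi is approximated by functions of the domain
    of S_1^2 without increasing the energy in the limit: cutoffs by flat functions ([cutoff])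
    followed by averages over short segments ([mollify]). On the domain of S_1 the
    functional eta |-> <S_1 eta, psi> is then bounded, and the Riesz representation theorem
    together with self-adjointness places psi in the domain ([sqrt_op_dom]).

    Weak derivatives are handled throughout by the identity between the increment of a
    function over a segment and the mean of its weak derivative along it
    ([weakd_increment]). It yields their uniqueness, their restriction to almost every slice,
    and the integration by parts of difference quotients. *)

Set Implicit Arguments.
Unset Strict Implicit.
Unset Printing Implicit Defensive.

Import Order.TTheory GRing.Theory Num.Theory.
Import numFieldNormedType.Exports.

Local Open Scope classical_set_scope.
Local Open Scope ring_scope.

(** * Open boxes and the uniqueness of Lebesgue measure *)

Section boxes.
Context {R : realType} (m n : nat).
Implicit Types a b x : 'M[R]_(m, n).

Definition obox a b : set 'M[R]_(m, n) :=
  [set x | forall i j, a i j < x i j < b i j].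

Definition oboxes : set (set 'M[R]_(m, n)) :=
  [set A | exists a b, A = obox a b].

Lemma oboxI_closed : setI_closed oboxes.
Proof.
move=> _ _ [a [b ->]] [a' [b' ->]].
exists (\matrix_(i, j) Num.max (a i j) (a' i j)).
exists (\matrix_(i, j) Num.min (b i j) (b' i j)).
apply/seteqP; split=> x.
  move=> [h h'] i j; rewrite !mxE gt_max lt_min.
  by have /andP[-> ->] := h i j; have /andP[-> ->] := h' i j.
move=> h; split=> i j; have := h i j; rewrite !mxE gt_max lt_min.
  by move=> /andP[/andP[-> _] /andP[-> _]].
by move=> /andP[/andP[_ ->] /andP[_ ->]].
Qed.

Lemma measurable_obox a b : measurable (obox a b).
Proof.
rewrite (_ : obox a b = \bigcap_(i in [set: 'I_m]) \bigcap_(j in [set: 'I_n])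
    ((fun x : 'M[R]_(m, n) => x i j) @^-1` `]a i j, b i j[%classic)); last first.
  apply/seteqP; split=> x.
    by move=> h i _ j _; rewrite /= in_itv/=; exact: h.
  by move=> h i j; have := h i I j I; rewrite /= in_itv/=.
apply: fin_bigcap_measurable => // i _; apply: fin_bigcap_measurable => // j _.
by rewrite -[X in measurable X]setTI; apply: measurable_mx_coord.
Qed.

Lemma obox_cover : \bigcup_k obox (const_mx (- k%:R)) (const_mx k%:R) = setT.
Proof.
apply/seteqP; split=> // x _.
pose M : R := \sum_i \sum_j `|x i j|.
exists (Num.truncn M).+1 => //.
move=> i j; rewrite !mxE -ltr_norml.
apply: (@le_lt_trans _ _ M); last exact: truncnS_gt.
rewrite /M (bigD1 i)//= (bigD1 j)//= -addrA lerDl addr_ge0// sumr_ge0// => k _.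
by rewrite sumr_ge0.
Qed.

Lemma measurable_oboxesE : (@measurable _ 'M[R]_(m, n)) = <<s oboxes >>.
Proof.
apply/seteqP; split; last first.
  apply: smallest_sub; first exact: sigma_algebra_measurable.
  by move=> _ [a [b ->]]; exact: measurable_obox.
apply: smallest_sub; first exact: smallest_sigma_algebra.
have sbox : sigma_algebra setT <<s oboxes >> by exact: smallest_sigma_algebra.
move=> _ [[i j] _ [B mB <-]]; rewrite setTI.
suff : (@RGenOpens.G R).-sigma.-measurable `<=`
    [set A | <<s oboxes >> (@mx_coord R m n (i, j) @^-1` A)].
  by apply; rewrite -RGenOpens.measurableE.
apply: smallest_sub.
  have [s0 sC sU] := sbox.
  split=> [|A mA|F mF] /=.
  - by rewrite preimage_set0.
  - by rewrite setTD preimage_setC -setTD; exact: sC.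
  - by rewrite preimage_bigcup; exact: sU.
move=> _ [a [b ->]] /=.
pose lo k : 'M[R]_(m, n) :=
  \matrix_(i', j') if (i', j') == (i, j) then a else - k%:R.
pose hi k : 'M[R]_(m, n) :=
  \matrix_(i', j') if (i', j') == (i, j) then b else k%:R.
rewrite (_ : _ @^-1` _ = \bigcup_k obox (lo k) (hi k)).
  have [s0 sC sU] := sbox; apply: sU => k.
  by apply: sub_sigma_algebra; exists (lo k), (hi k).
apply/seteqP; split=> x; rewrite /mx_coord/= in_itv/=.
  move=> xab; have : (\bigcup_k obox (const_mx (- k%:R)) (const_mx k%:R)) x.
    by rewrite obox_cover.
  move=> [k _ kx]; exists k => // i' j'; rewrite !mxE.
  by case: eqP => [[-> ->]//|_]; have := kx i' j'; rewrite !mxE.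
by move=> [k _ /(_ i j)]; rewrite !mxE eqxx.
Qed.

(** Open boxes form a generating pi-system that exhausts the space. *)
Lemma obox_measure_unique
    (mu nu : {measure set 'M[R]_(m, n) -> \bar R}) :
  (forall a b, mu (obox a b) = nu (obox a b)) ->
  (forall a b, (mu (obox a b) < +oo)%E) ->
  forall A, measurable A -> mu A = nu A.
Proof.
move=> munu muoo A mA.
apply: (measure_unique oboxes
  (fun k => obox (const_mx (- k%:R)) (const_mx k%:R))) => //.
- exact: measurable_oboxesE.
- exact: oboxI_closed.
- by move=> k; exists (const_mx (- k%:R)), (const_mx k%:R).
- exact: obox_cover.
- by move=> _ [a [b ->]].
Qed.

(* Open sets are countable unions of boxes with rational corners. *)
Lemma continuous_mx_measurable (f : 'M[R]_(m, n) -> R) :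
  continuous f -> measurable_fun setT f.
Proof.
move=> cf; apply: (measurability (@RGenOpens.G R)).
  exact: RGenOpens.measurableE.
move=> _ [_ [a [b ->]] <-]; rewrite setTI.
have opU : open (f @^-1` `]a, b[%classic).
  by apply: open_comp => //; move=> x _; exact: cf.
set U := f @^-1` _ in opU *.
pose rbox (q : 'M[rat]_(m, n) * 'M[rat]_(m, n)) : set 'M[R]_(m, n) :=
  obox (map_mx ratr q.1) (map_mx ratr q.2).
rewrite (_ : U = \bigcup_(q in [set q | rbox q `<=` U]) rbox q); last first.
  apply/seteqP; split=> [x Ux|x [q /= qU qx]]; last exact: qU.
  have /nbhs_ballP[e /= e0 eU] : nbhs x U by exact: open_nbhs_nbhs.
  have lo i j : exists q : rat, x i j - e < ratr q < x i j.
    have : x i j - e < x i j by rewrite gtrDl oppr_lt0.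
    by move/rat_in_itvoo => [q]; rewrite in_itv; exists q.
  have hi i j : exists q : rat, x i j < ratr q < x i j + e.
    have : x i j < x i j + e by rewrite ltrDl.
    by move/rat_in_itvoo => [q]; rewrite in_itv; exists q.
  exists (\matrix_(i, j) xchoose (lo i j), \matrix_(i, j) xchoose (hi i j)).
    move=> y /= yx; apply: eU; split => // i j.
    have := yx i j; rewrite !mxE => /andP[ly yh].
    have /andP[l1 _] := xchooseP (lo i j).
    have /andP[_ h2] := xchooseP (hi i j).
    rewrite /ball/= ltr_norml; apply/andP; split.
      by rewrite ltrBrDl -ltrBrDr opprK (lt_trans yh).
    by rewrite ltrBlDr -ltrBlDl (lt_trans _ ly)// (lt_le_trans l1).
  move=> i j; rewrite /rbox/= !mxE.
  have /andP[_ ->] := xchooseP (lo i j).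
  by have /andP[-> _] := xchooseP (hi i j).
rewrite bigcup_mkcond; apply: countable_bigcupT_measurable => [|q]; last first.
  by case: ifP => // _; exact: measurable_obox.
exact: countableP.
Qed.

End boxes.

Section lebesgue_boxes.
Context {R : realType}.
Local Notation lambda := (@lebesgue_measure R).

Lemma ord2P (j : 'I_2) : j = ord0 \/ j = ord_max.
Proof.
by case: j => -[|[|//]] j2; [left|right]; exact: val_inj.
Qed.

Lemma lebesgue_plane_obox (a b : 'rV[R]_2) : lebesgue_plane (obox a b) =
  (\prod_(j < 2) lambda `](a ord0 j), (b ord0 j)[)%E.
Proof.
rewrite !big_ord_recl big_ord0 mule1.
rewrite (_ : lift ord0 ord0 = ord_max); last exact: val_inj.
rewrite /lebesgue_plane/= /image_measure/pushforward/=.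
rewrite (_ : _ @^-1` _ = (`](a ord0 ord0), (b ord0 ord0)[%classic `*`
   `](a ord0 ord_max), (b ord0 ord_max)[%classic)).
  by rewrite /prod_measure product_measure1E.
apply/seteqP; split=> -[s t] /=; rewrite /obox/= !in_itv/=.
  by move=> h; have := h ord0 ord0; have := h ord0 ord_max; rewrite !mxE/=.
by move=> [h1 h2] i j; rewrite !mxE ord1; have [->|->] := ord2P j.
Qed.

Lemma leb_succE n (A : set 'M[R]_(n.+1, 2)) :
  leb n.+1 A = (lebesgue_plane \x leb n)%E (@add_particle R n @^-1` A).
Proof. by []. Qed.

Lemma leb_obox n (a b : 'M[R]_(n, 2)) : leb n (obox a b) =
  (\prod_(i < n) \prod_(j < 2) lambda `](a i j), (b i j)[)%E.
Proof.
elim: n a b => [a b|n IHn a b].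
  rewrite big_ord0 /=/dirac indicE mem_set// => i; by case: i.
rewrite leb_succE.
rewrite (_ : _ @^-1` _ =
  obox (usubmx (a : 'M[R]_(1 + n, 2))) (usubmx (b : 'M[R]_(1 + n, 2))) `*`
  obox (dsubmx (a : 'M[R]_(1 + n, 2))) (dsubmx (b : 'M[R]_(1 + n, 2)))).
  rewrite product_measure1E; [|exact: measurable_obox..].
  rewrite [X in (X * _)%E]lebesgue_plane_obox [X in (_ * X)%E]IHn.
  rewrite [RHS]big_ord_recl; congr (_ * _)%E.
    by apply: eq_bigr => j _; rewrite !mxE (_ : lshift n ord0 = ord0)//; exact: val_inj.
  apply: eq_bigr => i _; apply: eq_bigr => j _; rewrite !mxE.
  by rewrite (_ : rshift 1 i = lift ord0 i)//; exact: val_inj.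
apply/seteqP; split=> -[s t] /=; rewrite /add_particle/obox/=.
  move=> h; split=> i j.
    by have := h (lshift n i) j; rewrite (col_mxEu s t) !mxE.
  by have := h (rshift 1 i) j; rewrite (col_mxEd s t) !mxE.
move=> [h1 h2] i j; rewrite -(splitK (i : 'I_(1 + n))).
case: (fintype.split _) => k /=.
  by have := h1 k j; rewrite (col_mxEu s t) !mxE.
by have := h2 k j; rewrite (col_mxEd s t) !mxE.
Qed.

Lemma leb_obox_lty n (a b : 'M[R]_(n, 2)) : (leb n (obox a b) < +oo)%E.
Proof.
have prod_lty I (r : seq I) (F : I -> \bar R) :
    (forall i, (0 <= F i < +oo)%E) -> (0 <= \prod_(i <- r) F i < +oo)%E.
  move=> F0; apply: (big_ind (fun z => 0 <= z < +oo)%E) => [|x y /andP[x0 xoo] /andP[y0 yoo]|i _].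
  - by rewrite ltry lee_fin ler01.
  - by rewrite mule_ge0//= lte_mul_pinfty// ge0_fin_numE.
  - exact: F0.
rewrite leb_obox; set P := (X in (X < _)%E).
suff /andP[] : (0 <= P < +oo)%E by [].
apply: (prod_lty) => i; apply: prod_lty => j; rewrite measure_ge0/= lebesgue_measure_itv/=.
by case: ifP => _; rewrite ?ltry// -EFinB ltry.
Qed.

End lebesgue_boxes.

(** * Measure-preserving maps *)

Section measure_preserving.
Context d (T : measurableType d) (R : realType).
Variable mu : {measure set T -> \bar R}.
Implicit Types f : T -> T.

Definition preserves f := measurable_fun setT f /\
  forall A, measurable A -> mu (f @^-1` A) = mu A.

Variable f : T -> T.
Hypothesis muf : preserves f.

Lemma preserves_ge0_integral (g : T -> \bar R) :
  measurable_fun setT g -> (forall x, 0 <= g x)%E ->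
  (\int[mu]_x g (f x) = \int[mu]_x g x)%E.
Proof.
case: muf => mf fE mg g0.
rewrite -[LHS](_ : \int[pushforward mu f]_x g x = _)%E; last first.
  by rewrite ge0_integral_pushforward// preimage_setT.
by apply: eq_measure_integral => A mA _; exact: fE.
Qed.

Lemma preserves_integral (g : T -> \bar R) : measurable_fun setT g ->
  (\int[mu]_x g (f x) = \int[mu]_x g x)%E.
Proof.
move=> mg; rewrite integralE [RHS]integralE; congr (_ - _)%E.
  rewrite -[RHS](@preserves_ge0_integral (g^\+)%E)//.
    by apply: eq_integral => x _; rewrite !funeposE.
  exact: measurable_funepos.
rewrite -[RHS](@preserves_ge0_integral (g^\-)%E)//.
  by apply: eq_integral => x _; rewrite !funenegE.
exact: measurable_funeneg.
Qed.

Lemma preserves_Rintegral (g : T -> R) : measurable_fun setT g ->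
  \int[mu]_x g (f x) = \int[mu]_x g x.
Proof.
move=> mg; congr fine; apply: (@preserves_integral (EFin \o g)).
exact/measurable_EFinP.
Qed.

End measure_preserving.

Section lebesgue_invariance.
Context {R : realType}.
Local Notation lambda := (@lebesgue_measure R).

Lemma preserves_obox n (f : 'M[R]_(n, 2) -> 'M[R]_(n, 2)) :
  measurable_fun setT f ->
  (forall a b, leb n (f @^-1` obox a b) = leb n (obox a b)) ->
  preserves (leb n) f.
Proof.
move=> mf fE; split=> // A mA.
pose fm : {mfun 'M[R]_(n, 2) >-> 'M[R]_(n, 2)} := HB.pack f
  (isMeasurableFun.Build _ _ _ _ _ mf).
apply: (obox_measure_unique (mu := pushforward (leb n) fm)) => //.
move=> a b; rewrite [X in (X < _)%E](_ : _ = leb n (obox a b)).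
  exact: leb_obox_lty.
exact: fE.
Qed.

Lemma preserves_translation n (v : 'M[R]_(n, 2)) :
  preserves (leb n) (fun x => x + v).
Proof.
apply: preserves_obox.
  apply: measurable_mx => i j; under eq_fun do rewrite mxE.
  apply: measurable_funD => //; exact: measurable_mx_coord.
move=> a b; rewrite (_ : _ @^-1` _ = obox (a - v) (b - v)).
  rewrite !leb_obox; apply: eq_bigr => i _; apply: eq_bigr => j _.
  rewrite !lebesgue_measure_itv/= !mxE !lte_fin ltrD2r.
  by case: ifP => // _; rewrite -!EFinB; congr EFin; ring.
by apply/seteqP; split=> x h i j; have := h i j; rewrite !mxE ltrBlDr ltrBrDr.
Qed.

Lemma preserves_row_perm n (s : 'S_n) : preserves (leb (R := R) n) (row_perm s).
Proof.
apply: preserves_obox.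
  apply: measurable_mx => i j; under eq_fun do rewrite mxE.
  exact: measurable_mx_coord.
move=> a b; rewrite (_ : _ @^-1` _ = obox (row_perm s^-1 a) (row_perm s^-1 b)).
  rewrite !leb_obox (reindex_inj (@perm_inj _ s))/=; apply: eq_bigr => i _.
  by apply: eq_bigr => j _; rewrite !mxE permK.
apply/seteqP; split=> x h i j.
  by have := h (s^-1 i)%g j; rewrite !mxE permKV.
by have := h (s i) j; rewrite !mxE permK.
Qed.

Lemma preserves_opp n : preserves (leb (R := R) n) -%R.
Proof.
apply: preserves_obox.
  apply: measurable_mx => i j; under eq_fun do rewrite mxE.
  by apply: measurableT_comp => //; exact: measurable_mx_coord.
move=> a b; rewrite (_ : _ @^-1` _ = obox (- b) (- a)).
  rewrite !leb_obox; apply: eq_bigr => i _; apply: eq_bigr => j _.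
  rewrite !lebesgue_measure_itv/= !mxE !lte_fin ltrN2.
  by case: ifP => // _; rewrite -!EFinB; congr EFin; ring.
by apply/seteqP; split=> x h i j; have := h i j; rewrite !mxE ltrNl ltrNr andbC.
Qed.

Lemma leb1E (A : set 'rV[R]_2) : measurable A -> leb 1 A = lebesgue_plane A.
Proof.
move=> mA; apply: obox_measure_unique => // a b; last exact: leb_obox_lty.
rewrite [LHS](leb_obox a b) big_ord_recl big_ord0 mule1.
by rewrite [RHS]lebesgue_plane_obox.
Qed.

End lebesgue_invariance.

(** * Square-integrable functions *)

Section L2_space.
Context d (T : measurableType d) (R : realType).
Variable mu : {measure set T -> \bar R}.
Implicit Types f g h : T -> R.

Definition L2 f := measurable_fun setT f /\
  (\int[mu]_x (f x ^+ 2)%:E < +oo)%E.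

Definition dot f g : R := \int[mu]_x (f x * g x).

Lemma L2_measurable f : L2 f -> measurable_fun setT f.
Proof. by case. Qed.

Let measurable_sqr f : measurable_fun setT f ->
  measurable_fun setT (fun x => (f x ^+ 2)%:E).
Proof. by move=> mf; apply/measurable_EFinP; exact: measurable_funX. Qed.

Lemma L2_integrable_mul f g : L2 f -> L2 g ->
  mu.-integrable setT (EFin \o (fun x => f x * g x)).
Proof.
move=> [mf foo] [mg goo]; apply/integrableP; split.
  by apply/measurable_EFinP; exact: measurable_funM.
apply: (@le_lt_trans _ _ (\int[mu]_x ((f x ^+ 2)%:E + (g x ^+ 2)%:E))%E).
  apply: ge0_le_integral => //=.
  - by apply/measurable_EFinP; apply: measurableT_comp => //; exact: measurable_funM.
  - by apply: emeasurable_funD; exact: measurable_sqr.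
  - move=> x _; rewrite -EFinD lee_fin normrM -[f x ^+ 2]real_normK ?num_real//.
    rewrite -[g x ^+ 2]real_normK ?num_real//.
    have := sqr_ge0 (`|f x| - `|g x|); have := mulr_ge0 (normr_ge0 (f x)) (normr_ge0 (g x)).
    nra.
rewrite ge0_integralD//; [|by move=> x _; rewrite lee_fin sqr_ge0|exact: measurable_sqr
  |by move=> x _; rewrite lee_fin sqr_ge0|exact: measurable_sqr].
exact: lte_add_pinfty.
Qed.

Lemma L2D f g : L2 f -> L2 g -> L2 (fun x => f x + g x).
Proof.
move=> Lf Lg; have [mf foo] := Lf; have [mg goo] := Lg.
split; first exact: measurable_funD.
apply: (@le_lt_trans _ _ (\int[mu]_x ((2 * f x ^+ 2)%:E + (2 * g x ^+ 2)%:E))%E).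
  apply: ge0_le_integral => //=.
  - by move=> x _; rewrite lee_fin sqr_ge0.
  - exact/measurable_sqr/measurable_funD.
  - by apply: emeasurable_funD; apply/measurable_EFinP; apply: measurable_funM => //;
      exact: measurable_funX.
  - by move=> x _; rewrite -EFinD lee_fin; have := sqr_ge0 (f x - g x); nra.
rewrite ge0_integralD//; [|by move=> x _; rewrite lee_fin mulr_ge0 ?sqr_ge0
 |by apply/measurable_EFinP; apply: measurable_funM => //; exact: measurable_funX
 |by move=> x _; rewrite lee_fin mulr_ge0 ?sqr_ge0
 |by apply/measurable_EFinP; apply: measurable_funM => //; exact: measurable_funX].
under eq_integral do rewrite EFinM.
under [X in (_ + X)%E]eq_integral do rewrite EFinM.
rewrite !ge0_integralZl//; [|exact: measurable_sqr|by move=> x _; rewrite lee_fin sqr_ge0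
  |exact: measurable_sqr|by move=> x _; rewrite lee_fin sqr_ge0].
apply: lte_add_pinfty; apply: lte_mul_pinfty => //.
Qed.

Lemma L2Z (a : R) f : L2 f -> L2 (fun x => a * f x).
Proof.
move=> [mf foo]; split; first exact: measurable_funM.
under eq_integral do rewrite exprMn EFinM.
rewrite ge0_integralZl//; last 3 first.
- exact: measurable_sqr.
- by move=> x _; rewrite lee_fin sqr_ge0.
- by rewrite lee_fin sqr_ge0.
by apply: lte_mul_pinfty => //; rewrite lee_fin sqr_ge0.
Qed.

Lemma L2N f : L2 f -> L2 (fun x => - f x).
Proof.
by move=> /(L2Z (-1)); rewrite (_ : (fun _ => _) = (fun x => - f x))//;
  apply/funext => x; rewrite mulN1r.
Qed.

Lemma L2B f g : L2 f -> L2 g -> L2 (fun x => f x - g x).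
Proof. by move=> Lf /L2N; exact: L2D. Qed.

Lemma L20 : L2 (fun=> 0).
Proof.
split; first exact: measurable_cst.
by under eq_integral do rewrite expr0n/=; rewrite integral0.
Qed.

Lemma dotC f g : dot f g = dot g f.
Proof. by apply: eq_Rintegral => x _; rewrite mulrC. Qed.

Lemma dotDl f g h : L2 f -> L2 g -> L2 h ->
  dot (fun x => f x + g x) h = dot f h + dot g h.
Proof.
move=> Lf Lg Lh; rewrite /dot -RintegralD//; [|exact: L2_integrable_mul..].
by apply: eq_Rintegral => x _; rewrite mulrDl.
Qed.

Lemma dotZl a f g : L2 f -> L2 g -> dot (fun x => a * f x) g = a * dot f g.
Proof.
move=> Lf Lg; rewrite /dot -RintegralZl//; last exact: L2_integrable_mul.
by apply: eq_Rintegral => x _; rewrite mulrA.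
Qed.

Lemma dotNl f g : L2 f -> L2 g -> dot (fun x => - f x) g = - dot f g.
Proof.
move=> Lf Lg; rewrite -mulN1r -dotZl//; congr dot.
by apply/funext => x; rewrite mulN1r.
Qed.

Lemma dotBl f g h : L2 f -> L2 g -> L2 h ->
  dot (fun x => f x - g x) h = dot f h - dot g h.
Proof. by move=> Lf Lg Lh; rewrite dotDl ?dotNl//; exact: L2N. Qed.

Lemma dotDr f g h : L2 f -> L2 g -> L2 h ->
  dot h (fun x => f x + g x) = dot h f + dot h g.
Proof. by move=> *; rewrite dotC dotDl// !(dotC h). Qed.

Lemma dotZr a f g : L2 f -> L2 g -> dot g (fun x => a * f x) = a * dot g f.
Proof. by move=> *; rewrite dotC dotZl// (dotC g). Qed.

Lemma dotNr f g : L2 f -> L2 g -> dot g (fun x => - f x) = - dot g f.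
Proof. by move=> *; rewrite dotC dotNl// (dotC g). Qed.

Lemma dotBr f g h : L2 f -> L2 g -> L2 h ->
  dot h (fun x => f x - g x) = dot h f - dot h g.
Proof. by move=> *; rewrite dotC dotBl// !(dotC h). Qed.

Lemma dot_ge0 f : 0 <= dot f f.
Proof. by apply: Rintegral_ge0 => x _; rewrite -expr2 sqr_ge0. Qed.

Lemma EFin_dot f : L2 f -> (dot f f)%:E = (\int[mu]_x (f x ^+ 2)%:E)%E.
Proof.
move=> [mf foo]; rewrite /dot/Rintegral; under eq_integral do rewrite -expr2.
by rewrite fineK// ge0_fin_numE// integral_ge0// => x _; rewrite lee_fin sqr_ge0.
Qed.

Lemma dotBB f g : L2 f -> L2 g ->
  dot (fun x => f x - g x) (fun x => f x - g x) =
  dot f f - 2 * dot f g + dot g g.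
Proof.
move=> Lf Lg; have Lfg := L2B Lf Lg.
by rewrite dotBl// !dotBr// (dotC g f); ring.
Qed.

Lemma dotDD f g : L2 f -> L2 g ->
  dot (fun x => f x + g x) (fun x => f x + g x) =
  dot f f + 2 * dot f g + dot g g.
Proof.
move=> Lf Lg; have Lfg := L2D Lf Lg.
by rewrite dotDl// !dotDr// (dotC g f); ring.
Qed.

Lemma cauchy_schwarz f g : L2 f -> L2 g ->
  dot f g ^+ 2 <= dot f f * dot g g.
Proof.
move=> Lf Lg; set a := dot f f; set b := dot f g; set c := dot g g.
have key t : 0 <= a - 2 * t * b + t ^+ 2 * c.
  have := dot_ge0 (fun x => f x - t * g x).
  rewrite dotBB ?dotZr ?dotZl//; [|exact: L2Z..].
  by rewrite -/a -/b -/c => h; apply: le_trans h _; rewrite le_eqVlt; apply/orP; left;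
    apply/eqP; ring.
have c0 : 0 <= c := dot_ge0 g; have a0 : 0 <= a := dot_ge0 f.
have [c00|cn0] := eqVneq c 0.
  have [->|b0] := eqVneq b 0; first by rewrite expr0n/= mulr_ge0.
  have := key ((a + 1) / (2 * b)); rewrite c00 mulr0 addr0.
  rewrite (_ : 2 * _ * b = a + 1); first lra.
  by field.
have := key (b / c); have cp : 0 < c by rewrite lt_def cn0.
rewrite (_ : _ + _ = (a * c - b ^+ 2) / c); last by field.
by rewrite pmulr_lge0 ?invr_gt0// subr_ge0.
Qed.

Lemma normr_dot_le f g (A B : R) : L2 f -> L2 g -> 0 <= A -> 0 <= B ->
  dot f f <= A ^+ 2 -> dot g g <= B ^+ 2 -> `|dot f g| <= A * B.
Proof.
move=> Lf Lg A0 B0 fA gB; rewrite -ler_sqr ?nnegrE ?mulr_ge0//.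
rewrite real_normK ?num_real// (le_trans (cauchy_schwarz Lf Lg))// exprMn.
by rewrite ler_pM ?dot_ge0.
Qed.

Lemma ae_eq_dot f g h k : measurable_fun setT f -> measurable_fun setT g ->
  measurable_fun setT h -> measurable_fun setT k ->
  {ae mu, forall x, f x = g x} -> {ae mu, forall x, h x = k x} ->
  dot f h = dot g k.
Proof.
move=> mf mg mh mk fg hk; congr fine; apply: ae_eq_integral => //=.
- by apply/measurable_EFinP; exact: measurable_funM.
- by apply/measurable_EFinP; exact: measurable_funM.
- by apply: filterS2 fg hk => x -> -> _.
Qed.

End L2_space.

(** * Completeness and the Riesz representation theorem *)

Lemma half_pow_sum (R : realFieldType) (n : nat) :
  \sum_(0 <= k < n) (2^-1 : R) ^+ k = 2 - 2 * 2^-1 ^+ n.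
Proof.
elim: n => [|n IHn]; first by rewrite big_geq// expr0 mulr1 subrr.
by rewrite big_nat_recr//= IHn exprS; field.
Qed.

Section geometric_cauchy.
Context {R : realType}.
Implicit Type a : nat -> R.

(** The sequences a_k - 2 s 2^-k and a_k + 2 s 2^-k are monotone and squeeze
    the limit. *)
Lemma geometric_cauchy a (s : R) : 0 <= s ->
  (forall k, `|a k.+1 - a k| <= s * 2^-1 ^+ k) ->
  cvgn a /\ forall k, `|limn a - a k| <= 2 * s * 2^-1 ^+ k.
Proof.
move=> s0 da.
pose lo k := a k - 2 * s * 2^-1 ^+ k; pose hi k := a k + 2 * s * 2^-1 ^+ k.
have e0 k : 0 <= s * 2^-1 ^+ k by rewrite mulr_ge0// exprn_ge0// invr_ge0.
have lo_nd : nondecreasing_seq lo.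
  apply/nondecreasing_seqP => k; rewrite /lo exprS.
  by have := da k; rewrite ler_norml => /andP[+ _]; lra.
have hi_ni : nonincreasing_seq hi.
  apply/nonincreasing_seqP => k; rewrite /hi exprS.
  by have := da k; rewrite ler_norml => /andP[_ +]; lra.
have lohi k : lo k <= hi k by rewrite /lo /hi; have := e0 k; lra.
have lo_ub : has_ubound (range lo).
  exists (hi 0%N) => _ [k _ <-]; exact: le_trans (lohi k) (hi_ni _ _ (leq0n k)).
have hi_lb : has_lbound (range hi).
  exists (lo 0%N) => _ [k _ <-]; apply: le_trans (lohi k); exact: lo_nd.
have c_lo := nondecreasing_is_cvgn lo_nd lo_ub.
have c_hi := nonincreasing_is_cvgn hi_ni hi_lb.
have c_geo : (fun k => 2 * s * 2^-1 ^+ k) @ \oo --> (0 : R).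
  apply: cvg_geometric; rewrite ger0_norm ?invr_ge0//.
  by rewrite invf_lt1// ltr1n.
have a_lo : a @ \oo --> limn lo.
  rewrite (_ : a = fun k => lo k + 2 * s * 2^-1 ^+ k); last first.
    by apply/funext => k; rewrite subrK.
  by rewrite -[limn lo]addr0; exact: cvgD.
have a_hi : a @ \oo --> limn hi.
  rewrite (_ : a = fun k => hi k - 2 * s * 2^-1 ^+ k); last first.
    by apply/funext => k; rewrite addrK.
  by rewrite -[limn hi]subr0; exact: cvgB.
split; first by apply/cvg_ex; exists (limn lo).
move=> k; rewrite ler_norml; apply/andP; split.
  have := nondecreasing_cvgn_le lo_nd c_lo k.
  by rewrite /lo -(cvg_lim _ a_lo)//; lra.
have := nonincreasing_cvgn_ge hi_ni c_hi k.
by rewrite /hi -(cvg_lim _ a_hi)//; lra.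
Qed.

End geometric_cauchy.

Section L2_completeness.
Context d (T : measurableType d) (R : realType).
Variable mu : {measure set T -> \bar R}.

(** Weighting the squared increments by 4^k keeps their sum G integrable; where
    G is finite the sequence is Cauchy at a geometric rate. *)
Lemma L2_complete (f : nat -> T -> R) :
  (forall k, L2 mu (f k)) ->
  (forall k, dot mu (fun x => f k.+1 x - f k x) (fun x => f k.+1 x - f k x) <=
     (16^-1) ^+ k) ->
  exists2 g, L2 mu g & forall k,
    dot mu (fun x => g x - f k x) (fun x => g x - f k x) <= 8 * (4^-1) ^+ k.
Proof.
move=> Lf df.
pose D k x := f k.+1 x - f k x.
have LD k : L2 mu (D k) by exact: L2B.
pose t k x := ((4 ^+ k * D k x ^+ 2)%:E : \bar R).
have t0 k x : (0 <= t k x)%E by rewrite /t lee_fin mulr_ge0 ?sqr_ge0// exprn_ge0.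
have mt k : measurable_fun setT (t k).
  apply/measurable_EFinP; apply: measurable_funM => //; apply: measurable_funX.
  exact: L2_measurable (LD k).
pose G x := (\sum_(k <oo) t k x)%E.
have G0 x : (0 <= G x)%E by apply: nneseries_ge0 => k _ _; exact: t0.
have mG : measurable_fun setT G by apply: ge0_emeasurable_sum => //.
have intG : (\int[mu]_x G x <= 2%:E)%E.
  rewrite integral_nneseries//.
  apply: lime_le.
    by apply: is_cvg_nneseries => k _ _; apply: integral_ge0 => x _; exact: t0.
  apply: nearW => n.
  apply: (@le_trans _ _ (\sum_(0 <= k < n) ((2^-1 : R) ^+ k)%:E)%E).
    apply: lee_sum => k _; rewrite /t.
    under eq_integral do rewrite EFinM.
    rewrite ge0_integralZl//; last 2 first.
    - by apply/measurable_EFinP/measurable_funX; exact: L2_measurable (LD k).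
    - by move=> x _; rewrite lee_fin sqr_ge0.
    rewrite -EFin_dot// -EFinM lee_fin.
    apply: (@le_trans _ _ (4 ^+ k * 16^-1 ^+ k)).
      by rewrite ler_wpM2l ?exprn_ge0// df.
    rewrite -exprMn lerXn2r ?nnegrE ?divr_ge0 ?invr_ge0// ?mulr_ge0 ?invr_ge0//.
    by lra.
  rewrite sumEFin lee_fin half_pow_sum lerBlDr lerDl.
  by rewrite mulr_ge0// exprn_ge0// invr_ge0.
pose A := [set x | (G x < +oo)%E].
have mA : measurable A.
  by rewrite -[A]setTI; apply: measurable_lte => //; exact: measurable_cst.
have aeA : {ae mu, forall x, A x}.
  have iG : mu.-integrable setT G.
    apply/integrableP; split => //.
    under eq_integral do rewrite gee0_abs//.
    by rewrite (le_lt_trans intG) ?ltry.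
  have := integrable_ae measurableT iG; apply: filterS => x /(_ I).
  by rewrite /A/= ge0_fin_numE.
have stepA x : A x -> forall k,
    `|f k.+1 x - f k x| <= Num.sqrt (fine (G x)) * 2^-1 ^+ k.
  move=> Ax k; have tG : (t k x <= G x)%E.
    rewrite /G; apply: le_trans (nneseries_lim_ge k.+1 _) => //.
    rewrite big_nat_recr//= leeDr// sume_ge0// => i _; exact: t0.
  have : 4 ^+ k * D k x ^+ 2 <= fine (G x).
    by rewrite -lee_fin fineK// ge0_fin_numE.
  move=> h; rewrite -ler_sqr ?nnegrE ?mulr_ge0 ?sqrtr_ge0 ?exprn_ge0 ?invr_ge0//.
  rewrite real_normK ?num_real// exprMn sqr_sqrtr ?fine_ge0//.
  rewrite -exprM mulnC exprM (_ : 2^-1 ^+ 2 = 4^-1); last by field.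
  by rewrite exprVn ler_pdivlMr ?exprn_gt0// mulrC.
pose h k x := f k x * \1_A x.
have h_step x : exists2 s, 0 <= s & forall k, `|h k.+1 x - h k x| <= s * 2^-1 ^+ k.
  have [Ax|nAx] := pselect (A x).
    exists (Num.sqrt (fine (G x))); first exact: sqrtr_ge0.
    by move=> k; rewrite /h indicE mem_set// !mulr1; exact: stepA.
  by exists 0 => // k; rewrite /h indicE memNset// !mulr0 subrr normr0 mul0r.
pose g x := limn (h ^~ x).
have h_cvg x : h ^~ x @ \oo --> g x.
  by have [s s0 hs] := h_step x; have [] := geometric_cauchy s0 hs.
have mh k : measurable_fun setT (h k).
  apply: measurable_funM; first exact: L2_measurable (Lf k).
  exact: measurable_indic.
have mg : measurable_fun setT g.
  exact: (measurable_fun_cvg mh).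
have gA x : A x -> forall k, (g x - f k x) ^+ 2 <= 4 * (4^-1 ^+ k) * fine (G x).
  move=> Ax k; have hE j : h j x = f j x by rewrite /h indicE mem_set// mulr1.
  have hs j : `|h j.+1 x - h j x| <= Num.sqrt (fine (G x)) * 2^-1 ^+ j.
    by rewrite !hE; exact: stepA.
  have [_ /(_ k)] := geometric_cauchy (sqrtr_ge0 _) hs.
  rewrite -/(g x) hE -ler_sqr ?nnegrE ?mulr_ge0 ?sqrtr_ge0 ?exprn_ge0 ?invr_ge0//.
  rewrite real_normK ?num_real// !exprMn sqr_sqrtr ?fine_ge0//.
  rewrite -exprM mulnC exprM (_ : 2^-1 ^+ 2 = 4^-1); last by field.
  by move=> hh; apply: le_trans hh _; rewrite le_eqVlt; apply/orP; left; apply/eqP; ring.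
have bound k : (\int[mu]_x ((g x - f k x) ^+ 2)%:E <= (8 * 4^-1 ^+ k)%:E)%E.
  apply: (@le_trans _ _ (\int[mu]_x ((4 * 4^-1 ^+ k)%:E * G x))%E).
    apply: ae_ge0_le_integral => //.
    - by move=> x _; rewrite lee_fin sqr_ge0.
    - apply/measurable_EFinP/measurable_funX/measurable_funB => //.
      exact: L2_measurable (Lf k).
    - by move=> x _; apply: mule_ge0.
    - exact: emeasurable_funM.
    - apply: filterS aeA => x Ax _.
      rewrite -[G x]fineK ?ge0_fin_numE// -EFinM lee_fin; exact: gA.
  rewrite ge0_integralZl//.
  apply: (@le_trans _ _ ((4 * 4^-1 ^+ k)%:E * 2%:E)%E).
    by rewrite lee_wpmul2l// lee_fin mulr_ge0// exprn_ge0// invr_ge0.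
  by rewrite -EFinM lee_fin; lra.
have Lgf k : L2 mu (fun x => g x - f k x).
  split; first by apply: measurable_funB => //; exact: L2_measurable (Lf k).
  by rewrite (le_lt_trans (bound k)) ?ltry.
exists g.
  have := L2D (Lgf 0%N) (Lf 0%N); congr L2; apply/funext => x; ring.
by move=> k; rewrite -lee_fin EFin_dot.
Qed.

End L2_completeness.

Section riesz_representation.
Context (R : realType) (V : lmodType R) (H : set V) (b : V -> V -> R).
Hypothesis H_lin : forall a u v, H u -> H v -> H (a *: u + v).
Hypothesis bC : forall u v, b u v = b v u.
Hypothesis b_lin : forall a u v w, H u -> H v -> H w ->
  b (a *: u + v) w = a * b u w + b v w.
Hypothesis b_ge0 : forall u, H u -> 0 <= b u u.
Hypothesis b_complete : forall u : nat -> V, (forall k, H (u k)) ->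
  (forall k, b (u k.+1 - u k) (u k.+1 - u k) <= 16^-1 ^+ k) ->
  exists2 v, H v & forall e : R, 0 < e ->
    exists N, forall k, (N <= k)%N -> b (v - u k) (v - u k) <= e.

Variables (D : set V) (l : V -> R) (Q : R).
Hypothesis DH : D `<=` H.
Hypothesis D0 : D 0.
Hypothesis D_lin : forall a u v, D u -> D v -> D (a *: u + v).
Hypothesis l_lin : forall a u v, D u -> D v -> l (a *: u + v) = a * l u + l v.
Hypothesis l_bounded : forall u, D u -> l u ^+ 2 <= Q * b u u.

Let J u := 2 * l u - b u u.

Let b_linr a u v w : H u -> H v -> H w -> b w (a *: u + v) = a * b w u + b w v.
Proof. by move=> *; rewrite bC b_lin// !(bC w). Qed.

Let HN u v : H u -> H v -> H (u - v).
Proof. by move=> Hu Hv; rewrite addrC -scaleN1r; exact: H_lin. Qed.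

Let b_expand t u v : H u -> H v ->
  b (t *: u + v) (t *: u + v) = t ^+ 2 * b u u + 2 * t * b u v + b v v.
Proof.
move=> Hu Hv; have Huv := H_lin t Hu Hv.
by rewrite b_lin// !b_linr// (bC v u); ring.
Qed.

Let b_sub u v : H u -> H v -> b (u - v) (u - v) = b u u - 2 * b u v + b v v.
Proof.
move=> Hu Hv; rewrite addrC -scaleN1r b_expand// (bC v u).
by ring.
Qed.

Let CS u v : H u -> H v -> b u v ^+ 2 <= b u u * b v v.
Proof.
move=> Hu Hv; set x := b u u; set y := b u v; set z := b v v.
have key t : 0 <= t ^+ 2 * x + 2 * t * y + z.
  by rewrite -b_expand//; apply/b_ge0/H_lin.
have x0 : 0 <= x := b_ge0 Hu; have z0 : 0 <= z := b_ge0 Hv.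
have [x00|xn0] := eqVneq x 0.
  have [->|y0] := eqVneq y 0; first by rewrite expr0n/= mulr_ge0.
  have := key (- (z + 1) / (2 * y)); rewrite x00 mulr0 add0r.
  rewrite (_ : 2 * _ * y = - (z + 1)); first lra.
  by field.
have := key (- y / x); have xp : 0 < x by rewrite lt_def xn0.
rewrite (_ : _ + _ = (x * z - y ^+ 2) / x); last by field.
by rewrite pmulr_lge0 ?invr_gt0// subr_ge0.
Qed.

(** A maximising sequence of J u = 2 l u - b u u on D is Cauchy by the
    parallelogram law, and its limit represents l. *)
Lemma riesz : 0 <= Q ->
  exists xi, [/\ H xi, b xi xi <= Q & forall u, D u -> l u = b u xi].
Proof.
move=> Q0.
have l0 : l 0 = 0 by have := l_lin 1 D0 D0; rewrite scaler0 addr0; lra.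
have J_ub u : D u -> J u <= Q.
  move=> Du; have bu := b_ge0 (DH Du); have lu := l_bounded Du; rewrite /J.
  have : (2 * l u) ^+ 2 <= (Q + b u u) ^+ 2 by have := sqr_ge0 (Q - b u u); nra.
  rewrite -[X in X <= _]real_normK ?num_real// ler_sqr ?nnegrE ?addr_ge0//.
  by move=> /(le_trans (ler_norm _)); lra.
pose s := sup [set J u | u in D].
have hs : has_sup [set J u | u in D].
  by split; [exists (J 0), 0|exists Q => _ [u Du <-]; exact: J_ub].
have Js u : D u -> J u <= s by move=> Du; apply: (ub_le_sup hs.2); exists u.
have sQ : s <= Q by apply: ge_sup; [exact: hs.1|move=> _ [u Du <-]; exact: J_ub].
have maxi k : exists u, D u /\ s - 64^-1 * 16^-1 ^+ k < J u.
  have e0 : 0 < 64^-1 * 16^-1 ^+ k :> R by rewrite mulr_gt0 ?exprn_gt0 ?invr_gt0.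
  have [_ [u Du <-] h] := sup_adherent e0 hs.
  by exists u.
have [u hu] := choice maxi.
have Du k : D (u k) by case: (hu k).
have Ju k : s - 64^-1 * 16^-1 ^+ k < J (u k) by case: (hu k).
have Hu k : H (u k) by exact/DH.
have H0 : H 0 by exact: DH.
have DZ a v : D v -> D (a *: v) by move=> Dv; rewrite -[_ *: _]addr0; exact: D_lin.
have lZ a v : D v -> l (a *: v) = a * l v.
  by move=> Dv; rewrite -[_ *: _]addr0 l_lin// l0 addr0.
have b0 v : H v -> b 0 v = 0.
  by move=> Hv; have := b_lin 1 H0 H0 Hv; rewrite scaler0 addr0; lra.
have bZ a v w : H v -> H w -> b (a *: v) w = a * b v w.
  by move=> Hv Hw; rewrite -[_ *: _]addr0 b_lin// b0// addr0.
have [xi Hxi cxi] : exists2 v, H v & forall e : R, 0 < e ->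
    exists N, forall k, (N <= k)%N -> b (v - u k) (v - u k) <= e.
  apply: b_complete => // k.
  have Du1 := Du k.+1; have Duk := Du k.
  pose m := 2^-1 *: (u k.+1) + 2^-1 *: u k.
  have Dm : D m by apply: D_lin => //; exact: DZ.
  have lm : l m = 2^-1 * l (u k.+1) + 2^-1 * l (u k).
    by rewrite /m l_lin// ?lZ//; exact: DZ.
  have bm : b m m = 4^-1 * b (u k.+1) (u k.+1) + 2^-1 * b (u k.+1) (u k)
      + 4^-1 * b (u k) (u k).
    have Hh : H (2^-1 *: u k) by exact/DH/DZ.
    rewrite /m b_expand// (bC _ (2^-1 *: _)) !bZ// (bC _ (2^-1 *: _)) bZ//.
    by rewrite (bC (u k)); field.
  have := Js _ Dm; have := Ju k.+1; have := Ju k; rewrite /J lm bm b_sub//.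
  have : 16^-1 ^+ k.+1 <= 16^-1 ^+ k :> R.
    by rewrite exprS ler_piMl ?exprn_ge0 ?invr_ge0// invf_le1// ler1n.
  have : 0 <= 16^-1 ^+ k :> R by rewrite exprn_ge0// invr_ge0.
  by lra.
have bxi v e : D v -> 0 < e -> exists N, forall k, (N <= k)%N ->
    `|b v xi - b v (u k)| <= e.
  move=> Dv e0.
  have bv1 : 0 < b v v + 1 by rewrite ltr_wpDl// b_ge0//; exact: DH.
  have [|N hN] := cxi (e ^+ 2 / (b v v + 1)); first by rewrite divr_gt0 ?exprn_gt0.
  exists N => k /hN hk.
  have -> : b v xi - b v (u k) = b v (xi - u k).
    by rewrite [xi - _]addrC -scaleN1r b_linr//; [ring|exact: DH].
  rewrite -ler_sqr ?nnegrE ?(ltW e0)// real_normK ?num_real//.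
  rewrite (le_trans (CS _ _))//.
  - exact: DH.
  - exact: HN.
  apply: (@le_trans _ _ (b v v * (e ^+ 2 / (b v v + 1)))).
    by rewrite ler_wpM2l// b_ge0//; exact: DH.
  rewrite mulrA ler_pdivrMr// mulrC ler_wpM2l ?sqr_ge0//; lra.
have bound t v : D v -> 2 * t * (l v - b v xi) <= t ^+ 2 * b v v.
  move=> Dv; have [//|] := leP (2 * t * (l v - b v xi)) (t ^+ 2 * b v v).
  rewrite -subr_gt0 => e0; set e := _ - _ in e0.
  pose e' := e / (4 * (`|t| + 1)).
  have t1 : 0 < `|t| + 1 by rewrite ltr_wpDl.
  have e'0 : 0 < e' by rewrite divr_gt0// mulr_gt0.
  have [N hN] := bxi v e' Dv e'0.
  have [K hK] : exists K, 64^-1 * 16^-1 ^+ K <= e / 4.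
    exists (Num.truncn e^-1); set K := Num.truncn _.
    have eK : e^-1 < 16 ^+ K.
      rewrite (lt_le_trans (truncnS_gt _))// -natrX ler_nat; exact: ltn_expl.
    have : 16^-1 ^+ K <= e.
      by rewrite exprVn -[e]invrK lef_pV2 ?posrE ?invr_gt0 ?exprn_gt0// ltW.
    lra.
  pose k := maxn N K.
  have := hN k (leq_maxl _ _).
  have : 64^-1 * 16^-1 ^+ k <= e / 4.
    apply: le_trans hK; rewrite ler_wpM2l ?invr_ge0//.
    by rewrite ler_wiXn2l ?invr_ge0 ?leq_maxr// invf_le1// ler1n.
  have := Js _ (D_lin t Dv (Du k)); rewrite /J l_lin// b_expand//; last exact: DH.
  have := Ju k; rewrite /J => h1 h2 h3 h4.
  have : 2 * t * (b v (u k) - b v xi) <= e / 2.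
    apply: (@le_trans _ _ (2 * `|t| * e')).
      rewrite -!mulrA ler_pM2l// (le_trans (ler_norm _))// normrM ler_wpM2l//.
      by rewrite distrC.
    rewrite /e' mulrA ler_pdivrMr ?mulr_gt0//.
    have := normr_ge0 t; nra.
  move=> h5; have eE : e = 2 * t * (l v - b v xi) - t ^+ 2 * b v v by [].
  by clearbody e; lra.
exists xi.
have rep v : D v -> l v = b v xi.
  move=> Dv; apply/eqP; rewrite -subr_eq0; apply/negPn/negP => x0.
  have := bound ((l v - b v xi) / (b v v + 1)) v Dv.
  set x := l v - b v xi in x0 *; set c := b v v.
  have c0 : 0 <= c by exact/b_ge0/DH.
  have c1 : 0 < c + 1 by rewrite ltr_wpDl.
  have x2 : 0 < x ^+ 2 by rewrite lt_def sqrf_eq0 x0 sqr_ge0.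
  rewrite (_ : 2 * _ * x = (2 * x ^+ 2 * (c + 1)) / (c + 1) ^+ 2); last first.
    by field; rewrite gt_eqF.
  rewrite expr_div_n [X in _ <= X -> _]mulrAC ler_pM2r ?invr_gt0 ?exprn_gt0//.
  by nra.
split => //; apply/ler_addgt0Pr => e e0.
have [N /(_ N (leqnn N))] := cxi e e0.
rewrite b_sub// (bC xi (u N)) -(rep (u N))//; have := J_ub _ (Du N); rewrite /J; lra.
Qed.

End riesz_representation.

(** * Smooth bump functions *)

Lemma scaleR1 (R : pzRingType) (h : R) : h *: (1 : R^o) = h.
Proof. exact: mulr1. Qed.

Section derive_cvg.
Context {R : realType} {V : normedModType R}.
Implicit Types (f : V -> R) (x v : V) (l : R).

Lemma is_derive_cvgP f x v l : is_derive x v f l <->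
  (fun h : R => h^-1 * (f (h *: v + x) - f x)) @ 0^' --> l.
Proof.
split=> [[fd <-]|h]; first exact: fd.
by apply: DeriveDef; [apply/cvg_ex; exists l|exact: cvg_lim].
Qed.

(** Reduces differentiation of functions of several particles to one variable. *)
Lemma is_derive_line f x v l :
  is_derive x v f l <-> is_derive (0 : R) (1 : R) (fun t : R => f (t *: v + x)) l.
Proof.
have E : (fun h : R => h^-1 * (f (h *: v + x) - f x)) =
    (fun h : R => h^-1 * (f ((h *: (1 : R^o) + 0) *: v + x) - f (0 *: v + x))).
  by apply/funext => h; rewrite scale0r add0r addr0 scaleR1.
split; first by move/is_derive_cvgP; rewrite E => h; apply: DeriveDef;
  [apply/cvg_ex; exists l|exact: cvg_lim].
by move=> [fd <-]; apply/is_derive_cvgP; rewrite E; exact: fd.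
Qed.

Lemma is_derive_along_line f (x v : V) (l t : R) :
  is_derive (t *: v + x) v f l ->
  is_derive (t : R) (1 : R) (fun t : R => f (t *: v + x)) l.
Proof.
move=> /is_derive_cvgP h.
have E : (fun h : R => h^-1 * (f (h *: v + (t *: v + x)) - f (t *: v + x))) =
    (fun h : R => h^-1 * (f ((h *: (1 : R^o) + t) *: v + x) - f (t *: v + x))).
  by apply/funext => k; rewrite scaleR1 scalerDl addrA.
by rewrite E in h; apply: DeriveDef; [apply/cvg_ex; exists l|exact: cvg_lim].
Qed.

End derive_cvg.

Section flat_functions.
Context {R : realType}.
Implicit Types (p : {poly R}) (t s : R).

(** These functions p(1/t) exp(-1/t), extended by 0 to t <= 0, form a family
    that is stable under differentiation; p = 1 is the standard example of a
    smooth function vanishing to infinite order at 0. *)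
Definition flat p t : R := if 0 < t then p.[t^-1] * expR (- t^-1) else 0.

Lemma poly_expR_bounded p :
  exists2 C, 0 <= C & forall s, 0 <= s -> `|p.[s]| * expR (- s) <= C.
Proof.
have mono n s : 0 <= s -> s ^+ n * expR (- s) <= n`!%:R.
  move=> s0; rewrite expRN ler_pdivrMr ?expR_gt0//.
  case: n => [|n].
    by rewrite expr0 fact0 mul1r (le_trans _ (expR_ge1Dx _))// lerDl.
  have := expR_ge1Dxn n s0.
  have f0 : 0 < (n.+1)`!%:R :> R by rewrite ltr0n fact_gt0.
  rewrite -(ler_pM2l f0); apply: le_trans.
  by rewrite mulrDr mulr1 mulrCA divff ?gt_eqF// mulr1 lerDr ltW.
exists (\sum_(i < size p) `|p`_i| * i`!%:R).
  by apply: sumr_ge0 => i _; rewrite mulr_ge0.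
move=> s s0; rewrite horner_coef.
apply: (@le_trans _ _ ((\sum_(i < size p) `|p`_i| * s ^+ i) * expR (- s))).
  rewrite ler_wpM2r ?expR_ge0// (le_trans (ler_norm_sum _ _ _))//.
  by apply: ler_sum => i _; rewrite normrM [`|s ^+ _|]ger0_norm// exprn_ge0.
rewrite mulr_suml; apply: ler_sum => i _; rewrite -mulrA.
by rewrite ler_wpM2l// mono.
Qed.

Lemma flat_bounded p : exists2 C, 0 <= C & forall t, `|flat p t| <= C.
Proof.
have [C C0 hC] := poly_expR_bounded p; exists C => // t; rewrite /flat.
case: ifPn => [t0|_]; last by rewrite normr0.
by rewrite normrM [`|expR _|]ger0_norm ?expR_ge0// hC// invr_ge0 ltW.
Qed.

Lemma is_derive_flat p t :
  is_derive t 1 (flat p) (flat ('X^2 * (p - p^`())) t).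
Proof.
have [t0|t0|->] := ltgtP t 0.
- rewrite {2}/flat ltNge ltW//=.
  apply: (@near_eq_is_derive _ _ _ (fun=> 0)).
    by near=> s; rewrite /flat ltNge ltW//=; near: s; exact: lt_nbhsl.
- rewrite {2}/flat t0.
  apply: (@near_eq_is_derive _ _ _ (fun s => p.[s^-1] * expR (- s^-1))).
    by near=> s; rewrite /flat ifT//; near: s; exact: lt_nbhsr.
  have tn0 : t != 0 by rewrite gt_eqF.
  have dV : is_derive t (1 : R) (fun s : R => s^-1) (- t^-1 ^+ 2).
    have := @is_deriveV R id t 1 1; rewrite /= => /(_ tn0 (is_derive_id _ _)).
    by rewrite scaleR1 exprVn.
  have dp : is_derive t (1 : R) (fun s : R => p.[s^-1]) (- t^-1 ^+ 2 * p^`().[t^-1]).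
    by apply: is_derive_eq; rewrite mulrC.
  have de : is_derive t (1 : R) (fun s : R => expR (- s^-1))
      (t^-1 ^+ 2 * expR (- t^-1)).
    by apply: is_derive_eq; rewrite opprK mulrC.
  rewrite (_ : (_ * _)%R = p.[t^-1] *: (t^-1 ^+ 2 * expR (- t^-1)) +
      expR (- t^-1) *: (- t^-1 ^+ 2 * p^`().[t^-1])).
    exact: (is_deriveM dp de).
  by rewrite !hornerE/= /GRing.scale/=; ring.
- rewrite {2}/flat ltxx; apply/is_derive_cvgP.
  have [C C0 hC] := poly_expR_bounded (p * 'X^2).
  have bnd h : `|h^-1 * (flat p (h *: 1 + 0) - flat p 0)| <= C * `|h|.
    rewrite addr0 scaleR1 [X in _ - X]/flat ltxx subr0 /flat.
    case: ifPn => [h0|_]; last by rewrite mulr0 normr0 mulr_ge0.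
    have := hC h^-1; rewrite invr_ge0 ltW// => /(_ isT).
    rewrite hornerM hornerXn !normrM [`|expR _|]ger0_norm ?expR_ge0// => k.
    have hn0 : `|h| != 0 by rewrite normr_eq0 gt_eqF.
    apply: le_trans (ler_wpM2r (normr_ge0 h) k).
    by rewrite !normrV ?unitfE ?gt_eqF// le_eqVlt; apply/orP; left; apply/eqP; field.
  apply/cvgr0Pnorm_le => e e0.
  have C1 : 0 < C + 1 by rewrite ltr_wpDl.
  near=> h; apply: le_trans (bnd h) _.
  apply: (@le_trans _ _ ((C + 1) * `|h|)); first by rewrite ler_wpM2r ?lerDl.
  rewrite mulrC -ler_pdivlMr// ltW//; near: h.
  by apply: dnbhs0_lt; rewrite divr_gt0.
Unshelve. all: by end_near. Qed.

Lemma flat_continuous p : continuous (flat p).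
Proof.
move=> t; apply/differentiable_continuous/derivable1_diffP.
by have [] := is_derive_flat p t.
Qed.

End flat_functions.

Section smooth_functions.
Context {R : realType} {n : nat}.
Local Notation X := 'M[R]_(n, 2).
Implicit Types f g h : X -> R.

Let contM f g : continuous f -> continuous g -> continuous (fun x => f x * g x).
Proof. by move=> cf cg x; exact: (cvgM (cf x) (cg x)). Qed.

Let contD f g : continuous f -> continuous g -> continuous (fun x => f x + g x).
Proof. by move=> cf cg x; exact: (cvgD (cf x) (cg x)). Qed.

Let contC (c : R) : continuous (fun _ : X => c).
Proof. exact: cst_continuous. Qed.

(** Smoothness speaks of all iterated derivatives at once, so it is enough to
    exhibit a class of differentiable functions closed under the derivatives. *)
Lemma smooth_coind (P : (X -> R) -> Prop) :
  (forall f, P f -> [/\ continuous f,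
     forall x j k, derivable f x (delta_mx j k) &
     forall j k, P ('D_(delta_mx j k) f)]) ->
  forall f, P f -> smooth f.
Proof.
move=> H f Pf s; suff /H[? ? _] : P (pder s f) by [].
by elim: s => [//|[j k] s IHs] /=; have [_ _] := H _ IHs; apply.
Qed.

Lemma pder_cat (s t : seq ('I_n * 'I_2)) f : pder (s ++ t) f = pder s (pder t f).
Proof. by rewrite /pder foldr_cat. Qed.

Lemma smooth_pder s f : smooth f -> smooth (pder s f).
Proof. by move=> sf t; rewrite -pder_cat; exact: sf. Qed.

Lemma smooth_continuous f : smooth f -> continuous f.
Proof. by move=> /(_ [::])[]. Qed.

Lemma smooth_derivable f x j k : smooth f -> derivable f x (delta_mx j k).
Proof. by move=> /(_ [::])[_]; apply. Qed.

Lemma smooth_measurable f : smooth f -> measurable_fun setT f.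
Proof. by move=> /smooth_continuous; exact: continuous_mx_measurable. Qed.

Lemma smooth_is_derive f x j k : smooth f ->
  is_derive x (delta_mx j k) f (pder [:: (j, k)] f x).
Proof. by move=> sf; apply: DeriveDef => //; exact: smooth_derivable. Qed.

Lemma is_derive_flat_coord q (K c d : R) (i j : 'I_n) (l k : 'I_2) (x : X) :
  is_derive x (delta_mx j k) (fun x : X => K * flat q (c + d * x i l))
    (K * (d * ((i == j) && (l == k))%:R) *
      flat ('X^2 * (q - q^`())) (c + d * x i l)).
Proof.
apply/is_derive_line.
have -> : (fun t : R => K * flat q (c + d * (t *: delta_mx j k + x) i l)) =
   (fun t : R => K * flat q ((c + d * x i l) + (d * ((i == j) && (l == k))%:R) * t)).
  by apply/funext => t; rewrite !mxE; congr (_ * flat _ _); ring.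
set a := c + _; set b := d * _.
have db : is_derive (0 : R) (1 : R) (fun t : R => a + b * t) b.
  by apply: is_derive_eq; rewrite /GRing.scale/=; ring.
have := is_derive_flat q (a + b * 0); rewrite mulr0 addr0 => df.
have df' : is_derive (a + b * 0) 1 (flat q) (flat ('X^2 * (q - q^`())) a).
  by rewrite mulr0 addr0.
have := @is_derive1_comp R (flat q) (fun t => a + b * t) 0 _ _ df' db.
move=> dc; apply: is_derive_eq; rewrite /GRing.scale/=; ring.
Qed.

Lemma smooth_flat p (c d : R) (i : 'I_n) (l : 'I_2) :
  smooth (fun x : X => flat p (c + d * x i l)).
Proof.
pose P f := exists q K, f = fun x : X => K * flat q (c + d * x i l).
apply: (@smooth_coind P); last by exists p, 1; apply/funext => x; rewrite mul1r.
move=> _ [q [K ->]]; split.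
- apply: contM; first exact: contC.
  move=> x; apply: (@continuous_comp _ _ _ (fun x : X => c + d * x i l) (flat q)).
    apply: (contD (@contC c) (contM (@contC d) _)); exact: coord_continuous.
  exact: flat_continuous.
- by move=> x j k; have [] := is_derive_flat_coord q K c d i j l k x.
- move=> j k; exists ('X^2 * (q - q^`())), (K * (d * ((i == j) && (l == k))%:R)).
  by apply/funext => x; have [] := is_derive_flat_coord q K c d i j l k x.
Qed.

Lemma smooth_cst (c : R) : smooth (fun _ : X => c).
Proof.
apply: (@smooth_coind (fun f => exists c, f = fun=> c)); last by exists c.
move=> _ [{}c ->]; split.
- exact: contC.
- by move=> x j k; exact: derivable_cst.
- by move=> j k; exists 0; apply/funext => x; rewrite derive_cst.
Qed.

(** The derivatives of a product leave the class of products, but not this one. *)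
Inductive sum_of_products : (X -> R) -> Prop :=
| product_of f g of smooth f & smooth g : sum_of_products (fun x => f x * g x)
| sum_of f g of sum_of_products f & sum_of_products g :
    sum_of_products (fun x => f x + g x).

Lemma smooth_sum_of_products h : sum_of_products h -> smooth h.
Proof.
apply: smooth_coind => {}h; elim=> [f g sf sg|f g _ [cf df Pf] _ [cg dg Pg]].
  have derM x j k := is_deriveM (smooth_is_derive x j k sf) (smooth_is_derive x j k sg).
  split.
  - by apply: contM; exact: smooth_continuous.
  - by move=> x j k; have [] := derM x j k.
  - move=> j k; rewrite (_ : 'D__ _ =
      fun x => f x * pder [:: (j, k)] g x + pder [:: (j, k)] f x * g x); last first.
      apply/funext => x; have [_ ->] := derM x j k.
      by rewrite /GRing.scale/= [g x * _]mulrC.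
    by apply: sum_of; apply: product_of => //; exact: smooth_pder.
split.
- exact: contD.
- by move=> x j k; exact: derivableD.
- move=> j k; rewrite (_ : 'D__ _ =
    fun x => 'D_(delta_mx j k) f x + 'D_(delta_mx j k) g x); last first.
    by apply/funext => x; rewrite -deriveD.
  by apply: sum_of.
Qed.

Lemma smoothM f g : smooth f -> smooth g -> smooth (fun x => f x * g x).
Proof. by move=> sf sg; apply/smooth_sum_of_products/product_of. Qed.

Lemma smooth_prod (I : Type) (r : seq I) (F : I -> X -> R) :
  (forall i, smooth (F i)) -> smooth (fun x => \prod_(i <- r) F i x).
Proof.
move=> sF; elim: r => [|i r IHr].
  by under eq_fun do rewrite big_nil; exact: smooth_cst.
by under eq_fun do rewrite big_cons; exact: smoothM.
Qed.

End smooth_functions.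

(** * The fundamental lemma of the calculus of variations *)

Section density.
Local Open Scope ereal_scope.
Context d (T : measurableType d) (R : realType).
Variables (mu : {measure set T -> \bar R}) (g : T -> \bar R).
Hypotheses (mg : measurable_fun setT g) (g_ge0 : forall x, 0 <= g x).

Definition density of measurable_fun setT g & (forall x, 0 <= g x) :
  set T -> \bar R := fun A => \int[mu]_(x in A) g x.

Local Notation nu := (density mg g_ge0).

Let nu0 : nu set0 = 0. Proof. exact: integral_set0. Qed.

Let nu_ge0 A : 0 <= nu A. Proof. exact: integral_ge0. Qed.

Let nu_sigma_additive : semi_sigma_additive nu.
Proof.
move=> F mF tF mUF; rewrite /density ge0_integral_bigcup//; last first.
  exact: measurable_funTS.
apply: is_cvg_nneseries => k _ _; exact: integral_ge0.
Qed.

HB.instance Definition _ := isMeasure.Build _ _ _ nu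
  nu0 nu_ge0 nu_sigma_additive.

End density.

Section sup_norm.
Context {R : realType} {m n : nat}.
Implicit Type x : 'M[R]_(m, n).

Lemma mx_norm_leP x (M : R) : 0 <= M ->
  (`|x| <= M) <-> forall i j, `|x i j| <= M.
Proof.
move=> M0; rewrite [`|x|]mx_normrE; split.
  move=> /bigmax_leP[_ h] i j; exact: (h (i, j)).
by move=> h; apply/bigmax_leP; split => // -[i j] _; exact: h.
Qed.

Lemma mx_entry_le_norm x i j : `|x i j| <= `|x|.
Proof. by have /(_ (lexx _)) := (mx_norm_leP x (normr_ge0 x)).1; apply. Qed.

End sup_norm.

Section test_functions.
Context {R : realType} {n : nat}.
Local Notation X := 'M[R]_(n, 2).
Implicit Types (phi chi : X -> R) (a b x : X) (k : nat).

Lemma test_smooth phi : test_function phi -> smooth phi.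
Proof. by case. Qed.

Lemma test_measurable phi : test_function phi -> measurable_fun setT phi.
Proof. by move=> /test_smooth/smooth_measurable. Qed.

Lemma smooth_test_mul chi phi : smooth chi -> test_function phi ->
  test_function (fun x => chi x * phi x).
Proof.
move=> sc [sp [M hM]]; split; first exact: smoothM.
by exists M => x /hM ->; rewrite mulr0.
Qed.

Lemma test_pder s phi : test_function phi -> test_function (pder s phi).
Proof.
move=> [sp [M hM]]; split; first exact: smooth_pder.
exists M; elim: s => [//|[j k] s IHs] x Mx /=.
have -> : 'D_(delta_mx j k) (pder s phi) x = 'D_(delta_mx j k) (fun=> 0) x.
  apply: near_eq_derive.
  have : open [set y : X | M < `|y|].
    apply: (@open_comp _ _ (fun y : X => `|y|) [set r | M < r]).
      by move=> y _; exact: norm_continuous.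
    exact: open_gt.
  rewrite openE => /(_ x Mx); apply: filterS => y; exact: IHs.
by rewrite derive_cst.
Qed.

(** Products of flat functions in every coordinate, steepened by [k]: a sequence
    of test functions converging to the indicator function of an open box. *)
Definition bump_factor (a b : X) (k : nat) (ij : 'I_n * 'I_2) x : R :=
  flat 1 (- (k%:R * a ij.1 ij.2) + k%:R * x ij.1 ij.2) *
  flat 1 (k%:R * b ij.1 ij.2 + (- k%:R) * x ij.1 ij.2).

Definition bump (a b : X) (k : nat) x : R :=
  \prod_(ij : 'I_n * 'I_2) bump_factor a b k ij x.

Lemma flat1_ge0 (t : R) : 0 <= flat 1 t.
Proof. by rewrite /flat; case: ifP => // _; rewrite hornerE mul1r expR_ge0. Qed.

Lemma flat1_le1 (t : R) : flat 1 t <= 1.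
Proof.
rewrite /flat; case: ifPn => // t0; rewrite hornerE mul1r -expR0 ler_expR.
by rewrite oppr_le0 invr_ge0 ltW.
Qed.

Lemma flat1_cvg (t : R) : 0 < t -> (fun k => flat 1 (k%:R * t)) @ \oo --> (1 : R).
Proof.
move=> t0; suff : (fun k => flat 1 (k%:R * t)) @ \oo --> expR 0 by rewrite expR0.
apply: (@cvg_trans _ ((fun k : nat => expR (- (t^-1 * k%:R^-1))) @ \oo)).
  apply: near_eq_cvg; near=> k; rewrite /flat.
  have k0 : (0 < k)%N by near: k; exact: nbhs_infty_gt.
  by rewrite mulr_gt0 ?ltr0n// hornerE mul1r invfM mulrC.
apply: continuous_cvg; first exact: continuous_expR.
rewrite -oppr0; apply: cvgN; rewrite -(mulr0 t^-1).
apply: cvgM; first exact: cvg_cst.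
by have := @cvg_harmonic R; rewrite -(cvg_shiftS (fun k : nat => k%:R^-1 : R)).
Unshelve. all: by end_near. Qed.

Lemma bump_factor_ge0 a b k ij x : 0 <= bump_factor a b k ij x.
Proof. by rewrite mulr_ge0 ?flat1_ge0. Qed.

Lemma bump_factor_le1 a b k ij x : bump_factor a b k ij x <= 1.
Proof. by rewrite mulr_ile1 ?flat1_ge0 ?flat1_le1. Qed.

Lemma bump_factor_out a b k ij x :
  ~~ (a ij.1 ij.2 < x ij.1 ij.2 < b ij.1 ij.2) -> bump_factor a b k ij x = 0.
Proof.
rewrite negb_and -!leNgt /bump_factor /flat => /orP[xa|bx].
  rewrite ifF ?mul0r//; apply/negbTE; rewrite -leNgt.
  by rewrite addrC -mulrBr mulr_ge0_le0// subr_le0.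
rewrite [X in _ * X]ifF ?mulr0//; apply/negbTE; rewrite -leNgt.
by rewrite mulNr -mulrBr mulr_ge0_le0// subr_le0.
Qed.

Lemma bump_factor_cvg a b ij x : a ij.1 ij.2 < x ij.1 ij.2 < b ij.1 ij.2 ->
  (fun k => bump_factor a b k ij x) @ \oo --> (1 : R).
Proof.
move=> /andP[ax xb]; rewrite -(mulr1 1); apply: cvgM.
  rewrite (_ : (fun _ => _) = (fun k => flat 1 (k%:R * (x ij.1 ij.2 - a ij.1 ij.2)))).
    by apply: flat1_cvg; rewrite subr_gt0.
  by apply/funext => k; congr flat; ring.
rewrite (_ : (fun _ => _) = (fun k => flat 1 (k%:R * (b ij.1 ij.2 - x ij.1 ij.2)))).
  by apply: flat1_cvg; rewrite subr_gt0.
by apply/funext => k; congr flat; ring.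
Qed.

Lemma bump_ge0 a b k x : 0 <= bump a b k x.
Proof. by apply: prodr_ge0 => ij _; exact: bump_factor_ge0. Qed.

Lemma bump_le1 a b k x : bump a b k x <= 1.
Proof.
by apply: prodr_ile1 => ij _; rewrite bump_factor_ge0 bump_factor_le1.
Qed.

Lemma bump_out a b k x : ~ obox a b x -> bump a b k x = 0.
Proof.
move=> /existsNP[i /existsNP[j /negP h]].
by rewrite /bump (bigD1 (i, j))//= bump_factor_out ?mul0r.
Qed.

Lemma bump_cvg a b x : (fun k => bump a b k x) @ \oo --> (\1_(obox a b) x : R).
Proof.
have [xab|nx] := pselect (obox a b x); last first.
  rewrite indicE memNset// [X in X @ _ --> _](_ : _ = fun=> 0); first exact: cvg_cst.
  by apply/funext => k; rewrite bump_out.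
rewrite indicE mem_set// /bump.
suff H (r : seq ('I_n * 'I_2)) :
  (fun k => \prod_(ij <- r) bump_factor a b k ij x) @ \oo --> (1 : R) by exact: H.
elim: r => [|ij r IHr].
  rewrite [X in X @ _ --> _](_ : _ = fun=> 1); first exact: cvg_cst.
  by apply/funext => k; rewrite big_nil.
rewrite [X in X @ _ --> _](_ : _ = fun k => bump_factor a b k ij x *
    \prod_(ij <- r) bump_factor a b k ij x); last first.
  by apply/funext => k; rewrite big_cons.
have := cvgM (@bump_factor_cvg a b ij x (xab _ _)) IHr.
by rewrite mulr1; apply.
Qed.

Lemma bump_test a b k : test_function (bump a b k).
Proof.
split.
  by apply: smooth_prod => ij; apply: smoothM; exact: smooth_flat.
exists (`|a| + `|b|) => x Mx; apply: bump_out => xab.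
move: Mx; rewrite ltNge => /negP; apply.
apply/mx_norm_leP; first by rewrite addr_ge0.
move=> i j; have /andP[h1 h2] := xab i j.
have := mx_entry_le_norm a i j; have := mx_entry_le_norm b i j.
rewrite !ler_norml => /andP[? ?] /andP[? ?].
have := normr_ge0 a; have := normr_ge0 b; lra.
Qed.

End test_functions.

Section du_bois_reymond.
Context {R : realType} {n : nat}.
Local Notation X := 'M[R]_(n, 2).
Local Notation mu := (@leb R n).

Lemma L2_indic_obox (a b : X) : L2 mu (\1_(obox a b)).
Proof.
split; first by apply: measurable_indic; exact: measurable_obox.
rewrite (_ : (fun _ => _) = (fun x => (\1_(obox a b) x)%:E)); last first.
  by apply/funext => x; rewrite indicE; case: (_ \in _); rewrite ?expr1n ?expr0n.
by rewrite integral_indic//; [rewrite setIT leb_obox_lty|exact: measurable_obox].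
Qed.

Lemma L2_bounded_support (phi : X -> R) (M C : R) :
  measurable_fun setT phi -> (forall x, `|phi x| <= C) ->
  (forall x, M < `|x| -> phi x = 0) -> L2 mu phi.
Proof.
move=> mphi phiC phiM; pose B : X := const_mx (`|M| + 1).
have C0 : 0 <= C by exact: le_trans (phiC 0).
split => //; have [_ lty] := L2Z C (L2_indic_obox (- B) B).
apply: le_lt_trans lty; apply: ge0_le_integral => //=.
- by move=> x _; rewrite lee_fin sqr_ge0.
- exact/measurable_EFinP/measurable_funX.
- apply/measurable_EFinP/measurable_funX/measurable_funM => //.
  by apply: measurable_indic; exact: measurable_obox.
move=> x _; rewrite lee_fin -[X in X <= _]real_normK ?num_real//.
rewrite lerXn2r ?nnegrE ?mulr_ge0//.
have [xM|Mx] := leP `|x| M; last by rewrite phiM// normr0 mulr_ge0.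
rewrite indicE mem_set ?mulr1// => i j; rewrite !mxE -ltr_norml.
rewrite (le_lt_trans (mx_entry_le_norm _ _ _))// (le_lt_trans xM)//.
by rewrite (le_lt_trans (ler_norm _))// ltrDl.
Qed.

Lemma test_bounded (phi : X -> R) : test_function phi ->
  exists2 C, 0 <= C & forall x, `|phi x| <= C.
Proof.
move=> [sp [M hM]].
pose K := [set v : 'rV[R]_(n * 2) | forall i, `[- `|M|, `|M|]%classic (v ord0 i)].
have cK : compact K.
  apply: (@rV_compact R _ (fun=> `[- `|M|, `|M|]%classic)) => i.
  exact: segment_compact.
have cvec : continuous (fun v : 'rV[R]_(n * 2) => phi (vec_mx v)).
  move=> v; apply: (@continuous_comp _ _ _ (@vec_mx R n 2) phi); last first.
    exact: smooth_continuous.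
  move=> A /nbhs_ballP[e e0 eA]; apply/nbhs_ballP; exists e => // w [_ vw].
  by apply: eA; split => // i j; rewrite !mxE; exact: vw.
have := continuous_compact (continuous_subspaceT cvec) cK.
move=> /compact_bounded[C [_ hC]].
exists (`|C| + 1) => [|x]; first by rewrite addr_ge0.
have [xM|/hM ->] := leP `|x| M; last by rewrite normr0 addr_ge0.
apply: hC; first by rewrite (le_lt_trans (ler_norm _))// ltrDl.
exists (mxvec x); last by rewrite mxvecK.
move=> k; case/mxvec_indexP: k => i j; rewrite mxvecE/= in_itv/= -ler_norml.
by rewrite (le_trans (mx_entry_le_norm _ _ _))// (le_trans xM)// ler_norm.
Qed.

Lemma L2_bump (a b : X) k : L2 mu (bump a b k).
Proof.
have [_ [M hM]] := bump_test a b k.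
apply: (L2_bounded_support (C := 1) _ _ hM).
  exact: (test_measurable (bump_test a b k)).
by move=> x; rewrite ger0_norm ?bump_ge0// bump_le1.
Qed.

Lemma du_bois_reymond_box (f : X -> R) : L2 mu f ->
  (forall phi, test_function phi -> \int[mu]_x (f x * phi x) = 0) ->
  forall a b, \int[mu]_x (f x * \1_(obox a b) x) = 0.
Proof.
move=> Lf f0 a b; have L1 := L2_indic_obox a b.
have mf := L2_measurable Lf.
have [] := @dominated_convergence _ _ _ mu setT measurableT
  (fun k x => (f x * bump a b k x)%:E) (fun x => (f x * \1_(obox a b) x)%:E)
  (fun x => `|f x * \1_(obox a b) x|%:E).
- move=> k; apply/measurable_EFinP/measurable_funM => //.
  exact: (test_measurable (bump_test a b k)).
- by apply/measurable_EFinP/measurable_funM => //; exact: L2_measurable L1.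
- apply: aeW => x _; apply/cvg_EFin; first by near=> k.
  by apply: cvgM; [exact: cvg_cst|exact: bump_cvg].
- by have /integrable_abse := L2_integrable_mul Lf L1.
- apply: aeW => x k _; rewrite lee_fin !normrM ler_wpM2l//.
  have [xab|nx] := pselect (obox a b x).
    by rewrite indicE mem_set// normr1 ger0_norm ?bump_ge0 ?bump_le1.
  by rewrite bump_out// normr0.
move=> _ _; rewrite (_ : [sequence _]_k = fun=> 0%E); last first.
  apply/funext => k /=; have := f0 _ (bump_test a b k).
  rewrite /Rintegral => h; rewrite -[LHS]fineK ?h//.
  by have := integrable_fin_num measurableT (L2_integrable_mul Lf (L2_bump a b k)).
by rewrite /Rintegral => /cvg_lim <-//; rewrite lim_cst.
Unshelve. all: by end_near. Qed.

(** By dominated convergence along the bumps, [f] has integral zero over every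
    box. The measures with densities the positive and the negative part of [f]
    then agree on boxes, hence everywhere, and they live on disjoint sets. *)
Lemma du_bois_reymond (f : X -> R) : L2 mu f ->
  (forall phi, test_function phi -> \int[mu]_x (f x * phi x) = 0) ->
  {ae mu, forall x, f x = 0}.
Proof.
move=> Lf /(du_bois_reymond_box Lf) fbox; have mf := L2_measurable Lf.
pose fp x := (Num.max (f x) 0)%:E; pose fm x := (Num.max (- f x) 0)%:E.
have fp0 x : (0 <= fp x)%E by rewrite lee_fin le_max lexx orbT.
have fm0 x : (0 <= fm x)%E by rewrite lee_fin le_max lexx orbT.
have mfp : measurable_fun setT fp.
  by apply/measurable_EFinP; apply: measurable_maxr.
have mfm : measurable_fun setT fm.
  by apply/measurable_EFinP; apply: measurable_maxr => //; exact: measurableT_comp.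
have fE x : (f x)%:E = (fp x - fm x)%E.
  rewrite -EFinB; congr EFin; case: (ltP (f x) 0) => f0.
    by rewrite max_l ?oppr_ge0 ?ltW// opprK add0r.
  by rewrite [X in _ - X]max_r ?oppr_le0// subr0.
have int_box (a b : X) (g : X -> R) : measurable_fun setT g -> (forall x, 0 <= g x <= `|f x|) ->
    (\int[mu]_(x in obox a b) (g x)%:E < +oo)%E.
  move=> mg gf; have mab := measurable_obox a b.
  have Labs := L2_integrable_mul Lf (L2_indic_obox a b).
  have /integrableP[_] := Labs; apply: le_lt_trans.
  rewrite [X in (X <= _)%E]integral_mkcond; apply: ge0_le_integral => //.
  - by move=> x _; apply: erestrict_ge0 => y _; rewrite lee_fin; have /andP[] := gf y.
  - apply/(measurable_restrictT _ _).1 => //.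
    exact/measurable_EFinP/measurable_funTS.
  - by apply: measurableT_comp => //; exact: (measurable_int _ Labs).
  move=> x _; rewrite patchE /= normrM; have /andP[g0 gx] := gf x.
  case: ifPn => [xab|_]; last by rewrite lee_fin mulr_ge0.
  by rewrite indicE xab normr1 mulr1 lee_fin.
have fp_le x : 0 <= Num.max (f x) 0 <= `|f x|.
  by rewrite le_max lexx orbT/= ge_max ler_norm normr_ge0.
have fm_le x : 0 <= Num.max (- f x) 0 <= `|f x|.
  by rewrite le_max lexx orbT/= ge_max -normrN ler_norm normr_ge0.
have E A : measurable A -> density mu mfp fp0 A = density mu mfm fm0 A.
  apply: obox_measure_unique => a b; last first.
    by apply: (int_box a b _ _ fp_le); apply: measurable_maxr.
  rewrite /density/=; have mab := measurable_obox a b.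
  have ip : (\int[mu]_(x in obox a b) fp x)%E \is a fin_num.
    rewrite ge0_fin_numE; last by apply: integral_ge0 => x _; exact: fp0.
    by apply: (int_box a b _ _ fp_le); apply: measurable_maxr.
  have im : (\int[mu]_(x in obox a b) fm x)%E \is a fin_num.
    rewrite ge0_fin_numE; last by apply: integral_ge0 => x _; exact: fm0.
    apply: (int_box a b _ _ fm_le); apply: measurable_maxr => //.
    exact: measurableT_comp.
  have pm0 : (\int[mu]_(x in obox a b) fp x - \int[mu]_(x in obox a b) fm x = 0)%E.
    have := fbox a b; rewrite /Rintegral.
    rewrite (_ : (\int[mu]_x _)%E = (\int[mu]_(x in obox a b) (fp x - fm x))%E); last first.
      rewrite [RHS]integral_mkcond; apply: eq_integral => x _.
      by rewrite patchE -fE indicE; case: (_ \in _); rewrite ?mulr1 ?mulr0.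
    rewrite integralB//.
    - move=> h; rewrite -[LHS]fineK ?h//.
      by rewrite fin_numB; apply/andP; split; [exact: ip|exact: im].
    - apply/integrableP; split; first exact: measurable_funTS.
      under eq_integral do rewrite gee0_abs//.
      by rewrite -ge0_fin_numE// integral_ge0.
    - apply/integrableP; split; first exact: measurable_funTS.
      under eq_integral do rewrite gee0_abs//.
      by rewrite -ge0_fin_numE// integral_ge0.
  suff : (\int[mu]_(x in obox a b) fp x = \int[mu]_(x in obox a b) fm x)%E by [].
  move: ip im pm0; set p := (\int[mu]_(x in obox a b) fp x)%E.
  set q := (\int[mu]_(x in obox a b) fm x)%E; clearbody p q.
  by case: p => // p; case: q => // q _ _ [] /eqP; rewrite subr_eq0 => /eqP ->.
have zero (g h : X -> R) (mg : measurable_fun setT (EFin \o g)) (mh : measurable_fun setT (EFin \o h))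
    g0 h0 : (forall x, 0 < g x -> h x = 0) ->
    (forall A, measurable A -> density mu mg g0 A = density mu mh h0 A) ->
    {ae mu, forall x, g x = 0}.
  move=> gh gE; pose A := [set x | 0 < g x].
  have mA : measurable A.
    rewrite (_ : A = setT `&` [set x | (cst 0 x < (EFin \o g) x)%E]).
      by apply: measurable_lte => //; exact: measurable_cst.
    by rewrite setTI; apply/seteqP; split => x; rewrite /A/= lte_fin.
  have gA0 : (\int[mu]_(x in A) `|(g x)%:E| = 0)%E.
    transitivity (density mu mg g0 A).
      by apply: eq_integral => x _; rewrite gee0_abs//; exact: g0.
    rewrite gE// /density; apply: integral0_eq => x Ax /=.
    by rewrite gh.
  have := (ae_eq_integral_abs mu mA (measurable_funTS mg)).1 gA0.
  apply: filterS => x /= h1; apply/eqP; rewrite eq_le; apply/andP; split; last first.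
    by have := g0 x; rewrite lee_fin.
  by rewrite leNgt; apply/negP => gx; have := h1 gx; case; lra.
have zp := zero (fun x => Num.max (f x) 0) (fun x => Num.max (- f x) 0) mfp mfm fp0 fm0.
have zm := zero (fun x => Num.max (- f x) 0) (fun x => Num.max (f x) 0) mfm mfp fm0 fp0.
have {}zp : {ae mu, forall x, Num.max (f x) 0 = 0}.
  by apply: zp => // x; rewrite lt_max ltxx orbF => f0; rewrite max_r// oppr_le0 ltW.
have {}zm : {ae mu, forall x, Num.max (- f x) 0 = 0}.
  apply: zm => [x|A mA]; last by rewrite E.
  by rewrite lt_max ltxx orbF oppr_gt0 => f0; rewrite max_r// ltW.
apply: filterS2 zp zm => x p m; have := fE x; rewrite /fp /fm p m => -[->].
by rewrite subr0.
Qed.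

End du_bois_reymond.

(** * Averages over measure-preserving flows *)

Section averages.
Context dX (X : measurableType dX) dY (Y : measurableType dY) (R : realType).
Variables (mu : {sigma_finite_measure set X -> \bar R}) (P : probability Y R).
Variable T : Y -> X -> X.
Hypothesis mT : measurable_fun setT (fun p : X * Y => T p.2 p.1).
Hypothesis Tmu : forall r, preserves mu (T r).
Implicit Types f g w : X -> R.

(** The mean of [f] over the random displacements [T r]; being a convex
    combination of isometric images of [f], it does not increase the norm. *)
Definition avg f x : R := \int[P]_r f (T r x).

Let mfT f : measurable_fun setT f ->
  measurable_fun setT (fun p : X * Y => f (T p.2 p.1)).
Proof. by move=> mf; exact: (measurableT_comp mf mT). Qed.

Let mfTr f x : measurable_fun setT f -> measurable_fun setT (fun r => f (T r x)).
Proof.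
move=> mf; have mp : measurable_fun setT (fun r : Y => (x, r)).
  by apply: measurable_fun_pair => //; exact: measurable_cst.
exact: (measurableT_comp (mfT mf) mp).
Qed.

Let mfTx f r : measurable_fun setT f -> measurable_fun setT (fun x => f (T r x)).
Proof. by move=> mf; apply: (measurableT_comp mf); case: (Tmu r). Qed.

Lemma L2_flow f r : L2 mu f -> L2 mu (fun x => f (T r x)).
Proof.
move=> [mf foo]; split; first exact: mfTx.
rewrite (preserves_ge0_integral (Tmu r) (g := fun x => (f x ^+ 2)%:E))//.
  exact/measurable_EFinP/measurable_funX.
by move=> x; rewrite lee_fin sqr_ge0.
Qed.

Lemma dot_flow f g r : measurable_fun setT f -> measurable_fun setT g ->
  dot mu (fun x => f (T r x)) (fun x => g (T r x)) = dot mu f g.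
Proof.
move=> mf mg; rewrite /dot (preserves_Rintegral (Tmu r) (g := fun x => f x * g x))//.
exact: measurable_funM.
Qed.

Lemma measurable_avg f : measurable_fun setT f -> measurable_fun setT (avg f).
Proof.
move=> mf; rewrite /avg /Rintegral.
apply: (measurableT_comp (fine_measurable measurableT)).
pose F (p : X * Y) := (f (T p.2 p.1))%:E.
have mF : measurable_fun setT F by apply/measurable_EFinP; exact: mfT.
rewrite (_ : (fun _ => _) = fun x => (\int[P]_r F^\+%E (x, r) - \int[P]_r F^\-%E (x, r))%E).
  apply: emeasurable_funB.
    apply: (@measurable_fun_fubini_tonelli_F _ _ _ _ _ P F^\+%E) => //.
      exact: measurable_funepos.
  apply: (@measurable_fun_fubini_tonelli_F _ _ _ _ _ P F^\-%E) => //.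
  exact: measurable_funeneg.
apply/funext => x; rewrite integralE; congr (_ - _)%E.
  by apply: eq_integral => r _; rewrite !funeposE.
by apply: eq_integral => r _; rewrite !funenegE.
Qed.

Let int1 : (\int[P]_r (cst 1 r : \bar R) = 1)%E.
Proof. by rewrite integral_cst// [X in (_ * X)%E]probability_setT mule1. Qed.

(** Jensen's inequality for the square, from the Cauchy-Schwarz inequality. *)
Lemma sqr_avg_le f x : measurable_fun setT f ->
  (((avg f x) ^+ 2)%:E <= \int[P]_r ((f (T r x)) ^+ 2)%:E)%E.
Proof.
move=> mf; have [oo|] := eqVneq (\int[P]_r ((f (T r x)) ^+ 2)%:E)%E +oo%E.
  by rewrite oo leey.
rewrite -ltey => lty.
have L : L2 P (fun r => f (T r x)) by split => //; exact: mfTr.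
have L1 : L2 P (fun=> 1).
  split; first exact: measurable_cst.
  by under eq_integral do rewrite expr1n; rewrite int1 ltry.
rewrite -(EFin_dot L) lee_fin.
have := cauchy_schwarz L L1.
have -> : dot P (fun=> 1) (fun=> 1) = 1.
  by rewrite /dot/Rintegral; under eq_integral do rewrite mulr1; rewrite int1.
rewrite mulr1; congr (_ ^+ 2 <= _).
by apply: eq_Rintegral => r _; rewrite mulr1.
Qed.

Let int_sqr f : L2 mu f ->
  (\int[mu]_x \int[P]_r ((f (T r x)) ^+ 2)%:E = \int[mu]_x (f x ^+ 2)%:E)%E.
Proof.
move=> [mf foo].
pose F (p : X * Y) := ((f (T p.2 p.1)) ^+ 2)%:E.
have mF : measurable_fun setT F by apply/measurable_EFinP; apply: measurable_funX; exact: mfT.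
have F0 p : (0 <= F p)%E by rewrite lee_fin sqr_ge0.
rewrite -(fubini_tonelli1 (m1 := mu) (m2 := P) F)// fubini_tonelli2// /fubini_G.
under eq_integral.
  move=> r _; rewrite (preserves_ge0_integral (Tmu r) (g := fun x => (f x ^+ 2)%:E)).
  - over.
  - exact/measurable_EFinP/measurable_funX.
  - by move=> x; rewrite lee_fin sqr_ge0.
have fin : (\int[mu]_x (f x ^+ 2)%:E)%E \is a fin_num.
  by rewrite ge0_fin_numE// integral_ge0// => x _; rewrite lee_fin sqr_ge0.
by rewrite -(fineK fin) integral_cst// [X in (_ * X)%E]probability_setT mule1.
Qed.

Lemma L2_avg f : L2 mu f -> L2 mu (avg f).
Proof.
move=> Lf; have [mf foo] := Lf; split; first exact: measurable_avg.
apply: le_lt_trans foo; rewrite -(int_sqr Lf); apply: ge0_le_integral => //.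
- by move=> x _; rewrite lee_fin sqr_ge0.
- exact/measurable_EFinP/measurable_funX/measurable_avg.
- apply: (@measurable_fun_fubini_tonelli_F _ _ _ _ _ P
    (fun p : X * Y => ((f (T p.2 p.1)) ^+ 2)%:E)) => [|p].
    by apply/measurable_EFinP; apply: measurable_funX; exact: mfT.
  by rewrite lee_fin sqr_ge0.
- by move=> x _; exact: sqr_avg_le.
Qed.

Lemma dot_avg_le f : L2 mu f -> dot mu (avg f) (avg f) <= dot mu f f.
Proof.
move=> Lf; have [mf foo] := Lf; rewrite -lee_fin !EFin_dot//; last exact: L2_avg.
rewrite -(int_sqr Lf); apply: ge0_le_integral => //.
- by move=> x _; rewrite lee_fin sqr_ge0.
- exact/measurable_EFinP/measurable_funX/measurable_avg.
- apply: (@measurable_fun_fubini_tonelli_F _ _ _ _ _ P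
    (fun p : X * Y => ((f (T p.2 p.1)) ^+ 2)%:E)) => [|p].
    by apply/measurable_EFinP; apply: measurable_funX; exact: mfT.
  by rewrite lee_fin sqr_ge0.
- by move=> x _; exact: sqr_avg_le.
Qed.

Lemma L2_avg_ae f : L2 mu f -> {ae mu, forall x, L2 P (fun r => f (T r x))}.
Proof.
move=> Lf; have [mf foo] := Lf.
pose G x := (\int[P]_r ((f (T r x)) ^+ 2)%:E)%E.
have G0 x : (0 <= G x)%E by apply: integral_ge0 => r _; rewrite lee_fin sqr_ge0.
have iG : mu.-integrable setT G.
  apply/integrableP; split.
    apply: (@measurable_fun_fubini_tonelli_F _ _ _ _ _ P
      (fun p : X * Y => ((f (T p.2 p.1)) ^+ 2)%:E)) => [|p].
      by apply/measurable_EFinP; apply: measurable_funX; exact: mfT.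
    by rewrite lee_fin sqr_ge0.
  by under eq_integral do rewrite gee0_abs//; rewrite int_sqr.
apply: filterS (integrable_ae measurableT iG) => x /(_ I) Gx; split.
  exact: mfTr.
by move: Gx; rewrite ge0_fin_numE.
Qed.

Lemma dot_avgl f w : L2 mu f -> L2 mu w ->
  dot mu (avg f) w = \int[P]_r dot mu (fun x => f (T r x)) w.
Proof.
move=> Lf Lw; have [mf _] := Lf; have [mw _] := Lw.
pose F (p : X * Y) := (f (T p.2 p.1) * w p.1)%:E.
have mF : measurable_fun setT F.
  apply/measurable_EFinP/measurable_funM; first exact: mfT.
  exact: (measurableT_comp mw measurable_fst).
have L1 : L2 P (fun=> 1).
  split; first exact: measurable_cst.
  by under eq_integral do rewrite expr1n; rewrite int1 ltry.
have iF : (mu \x P)%E.-integrable setT F.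
  apply/integrable21ltyP => //.
  apply: (@le_lt_trans _ _ (\int[P]_r (dot mu f f + dot mu w w)%:E)%E).
    apply: ge0_le_integral => //.
    - by move=> r _; exact: integral_ge0.
    - apply: (@measurable_fun_fubini_tonelli_G _ _ _ _ _ mu (abse \o F)) => [|p].
        exact: measurableT_comp.
      exact: abse_ge0.
    - move=> r _; rewrite EFinD !EFin_dot//.
      rewrite -(preserves_ge0_integral (Tmu r) (g := fun x => (f x ^+ 2)%:E)); last first.
      + by move=> x; rewrite lee_fin sqr_ge0.
      + exact/measurable_EFinP/measurable_funX.
      rewrite -ge0_integralD//.
      + apply: ge0_le_integral => //.
        * apply: measurableT_comp => //; apply/measurable_EFinP/measurable_funM => //.
          exact: mfTx.
        * apply: emeasurable_funD; apply/measurable_EFinP/measurable_funX => //.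
          exact: mfTx.
        * move=> x _; rewrite /F/= -EFinD lee_fin normrM.
          rewrite -[X in X + _]real_normK ?num_real// -[X in _ + X]real_normK ?num_real//.
          have := sqr_ge0 (`|f (T r x)| - `|w x|).
          have := mulr_ge0 (normr_ge0 (f (T r x))) (normr_ge0 (w x)); nra.
      + by move=> x _; rewrite lee_fin sqr_ge0.
      + by apply/measurable_EFinP/measurable_funX; exact: mfTx.
      + by move=> x _; rewrite lee_fin sqr_ge0.
      + exact/measurable_EFinP/measurable_funX.
  by rewrite integral_cst// [X in (_ * X)%E]probability_setT mule1 ltry.
have -> : \int[P]_r dot mu (fun x => f (T r x)) w =
    fine (\int[P]_r (\int[mu]_x F (x, r)))%E.
  congr fine; apply: eq_integral => r _; rewrite /dot/Rintegral fineK//.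
  exact: (integrable_fin_num measurableT (L2_integrable_mul (L2_flow r Lf) Lw)).
have -> : (\int[P]_r (\int[mu]_x F (x, r)) = \int[mu]_x (\int[P]_r F (x, r)))%E.
  by rewrite (integral21_prod_meas1 iF) -(integral12_prod_meas1 iF).
congr fine; apply: ae_eq_integral => //.
- by apply/measurable_EFinP/measurable_funM => //; exact: measurable_avg.
- exact: (measurable_fubini_F iF).
apply: filterS (L2_avg_ae Lf) => x Lx _ /=; rewrite /F/= /avg.
have := @RintegralZr _ _ _ P setT (fun r => f (T r x)) (w x) measurableT.
have i1 : P.-integrable setT (EFin \o (fun r => f (T r x))).
  have := L2_integrable_mul Lx L1; congr (_.-integrable _ _).
  by apply/funext => r /=; rewrite mulr1.
have i2 : P.-integrable setT (EFin \o (fun r => f (T r x) * w x)).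
  have := L2_integrable_mul Lx (L2Z (w x) L1); congr (_.-integrable _ _).
  by apply/funext => r /=; rewrite mulr1.
move=> /(_ i1) <-; rewrite /Rintegral fineK//.
exact: integrable_fin_num.
Qed.

End averages.

Section uniform_averages.
Context {R : realType}.
Local Notation lambda := (@lebesgue_measure R).

Lemma Rintegral_uniform (a b : R) (ab : a < b) (f : R -> R) :
  measurable_fun setT f -> lambda.-integrable `[a, b] (EFin \o f) ->
  \int[uniform_prob ab]_r f r = (b - a)^-1 * \int[lambda]_(r in `[a, b]) f r.
Proof.
move=> mf intf; have mF : measurable_fun setT (EFin \o f) by exact/measurable_EFinP.
have fin : (\int[lambda]_(r in `[a, b]) (f r)%:E)%E \is a fin_num.
  exact: integrable_fin_num.
rewrite /Rintegral -[X in _ = X * _]/(fine ((b - a)^-1)%:E) -fineM//; congr fine.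
rewrite [LHS]integralE !integral_uniform//; last 2 first.
  exact: measurable_funeneg.
  exact: measurable_funepos.
rewrite -muleBr//; last first.
  by apply: fin_num_adde_defl; rewrite fin_numN; exact: integrable_neg_fin_num intf.
by rewrite [in RHS]integralE.
Qed.

(** The fundamental theorem of calculus, normalised for uniform means. *)
Lemma mean_of_derivative (s : R) (s0 : 0 < s) (F f : R -> R) :
  (forall t : R, is_derive t (1 : R) F (f t)) -> continuous f ->
  \int[uniform_prob s0]_r f r = s^-1 * (F s - F 0).
Proof.
move=> dF cf.
have cF : continuous F.
  move=> t; apply/differentiable_continuous/derivable1_diffP.
  by have [] := dF t.
have cfI : {within `[0, s], continuous f} by exact: continuous_subspaceT.
rewrite Rintegral_uniform ?subr0.
- congr (_ * _); rewrite /Rintegral (continuous_FTC2 s0 cfI (F := F))//.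
    split.
    + by move=> t _; have [] := dF t.
    + by apply: cvg_at_right_filter; exact: cF.
    + by apply: cvg_at_left_filter; exact: cF.
  by move=> t _; rewrite derive1E; have [_ ->] := dF t.
- exact: continuous_measurable_fun.
- by apply: continuous_compact_integrable => //; exact: segment_compact.
Qed.

End uniform_averages.

(** * Weak derivatives as increments along lines *)

Section translations.
Context {R : realType} {n : nat}.
Local Notation X := 'M[R]_(n, 2).
Implicit Types (f phi : X -> R) (v x : X).

Lemma derive_translate f v w :
  'D_w (fun x => f (x + v)) = (fun x => 'D_w f (x + v)).
Proof.
apply/funext => x; rewrite /derive.
set g1 := fun h => h^-1 *: _; set g2 := fun h => h^-1 *: _; suff -> : g1 = g2 by [].
by apply/funext => h; rewrite /g1 /g2/= addrA.
Qed.

Lemma derivable_translate f v w x :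
  derivable f (x + v) w -> derivable (fun x => f (x + v)) x w.
Proof.
rewrite /derivable.
set g1 := fun h => h^-1 *: _; set g2 := fun h => h^-1 *: _; suff -> : g1 = g2 by [].
by apply/funext => h; rewrite /g1 /g2/= addrA.
Qed.

Lemma pder_translate s f v :
  pder s (fun x => f (x + v)) = (fun x => pder s f (x + v)).
Proof.
by elim: s => [//|[j k] s IHs] /=; rewrite IHs derive_translate.
Qed.

Lemma continuous_translate v : continuous (fun x : X => x + v).
Proof. by move=> x; exact: (cvgD (@cvg_id _ (nbhs x)) (@cvg_cst _ v _ _ _)). Qed.

Lemma smooth_translate f v : smooth f -> smooth (fun x => f (x + v)).
Proof.
move=> sf s; rewrite pder_translate; split.
  move=> x; apply: (@continuous_comp _ _ _ (fun x : X => x + v) (pder s f)).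
    exact: continuous_translate.
  exact: (sf s).1.
by move=> x j k; apply/derivable_translate/(sf s).2.
Qed.

Lemma test_translate phi v : test_function phi ->
  test_function (fun x => phi (x + v)).
Proof.
move=> [sp [M hM]]; split; first exact: smooth_translate.
exists (M + `|v|) => x h; apply: hM.
rewrite -(ltrD2r `|v|) (lt_le_trans h)// -[in leLHS](addrK v x).
by rewrite (le_trans (ler_normB _ _)).
Qed.

Lemma L2_test phi : test_function phi -> L2 (leb n) phi.
Proof.
move=> tp; have [C C0 hC] := test_bounded tp; have [_ [M hM]] := tp.
exact: (L2_bounded_support (test_measurable tp) hC hM).
Qed.

End translations.

Section weak_derivatives.
Context {R : realType} {n : nat} (j : 'I_n) (k : 'I_2).
Local Notation X := 'M[R]_(n, 2).
Local Notation mu := (@leb R n).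
Implicit Types (u g f phi : X -> R) (x : X).

Definition unit_move (r : measurableTypeR R) x : X := x + r *: delta_mx j k.

Lemma measurable_unit_move :
  measurable_fun setT (fun p : X * measurableTypeR R => unit_move p.2 p.1).
Proof.
apply: measurable_mx => i l.
rewrite (_ : (fun _ => _) = (fun p : X * measurableTypeR R =>
    p.1 i l + p.2 * (delta_mx j k : X) i l)); last first.
  by apply/funext => p; rewrite !mxE.
apply: measurable_funD.
  exact: (measurableT_comp (measurable_mx_coord i l) measurable_fst).
by apply: measurable_funM => //; exact: measurable_snd.
Qed.

Lemma measurable_unit_moveN :
  measurable_fun setT (fun p : X * measurableTypeR R => unit_move (- p.2) p.1).
Proof.
have mN : measurable_fun setT (fun p : X * measurableTypeR R =>
    (p.1, (- p.2 : measurableTypeR R))).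
  apply: measurable_fun_pair; first exact: measurable_fst.
  by apply: (@measurableT_comp _ _ _ _ _ _ (-%R : R -> R)) => //; exact: measurable_snd.
exact: (measurableT_comp measurable_unit_move mN).
Qed.

Lemma preserves_unit_move r : preserves mu (unit_move r).
Proof. exact: preserves_translation. Qed.

Lemma unit_moveK r x : unit_move (- r) (unit_move r x) = x.
Proof. by rewrite /unit_move scaleNr addrK. Qed.

Definition fwd (s : R) (s0 : 0 < s) u : X -> R := avg (uniform_prob s0) unit_move u.
Definition bwd (s : R) (s0 : 0 < s) u : X -> R :=
  avg (uniform_prob s0) (fun r => unit_move (- r)) u.

Lemma L2_move r u : L2 mu u -> L2 mu (fun x => u (unit_move r x)).
Proof. by move=> Lu; apply: L2_flow => // r'; exact: preserves_unit_move. Qed.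

Lemma dot_move r u w : L2 mu u -> L2 mu w ->
  dot mu (fun x => u (unit_move r x)) w = dot mu u (fun x => w (unit_move (- r) x)).
Proof.
move=> Lu Lw; have [mu' _] := Lu; have [mw _] := L2_move (- r) Lw.
rewrite -(dot_flow preserves_unit_move r mu' mw).
by congr dot; apply/funext => x; rewrite unit_moveK.
Qed.

Lemma L2_fwd s (s0 : 0 < s) u : L2 mu u -> L2 mu (fwd s0 u).
Proof.
move=> Lu; apply: L2_avg => //; first exact: measurable_unit_move.
exact: preserves_unit_move.
Qed.

Lemma L2_bwd s (s0 : 0 < s) u : L2 mu u -> L2 mu (bwd s0 u).
Proof.
move=> Lu; apply: L2_avg => //; first exact: measurable_unit_moveN.
by move=> r; exact: preserves_unit_move.
Qed.

Lemma dot_fwd_le s (s0 : 0 < s) u : L2 mu u ->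
  dot mu (fwd s0 u) (fwd s0 u) <= dot mu u u.
Proof.
move=> Lu; apply: dot_avg_le => //; first exact: measurable_unit_move.
exact: preserves_unit_move.
Qed.

Lemma dot_fwd s (s0 : 0 < s) u w : L2 mu u -> L2 mu w ->
  dot mu (fwd s0 u) w = \int[uniform_prob s0]_r dot mu (fun x => u (unit_move r x)) w.
Proof.
move=> Lu Lw; apply: dot_avgl => //; first exact: measurable_unit_move.
exact: preserves_unit_move.
Qed.

Lemma dot_fwd_bwd s (s0 : 0 < s) u w : L2 mu u -> L2 mu w ->
  dot mu (fwd s0 u) w = dot mu u (bwd s0 w).
Proof.
move=> Lu Lw; rewrite (dot_fwd s0 Lu Lw) [RHS]dotC [RHS]dot_avgl//.
- by apply: eq_Rintegral => r _; rewrite dot_move// dotC.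
- exact: measurable_unit_moveN.
- by move=> r; exact: preserves_unit_move.
Qed.

Lemma bwd_pder s (s0 : 0 < s) phi : test_function phi ->
  bwd s0 (pder [:: (j, k)] phi) = (fun x => s^-1 * (phi x - phi (unit_move (- s) x))).
Proof.
move=> tp; apply/funext => x; rewrite /bwd /avg.
have sp := test_smooth tp.
have dF (t : R) : is_derive (t : R) (1 : R) (fun r => - phi (unit_move (- r) x))
    (pder [:: (j, k)] phi (unit_move (- t) x)).
  have h : is_derive (- t) (1 : R) (fun t : R => phi (t *: delta_mx j k + x))
     (pder [:: (j, k)] phi (- t *: delta_mx j k + x)).
    exact/is_derive_along_line/smooth_is_derive.
  have hN : is_derive t (1 : R) (fun t : R => - t) (- 1).
    exact: (is_deriveN (is_derive_id t (1 : R))).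
  have := is_deriveN (is_derive1_comp (g := fun t : R => - t) h hN).
  rewrite mulrN1 opprK /unit_move [x + _]addrC; congr is_derive.
  by apply/funext => r /=; rewrite /unit_move [x + _]addrC.
have cf : continuous (fun r : R => pder [:: (j, k)] phi (unit_move (- r) x)).
  move=> t; apply: (@continuous_comp _ _ _ (fun r : R => unit_move (- r) x : X)
    (pder [:: (j, k)] phi)); last exact/smooth_continuous/smooth_pder.
  rewrite /unit_move; apply: cvgD; first exact: cvg_cst.
  by apply: cvgZl; apply: cvgN; exact: cvg_id.
rewrite (mean_of_derivative s0 dF cf).
by rewrite oppr0 /unit_move scale0r addr0 opprK addrC.
Qed.

(** The real-valued counterpart of [weak_derivative]. *)
Definition weakd u g := forall phi, test_function phi ->
  dot mu u (pder [:: (j, k)] phi) = - dot mu g phi.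

Lemma weakd_move r u g : L2 mu u -> L2 mu g -> weakd u g ->
  weakd (fun x => u (unit_move r x)) (fun x => g (unit_move r x)).
Proof.
move=> Lu Lg ug phi tp; rewrite !dot_move//; [|exact: L2_test|].
  rewrite -ug; last exact: test_translate.
  by congr dot; rewrite pder_translate.
exact/L2_test/test_pder.
Qed.

(** The increment of u over a segment is the integral of its weak derivative:
    both sides have the same integral against every test function. *)
Lemma weakd_increment s (s0 : 0 < s) u g : L2 mu u -> L2 mu g -> weakd u g ->
  {ae mu, forall x, u (unit_move s x) - u x = s * fwd s0 g x}.
Proof.
move=> Lu Lg ug.
have Lm := L2_move s Lu; have Lf := L2_fwd s0 Lg.
have L1 := L2B Lm Lu; have L2' := L2Z s Lf.
suff : {ae mu, forall x, (u (unit_move s x) - u x) - s * fwd s0 g x = 0}.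
  by apply: filterS => x /eqP; rewrite subr_eq0 => /eqP.
apply: du_bois_reymond; first exact: L2B.
move=> phi tp; have Lp := L2_test tp; have Lpm := L2_move (- s) Lp.
have Ld := L2_test (test_pder [:: (j, k)] tp).
rewrite -/(dot mu _ phi) dotBl// dotBl// dotZl// dot_move//.
rewrite dot_fwd//.
rewrite (_ : \int[_]_r _ = - dot mu u (bwd s0 (pder [:: (j, k)] phi))).
  rewrite bwd_pder// dotZr//; last exact: L2B.
  by rewrite dotBr//; field; rewrite gt_eqF.
have LN := L2N Lu.
rewrite -[RHS](dotNl Lu (L2_bwd s0 Ld)) -(dot_fwd_bwd s0 LN Ld) (dot_fwd s0 LN Ld).
apply: eq_Rintegral => r _.
rewrite -[LHS]opprK -(weakd_move r Lu Lg ug tp) -dotNl//; exact: L2_move.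
Qed.

Lemma weakd_unique u g h : L2 mu g -> L2 mu h -> weakd u g -> weakd u h ->
  {ae mu, forall x, g x = h x}.
Proof.
move=> Lg Lh ug uh.
suff : {ae mu, forall x, g x - h x = 0}.
  by apply: filterS => x /eqP; rewrite subr_eq0 => /eqP.
apply: du_bois_reymond; first exact: L2B.
move=> phi tp; have Lp := L2_test tp.
by rewrite -/(dot mu _ phi) dotBl// -[dot mu g phi]opprK -ug// uh// opprK subrr.
Qed.

Lemma dot_increment_le s (s0 : 0 < s) u g : L2 mu u -> L2 mu g -> weakd u g ->
  dot mu (fun x => u (unit_move s x) - u x) (fun x => u (unit_move s x) - u x) <=
  s ^+ 2 * dot mu g g.
Proof.
move=> Lu Lg ug; have H := weakd_increment s0 Lu Lg ug.
have L1 := L2B (L2_move s Lu) Lu; have L2' := L2Z s (L2_fwd s0 Lg).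
rewrite (ae_eq_dot (L2_measurable L1) (L2_measurable L2') (L2_measurable L1)
  (L2_measurable L2') H H).
rewrite dotZl ?dotZr//; try exact: L2_fwd.
by rewrite mulrA -expr2 ler_wpM2l ?sqr_ge0// dot_fwd_le.
Qed.

(** Each displacement by r <= s costs at most r times the norm of g, and the mean
    of the increments inherits the bound. *)
Lemma dot_fwd_sub_le s (s0 : 0 < s) u g : L2 mu u -> L2 mu g -> weakd u g ->
  dot mu (fun x => fwd s0 u x - u x) (fun x => fwd s0 u x - u x) <=
  s ^+ 2 * dot mu g g.
Proof.
move=> Lu Lg ug; have Lf := L2_fwd s0 Lu; have LB := L2B Lf Lu.
have [mu' _] := Lu.
pose P : probability (measurableTypeR R) R := uniform_prob s0.
pose F (p : X * measurableTypeR R) := ((u (unit_move p.2 p.1) - u p.1) ^+ 2)%:E.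
rewrite -lee_fin EFin_dot//.
have mF : measurable_fun setT F.
  apply/measurable_EFinP; apply: measurable_funX; apply: measurable_funB.
    exact: (measurableT_comp mu' measurable_unit_move).
  exact: (measurableT_comp mu' measurable_fst).
have F0 p : (0 <= F p)%E by rewrite lee_fin sqr_ge0.
have mFx : measurable_fun setT (fun x => \int[P]_r F (x, r))%E.
  exact: (@measurable_fun_fubini_tonelli_F _ _ _ _ _ P F mF F0).
have mFr : measurable_fun setT (fun r => \int[mu]_x F (x, r))%E.
  exact: (@measurable_fun_fubini_tonelli_G _ _ _ _ _ mu F mF F0).
apply: (@le_trans _ _ (\int[mu]_x \int[P]_r F (x, r))%E).
  apply: ae_ge0_le_integral => //.
  - by move=> x _; rewrite lee_fin sqr_ge0.
  - by apply/measurable_EFinP; apply: measurable_funX; exact: L2_measurable LB.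
  - by move=> x _; apply: integral_ge0 => r _; exact: F0.
  have := L2_avg_ae P measurable_unit_move preserves_unit_move Lu.
  apply: filterS => x Lx _.
  have L1 : L2 P (fun=> 1).
    split; first exact: measurable_cst.
    under eq_integral do rewrite expr1n.
    by rewrite integral_cst// [X in (_ * X)%E]probability_setT mule1 ltry.
  have Lc : L2 P (fun=> u x).
    by have := L2Z (u x) L1; congr (L2 _ _); apply/funext => r; rewrite mulr1.
  have Ld := L2B Lx Lc.
  have d11 : dot P (fun=> 1) (fun=> 1) = 1.
    rewrite /dot/Rintegral; under eq_integral do rewrite mulr1.
    by rewrite integral_cst// [X in (_ * X)%E]probability_setT mule1.
  have -> : fwd s0 u x - u x = dot P (fun r => u (unit_move r x) - u x) (fun=> 1).
    rewrite dotBl//; congr (_ - _).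
      by apply: eq_Rintegral => r _; rewrite mulr1.
    have := dotZl (u x) L1 L1; rewrite d11 mulr1 => {1}<-.
    by congr dot; apply/funext => r; rewrite mulr1.
  rewrite -(EFin_dot Ld) lee_fin (le_trans (cauchy_schwarz Ld L1))//.
  by rewrite d11 mulr1.
rewrite -[X in (X <= _)%E](@fubini_tonelli1 _ _ _ _ _ mu P F mF F0).
rewrite (@fubini_tonelli2 _ _ _ _ _ mu P F mF F0) /fubini_G.
rewrite integral_uniform//; last first.
  by move=> r; apply: integral_ge0 => x _; exact: F0.
rewrite subr0; set G := dot mu g g.
have G0 : 0 <= G by exact: dot_ge0.
apply: (@le_trans _ _ ((s^-1)%:E *
    \int[lebesgue_measure]_(r in `[0%R, s]) (s ^+ 2 * G)%:E)%E).
  apply: lee_wpmul2l; first by rewrite lee_fin invr_ge0 ltW.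
  apply: ge0_le_integral => //.
  - by move=> r _; apply: integral_ge0 => x _; exact: F0.
  - exact: measurable_funTS.
  move=> r /=; rewrite in_itv/= => /andP[]; rewrite le_eqVlt => /predU1P[<- _|r0 rs].
    rewrite integral0_eq; first by rewrite lee_fin mulr_ge0// sqr_ge0.
    by move=> x _; rewrite /F/= /unit_move scale0r addr0 subrr expr0n.
  have Lr := L2B (L2_move r Lu) Lu.
  rewrite -(EFin_dot Lr) lee_fin (le_trans (dot_increment_le r0 Lu Lg ug))//.
  by rewrite ler_wpM2r// ler_sqr ?nnegrE ?(ltW r0) ?(ltW s0).
have lam : lebesgue_measure `[0%R, s]%classic = s%:E.
  by rewrite lebesgue_measure_itv/= lte_fin s0 oppr0 adde0.
rewrite integral_cst//; rewrite [X in (_ * (_ * X) <= _)%E]lam -!EFinM lee_fin.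
by rewrite mulrCA mulVf ?mulr1// gt_eqF.
Qed.

End weak_derivatives.

(** * Complex-valued functions *)

Section complex_functions.
Context {R : realType} {n : nat}.
Local Notation X := 'M[R]_(n, 2).
Local Notation mu := (@leb R n).
Local Notation modulus := (@ComplexField.Normc.normc R).
Implicit Types (psi chi g : X -> R[i]) (phi : X -> R).

Definition cRe psi x := complex.Re (psi x).
Definition cIm psi x := complex.Im (psi x).

Lemma sqr_modulus (z : R[i]) : modulus z ^+ 2 = complex.Re z ^+ 2 + complex.Im z ^+ 2.
Proof. by case: z => a b /=; rewrite sqr_sqrtr// addr_ge0 ?sqr_ge0. Qed.

Lemma modulus_ge0 (z : R[i]) : 0 <= modulus z.
Proof. by case: z => a b; exact: sqrtr_ge0. Qed.

Lemma poweR2_sqr (x : \bar R) : (0 <= x)%E -> (x ^+ 2 = x `^ 2)%E.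
Proof.
case: x => [r r0|_|//].
  by rewrite poweR_EFin -EFin_expe powR_mulrn.
by rewrite poweRyr// expeS expe1 mulyy.
Qed.

Lemma sqnormE psi :
  sqnorm psi = (\int[mu]_x (cRe psi x ^+ 2 + cIm psi x ^+ 2)%:E)%E.
Proof.
rewrite /sqnorm /Lp_norm poweR2_sqr ?Lnorm_ge0// powR_Lnorm ?pnatr_eq0//.
apply: eq_integral => x _; rewrite abse_EFin poweR_EFin powR_mulrn//.
by rewrite real_normK ?num_real// sqr_modulus.
Qed.

Lemma sqnorm_ge0 psi : (0 <= sqnorm psi)%E.
Proof. by rewrite /sqnorm expe_ge0// Lnorm_ge0. Qed.

Lemma measurable_sqr_modulus psi :
  measurable_fun setT (cRe psi) -> measurable_fun setT (cIm psi) ->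
  measurable_fun setT (fun x => (cRe psi x ^+ 2 + cIm psi x ^+ 2)%:E).
Proof.
move=> mr mi; apply/measurable_EFinP.
by apply: measurable_funD; exact: measurable_funX.
Qed.

Lemma is_L2P psi : is_L2 psi <-> L2 mu (cRe psi) /\ L2 mu (cIm psi).
Proof.
have sqE : (Lp_norm 2 psi < +oo)%E <-> (sqnorm psi < +oo)%E.
  rewrite /sqnorm poweR2_sqr ?Lnorm_ge0//; split; first exact: poweR_lty.
  by apply: lty_poweRy; rewrite pnatr_eq0.
split=> [[mr mi /sqE]|[[mr ri] [mi ii]]].
  rewrite sqnormE => lty; split; split => //; apply: le_lt_trans lty.
    apply: ge0_le_integral => //.
    - by move=> x _; rewrite lee_fin sqr_ge0.
    - exact/measurable_EFinP/measurable_funX.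
    - exact: measurable_sqr_modulus.
    - by move=> x _; rewrite lee_fin lerDl sqr_ge0.
  apply: ge0_le_integral => //.
  - by move=> x _; rewrite lee_fin sqr_ge0.
  - exact/measurable_EFinP/measurable_funX.
  - exact: measurable_sqr_modulus.
  - by move=> x _; rewrite lee_fin lerDr sqr_ge0.
split => //; apply/sqE; rewrite sqnormE; under eq_integral do rewrite EFinD.
rewrite ge0_integralD//; first exact: lte_add_pinfty.
- by move=> x _; rewrite lee_fin sqr_ge0.
- exact/measurable_EFinP/measurable_funX.
- by move=> x _; rewrite lee_fin sqr_ge0.
- exact/measurable_EFinP/measurable_funX.
Qed.

Lemma sqnorm_dot psi : is_L2 psi ->
  sqnorm psi = (dot mu (cRe psi) (cRe psi) + dot mu (cIm psi) (cIm psi))%:E.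
Proof.
move=> /is_L2P[Lr Li]; have [mr _] := Lr; have [mi _] := Li.
rewrite sqnormE [RHS]EFinD !EFin_dot//; under [LHS]eq_integral do rewrite EFinD.
rewrite ge0_integralD//.
- by move=> x _; rewrite lee_fin sqr_ge0.
- exact/measurable_EFinP/measurable_funX.
- by move=> x _; rewrite lee_fin sqr_ge0.
- exact/measurable_EFinP/measurable_funX.
Qed.

Lemma ae_eq_sqnorm psi chi : is_L2 psi -> is_L2 chi ->
  {ae mu, forall x, cRe psi x = cRe chi x} ->
  {ae mu, forall x, cIm psi x = cIm chi x} -> sqnorm psi = sqnorm chi.
Proof.
move=> Lp Lc rE iE; rewrite !sqnorm_dot//.
have [[r _] [i _]] := (is_L2P psi).1 Lp.
have [[r' _] [i' _]] := (is_L2P chi).1 Lc.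
by rewrite (ae_eq_dot r r' r r' rE rE) (ae_eq_dot i i' i i' iE iE).
Qed.

Lemma innerE psi chi : is_L2 psi -> is_L2 chi -> inner psi chi =
  Complex (dot mu (cRe psi) (cRe chi) + dot mu (cIm psi) (cIm chi))
          (dot mu (cRe psi) (cIm chi) - dot mu (cIm psi) (cRe chi)).
Proof.
move=> /is_L2P[Lr Li] /is_L2P[Lr' Li'].
rewrite /inner /cintegral; congr Complex.
  rewrite /dot -RintegralD//; try exact: L2_integrable_mul.
  apply: eq_Rintegral => x _; rewrite /cRe /cIm.
  by case: (psi x) => a b; case: (chi x) => c d /=; ring.
rewrite /dot -RintegralB//; try exact: L2_integrable_mul.
apply: eq_Rintegral => x _; rewrite /cRe /cIm.
by case: (psi x) => a b; case: (chi x) => c d /=; ring.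
Qed.

Lemma cintegral_real psi phi : cintegral (fun x => psi x * (phi x)%:C%C) =
  Complex (dot mu (cRe psi) phi) (dot mu (cIm psi) phi).
Proof.
rewrite /cintegral /dot; congr Complex; apply: eq_Rintegral => x _;
  by rewrite /cRe /cIm; case: (psi x) => a b /=; ring.
Qed.

Lemma weak_derivativeP j k psi g : weak_derivative j k psi g <->
  weakd j k (cRe psi) (cRe g) /\ weakd j k (cIm psi) (cIm g).
Proof.
split=> [h|[hr hi] phi tp]; last by rewrite !cintegral_real hr// hi.
by split=> phi tp; have := h phi tp; rewrite !cintegral_real => -[].
Qed.

(** Weak derivatives are unique, so the infimum is a minimum. *)
Lemma dirichlet_formE j k psi g : is_L2 g -> weak_derivative j k psi g ->
  dirichlet_form j k psi = sqnorm g.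
Proof.
move=> Lg wg; apply/eqP; rewrite eq_le; apply/andP; split.
  by apply: ereal_inf_lbound; exists g.
apply: le_ereal_inf_tmp => _ [h [Lh wh] <-].
have [[gr gi] [hr hi]] := ((is_L2P g).1 Lg, (is_L2P h).1 Lh).
have [wgr wgi] := (weak_derivativeP _ _ _ _).1 wg.
have [whr whi] := (weak_derivativeP _ _ _ _).1 wh.
rewrite (ae_eq_sqnorm Lg Lh)//; first exact: weakd_unique wgr whr.
exact: weakd_unique wgi whi.
Qed.

Lemma dirichlet_form_lty j k psi : (dirichlet_form j k psi < +oo)%E ->
  exists2 g, is_L2 g & weak_derivative j k psi g.
Proof.
by move=> /ereal_inf_lt[_ [g [Lg wg] _] _]; exists g.
Qed.

Lemma dirichlet_form_ge0 j k psi : (0 <= dirichlet_form j k psi)%E.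
Proof. by apply: le_ereal_inf_tmp => _ [g _ <-]; exact: sqnorm_ge0. Qed.

Lemma gradient_formE j psi : gradient_form j psi =
  (dirichlet_form j ord0 psi + dirichlet_form j ord_max psi)%E.
Proof.
by rewrite /gradient_form big_ord_recl big_ord1; congr (_ + dirichlet_form _ _ _)%E.
Qed.

Lemma gradient_form_ge0 j psi : (0 <= gradient_form j psi)%E.
Proof. by apply: sume_ge0 => k _; exact: dirichlet_form_ge0. Qed.

Lemma gradient_form_lty j psi : (gradient_form j psi < +oo)%E ->
  exists g : 'I_2 -> X -> R[i], forall k, is_L2 (g k) /\ weak_derivative j k psi (g k).
Proof.
move=> fin; have d0 l := dirichlet_form_ge0 j l psi.
have /choice[g gP] : forall k, exists g, is_L2 g /\ weak_derivative j k psi g.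
  move=> k; have : (dirichlet_form j k psi < +oo)%E.
    apply: le_lt_trans fin; rewrite gradient_formE.
    by case: (ord2P k) => ->; [exact: leeDl|exact: leeDr].
  by move=> /dirichlet_form_lty[g Lg wg]; exists g.
by exists g.
Qed.

End complex_functions.

(** * Slices *)

Section slices.
Context {R : realType} {n : nat}.
Local Notation X := 'M[R]_(n.+1, 2).

Definition cons_particle (x : 'M[R]_(1, 2)) (y : 'M[R]_(n, 2)) : X := add_particle (x, y).

Lemma measurable_add_particle : measurable_fun setT (@add_particle R n).
Proof.
apply: measurable_mx => i k; rewrite /add_particle.
under eq_fun do rewrite mxE.
case: (fintype.split _) => j.
- exact: (measurableT_comp (measurable_mx_coord j k) measurable_fst).
- exact: (measurableT_comp (measurable_mx_coord j k) measurable_snd).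
Qed.

Lemma measurable_cons_particle y : measurable_fun setT (cons_particle^~ y).
Proof.
apply: (measurableT_comp measurable_add_particle).
by apply: measurable_fun_pair => //; exact: measurable_cst.
Qed.

Lemma eq_integral_leb1 (f : 'M[R]_(1, 2) -> \bar R) :
  (\int[leb 1]_x f x = \int[lebesgue_plane]_x f x)%E.
Proof. by apply: eq_measure_integral => A mA _; exact: leb1E. Qed.

Lemma measurable_slice_integral (f : X -> \bar R) :
  measurable_fun setT f -> (forall x, 0 <= f x)%E ->
  measurable_fun setT (fun y => \int[leb 1]_x f (cons_particle x y))%E.
Proof.
move=> mf f0; under eq_fun do rewrite eq_integral_leb1.
apply: (@measurable_fun_fubini_tonelli_G _ _ _ _ _ lebesgue_plane
  (f \o @add_particle R n)) => [|p]; last exact: f0.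
exact: (measurableT_comp mf measurable_add_particle).
Qed.

Lemma integral_slices (f : X -> \bar R) :
  measurable_fun setT f -> (forall x, 0 <= f x)%E ->
  (\int[leb n.+1]_x f x = \int[leb n]_y \int[leb 1]_x f (cons_particle x y))%E.
Proof.
move=> mf f0.
have mfp := measurableT_comp mf measurable_add_particle.
transitivity (\int[(lebesgue_plane \x leb n)%E]_p f (add_particle p))%E.
  have := @ge0_integral_pushforward _ _ _ _ R _ measurable_add_particle
    (lebesgue_plane \x leb n)%E setT f measurableT mf (fun x _ => f0 x).
  by rewrite preimage_setT => <-.
by rewrite fubini_tonelli2//; apply: eq_integral => y _; rewrite eq_integral_leb1.
Qed.

Lemma ae_slices (P : X -> Prop) : {ae leb n.+1, forall x, P x} ->
  {ae leb n, forall y, {ae leb 1, forall x, P (cons_particle x y)}}.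
Proof.
move=> [N [mN N0 PN]].
have mi : measurable_fun setT (fun x : X => (\1_N x)%:E : \bar R).
  by apply/measurable_EFinP; exact: measurable_indic.
have i0 (x : X) : (0 <= (\1_N x)%:E :> \bar R)%E by rewrite lee_fin.
have : (\int[leb n.+1]_x (\1_N x)%:E = 0 :> \bar R)%E by rewrite integral_indic// setIT.
rewrite integral_slices// => I0.
have mS := measurable_slice_integral mi i0.
have S0 y : (0 <= \int[leb 1]_x (\1_N (cons_particle x y))%:E :> \bar R)%E.
  by apply: integral_ge0 => x _; exact: i0.
have := (ae_eq_integral_abs (leb n) measurableT mS).1.
rewrite (_ : (\int[_]_y `|_| = 0)%E) => [/(_ erefl)|]; last first.
  by rewrite -[RHS]I0; apply: eq_integral => y _; rewrite gee0_abs.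
apply: filterS => y /(_ I) /= Iy.
have mNy : measurable (cons_particle^~ y @^-1` N).
  by rewrite -[X in measurable X]setTI; exact: measurable_cons_particle.
exists (cons_particle^~ y @^-1` N); split => //; last by move=> x /= nP; apply: PN.
rewrite -Iy -[X in leb 1 X]setIT -integral_indic//.
Qed.

Lemma unit_move_cons_particle k (r : R) x y :
  cons_particle (unit_move ord0 k r x) y = unit_move ord0 k r (cons_particle x y).
Proof.
apply/matrixP => i l; rewrite /unit_move /cons_particle /add_particle !mxE.
by case: splitP => a ia; rewrite ?mxE -!val_eqE/= ia ?ord1// mulr0 addr0.
Qed.

End slices.

(** * Weak derivatives of slices *)

Section uniform_means.
Context {R : realType} {n : nat}.
Local Notation X := 'M[R]_(n, 2).
Local Notation mu := (@leb R n).

Lemma uniform_mean_dist (s : R) (s0 : 0 < s) (f : R -> R) (c C : R) :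
  continuous f -> (forall r, 0 <= r <= s -> `|f r - c| <= C) ->
  `|\int[uniform_prob s0]_r f r - c| <= C.
Proof.
move=> cf fcC.
have If : lebesgue_measure.-integrable `[0, s] (EFin \o f).
  apply: continuous_compact_integrable; first exact: segment_compact.
  exact: continuous_subspaceT.
have Ic (a : R) : lebesgue_measure.-integrable `[0, s] (EFin \o (fun=> a)).
  apply: continuous_compact_integrable; first exact: segment_compact.
  by apply: continuous_subspaceT; exact: cst_continuous.
have Ec (a : R) : \int[lebesgue_measure]_(r in `[0, s]) a = a * s.
  rewrite Rintegral_cst//; congr (_ * _).
  rewrite -[RHS]/(fine s%:E); congr fine.
  have lam : (@lebesgue_measure R) `[0%R, s]%classic = s%:E.
    by rewrite lebesgue_measure_itv/= lte_fin s0 oppr0 adde0.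
  exact: lam.
rewrite Rintegral_uniform ?subr0//; last exact: continuous_measurable_fun.
set I := \int[lebesgue_measure]_(r in _) _.
have up : I <= (c + C) * s.
  rewrite -Ec; apply: le_Rintegral => // r /= /[!in_itv]/= /fcC.
  by rewrite ler_norml => /andP[_]; rewrite lerBlDl.
have lo : (c - C) * s <= I.
  rewrite -Ec; apply: le_Rintegral => // r /= /[!in_itv]/= /fcC.
  by rewrite ler_norml => /andP[+ _]; rewrite lerBrDl.
rewrite ler_norml [s^-1 * _]mulrC; apply/andP; split.
  by rewrite lerBrDl ler_pdivlMr.
by rewrite lerBlDl ler_pdivrMr.
Qed.

Lemma norm_unit_move j k (r : R) (x : X) : `|x| - `|r| <= `|unit_move j k r x|.
Proof.
rewrite /unit_move; apply: le_trans (lerB_normD _ _); rewrite lerD2l lerN2.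
apply/mx_norm_leP => // i l; rewrite !mxE normrM ler_piMr//.
by case: (_ && _); rewrite ?normr1 ?normr0.
Qed.

Lemma continuous_line j k (phi : X -> R) x : continuous phi ->
  continuous (fun r : R => phi (unit_move j k (- r) x)).
Proof.
move=> cphi t; apply: (@continuous_comp _ _ _ (fun r : R => unit_move j k (- r) x : X)
  phi); last exact: cphi.
rewrite /unit_move; apply: cvgD; first exact: cvg_cst.
by apply: cvgZl; apply: cvgN; exact: cvg_id.
Qed.

(** A test function moves by at most [s] times a bound on its derivative, on a
    bounded neighbourhood of its support. *)
Lemma test_bwd_close j k (chi : X -> R) : test_function chi ->
  exists2 K, 0 <= K & forall (s : R) (s0 : 0 < s), s <= 1 ->
    dot mu (fun x => bwd j k s0 chi x - chi x) (fun x => bwd j k s0 chi x - chi x) <=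
    (s * K) ^+ 2.
Proof.
move=> tc; have [_ [M hM]] := tc.
have td := test_pder [:: (j, k)] tc; have [C C0 hC] := test_bounded td.
pose B : X := const_mx (`|M| + 2); pose D := dot mu (\1_(obox (- B) B)) (\1_(obox (- B) B)).
have LB := L2_indic_obox (- B) B.
have D0 : 0 <= D by exact: dot_ge0.
exists (C * Num.sqrt D); first by rewrite mulr_ge0// sqrtr_ge0.
move=> s s0 s1.
have sc := smooth_continuous (test_smooth tc).
have lip r x : 0 <= r -> `|chi (unit_move j k (- r) x) - chi x| <= r * C.
  rewrite le_eqVlt => /predU1P[<-|r0].
    by rewrite /unit_move oppr0 scale0r addr0 subrr normr0 mul0r.
  have E : chi x - chi (unit_move j k (- r) x) =
      r * bwd j k r0 (pder [:: (j, k)] chi) x.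
    by rewrite bwd_pder// mulrA divff ?mul1r// gt_eqF.
  rewrite distrC E normrM gtr0_norm// ler_pM2l// -[bwd _ _ _ _ _]subr0.
  apply: uniform_mean_dist => [|t _]; last by rewrite subr0.
  exact/continuous_line/smooth_continuous/test_smooth.
have key x : `|bwd j k s0 chi x - chi x| <= s * C * \1_(obox (- B) B) x.
  have [xB|nB] := pselect (obox (- B) B x).
    rewrite indicE mem_set// mulr1; apply: uniform_mean_dist.
      exact: continuous_line.
    move=> r /andP[r0 rs]; rewrite (le_trans (lip _ _ r0))//.
    by rewrite ler_wpM2r.
  have xM : `|M| + 1 < `|x|.
    rewrite ltNge; apply/negP => h; apply: nB => i l; rewrite !mxE -ltr_norml.
    by rewrite (le_lt_trans (mx_entry_le_norm _ _ _))// (le_lt_trans h)// ltrD2l ltr1n.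
  have chi0 r : 0 <= r <= s -> chi (unit_move j k (- r) x) = 0.
    move=> /andP[r0 rs]; apply: hM.
    apply: lt_le_trans (norm_unit_move _ _ _ _); rewrite normrN (ger0_norm r0).
    have := ler_norm M; lra.
  have chix : chi x = 0.
    by have := chi0 0; rewrite /unit_move oppr0 scale0r addr0 lexx ltW//; apply.
  rewrite indicE memNset// mulr0; apply: uniform_mean_dist.
    exact: continuous_line.
  by move=> r /chi0 ->; rewrite chix subrr normr0.
have Lb := L2B (L2_bwd j k s0 (L2_test tc)) (L2_test tc).
have L1 := L2Z (s * C) LB.
rewrite -lee_fin EFin_dot// (le_trans (y := (dot mu (fun x => s * C * \1_(obox (- B) B) x)
  (fun x => s * C * \1_(obox (- B) B) x))%:E))//.
  rewrite EFin_dot//; apply: ge0_le_integral => //.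
  - by move=> x _; rewrite lee_fin sqr_ge0.
  - by apply/measurable_EFinP; apply: measurable_funX; exact: L2_measurable Lb.
  - by apply/measurable_EFinP; apply: measurable_funX; exact: L2_measurable L1.
  - move=> x _; rewrite lee_fin -[X in X <= _]real_normK ?num_real//.
    by rewrite lerXn2r ?nnegrE// (le_trans _ (key x)).
rewrite lee_fin dotZl ?dotZr// -/D !exprMn sqr_sqrtr//.
by rewrite le_eqVlt; apply/orP; left; apply/eqP; ring.
Qed.

Definition harm_step (m : nat) : R := m.+1%:R^-1.

Lemma harm_step_gt0 m : 0 < harm_step m. Proof. by rewrite invr_gt0. Qed.

(** The converse of [weakd_increment]: testing the increments with step [s] against
    [phi] gives the weak derivative up to errors of order [s]. *)
Lemma weakd_of_increments j k (u g : X -> R) : L2 mu u -> L2 mu g ->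
  (forall m, {ae mu, forall x, u (unit_move j k (harm_step m) x) - u x =
     harm_step m * fwd j k (harm_step_gt0 m) g x}) ->
  weakd j k u g.
Proof.
move=> Lu Lg ug phi tp; have td := test_pder [:: (j, k)] tp.
have Lp := L2_test tp; have Ld := L2_test td.
have [K1 K10 hK1] := test_bwd_close j k tp.
have [K2 K20 hK2] := test_bwd_close j k td.
apply/eqP; rewrite -subr_eq0 opprK; apply/negPn/negP => ne0.
pose A := Num.sqrt (dot mu u u); pose A' := Num.sqrt (dot mu g g).
pose Q := A * K2 + A' * K1.
have Q0 : 0 <= Q by rewrite addr_ge0// mulr_ge0// sqrtr_ge0.
have bound m : `|dot mu u (pder [:: (j, k)] phi) + dot mu g phi| <= harm_step m * Q.
  set s := harm_step m; have s0 : 0 < s := harm_step_gt0 m.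
  have s1 : s <= 1 by rewrite invf_le1// ler1n.
  have Lb1 := L2_bwd j k s0 Lp; have Lb2 := L2_bwd j k s0 Ld.
  have Lm := L2_move j k s Lu; have Lmm := L2_move j k (- s) Lp.
  have id1 : dot mu u (bwd j k s0 (pder [:: (j, k)] phi)) = - dot mu g (bwd j k s0 phi).
    rewrite bwd_pder// dotZr//; last exact: L2B.
    rewrite dotBr// -(dot_move j k s Lu Lp) -dot_fwd_bwd//.
    have LI := L2B Lm Lu; have LF := L2Z s (L2_fwd j k s0 Lg).
    have := ae_eq_dot (L2_measurable LI) (L2_measurable LF) (L2_measurable Lp)
       (L2_measurable Lp) (ug m) (aeW _ (fun=> erefl)).
    rewrite dotBl// dotZl//; last exact: L2_fwd.
    move=> h; have -> : dot mu (fwd j k s0 g) phi = s^-1 * (s * dot mu (fwd j k s0 g) phi).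
      by rewrite mulKf// gt_eqF.
    by rewrite -h; ring.
  have -> : dot mu u (pder [:: (j, k)] phi) + dot mu g phi =
     - (dot mu u (fun x => bwd j k s0 (pder [:: (j, k)] phi) x - pder [:: (j, k)] phi x)
       + dot mu g (fun x => bwd j k s0 phi x - phi x)).
    by rewrite !dotBr// id1; ring.
  rewrite normrN (le_trans (ler_normD _ _))// /Q mulrDr lerD//.
    rewrite mulrCA; apply: normr_dot_le => //.
    - exact: L2B.
    - by rewrite sqrtr_ge0.
    - by rewrite mulr_ge0// ltW.
    - by rewrite sqr_sqrtr// dot_ge0.
    - exact: hK2.
  rewrite mulrCA; apply: normr_dot_le => //.
  - exact: L2B.
  - by rewrite sqrtr_ge0.
  - by rewrite mulr_ge0// ltW.
  - by rewrite sqr_sqrtr// dot_ge0.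
  - exact: hK1.
have {}ne0 : 0 < `|dot mu u (pder [:: (j, k)] phi) + dot mu g phi| by rewrite normr_gt0.
set a := `|_| in bound ne0.
have := bound (Num.truncn (Q / a)); rewrite /harm_step mulrC ler_pdivlMr//.
by rewrite mulrC -ler_pdivlMr// leNgt truncnS_gt.
Qed.

End uniform_means.

Section weak_derivative_slices.
Context {R : realType} {n : nat}.
Local Notation X := 'M[R]_(n.+1, 2).

Lemma L2_slices (f : X -> R) : L2 (leb n.+1) f ->
  {ae leb n, forall y, L2 (leb 1) (fun x => f (cons_particle x y))}.
Proof.
move=> [mf foo].
have mf2 : measurable_fun setT (fun x => (f x ^+ 2)%:E).
  by apply/measurable_EFinP; exact: measurable_funX.
have f20 x : (0 <= (f x ^+ 2)%:E)%E by rewrite lee_fin sqr_ge0.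
have mS := measurable_slice_integral mf2 f20.
have S0 y : (0 <= \int[leb 1]_x (f (cons_particle x y) ^+ 2)%:E)%E.
  by apply: integral_ge0 => x _; exact: f20.
have iS : (leb n).-integrable setT (fun y => \int[leb 1]_x (f (cons_particle x y) ^+ 2)%:E)%E.
  apply/integrableP; split => //.
  under eq_integral do rewrite gee0_abs//.
  by rewrite -(integral_slices mf2 f20).
apply: filterS (integrable_ae measurableT iS) => y /(_ I) fin; split.
  by apply: (measurableT_comp mf); exact: measurable_cons_particle.
by move: fin; rewrite ge0_fin_numE.
Qed.

(** Almost every slice of a weak derivative is a weak derivative: the increment
    identities at the countably many steps 1/(m+1) pass to almost every slice. *)
Lemma weakd_slices k (u g : X -> R) : L2 (leb n.+1) u -> L2 (leb n.+1) g ->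
  weakd ord0 k u g ->
  {ae leb n, forall y, weakd ord0 k (fun x => u (cons_particle x y)) (fun x => g (cons_particle x y))}.
Proof.
move=> Lu Lg ug.
have inc : {ae leb n, forall y, forall m, {ae leb 1, forall x,
    u (unit_move ord0 k (harm_step m) (cons_particle x y)) - u (cons_particle x y) =
    harm_step m * fwd ord0 k (harm_step_gt0 m) g (cons_particle x y)}}.
  apply: ae_foralln => m.
  exact: (ae_slices (weakd_increment (harm_step_gt0 m) Lu Lg ug)).
apply: filterS3 inc (L2_slices Lu) (L2_slices Lg) => y hy Luy Lgy.
apply: weakd_of_increments => // m; apply: filterS (hy m) => x.
rewrite unit_move_cons_particle => ->; congr (_ * _); apply: eq_Rintegral => r _.
by rewrite unit_move_cons_particle.
Qed.

End weak_derivative_slices.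

(** * Averages, difference quotients and products *)

Section L2_tools.
Context d (T : measurableType d) (R : realType).
Variable mu : {measure set T -> \bar R}.
Implicit Types f g a : T -> R.

Lemma dot_triangle f g (A B : R) : L2 mu f -> L2 mu g -> 0 <= A -> 0 <= B ->
  dot mu f f <= A ^+ 2 -> dot mu g g <= B ^+ 2 ->
  dot mu (fun x => f x + g x) (fun x => f x + g x) <= (A + B) ^+ 2.
Proof.
move=> Lf Lg A0 B0 fA gB; rewrite dotDD//.
by have := normr_dot_le Lf Lg A0 B0 fA gB; rewrite ler_norml => /andP[_]; nra.
Qed.

Lemma le_dot f h : measurable_fun setT f -> L2 mu h ->
  (forall x, `|f x| <= `|h x|) -> L2 mu f /\ dot mu f f <= dot mu h h.
Proof.
move=> mf Lh fh; have mh := L2_measurable Lh.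
have key : (\int[mu]_x (f x ^+ 2)%:E <= \int[mu]_x (h x ^+ 2)%:E)%E.
  apply: ge0_le_integral => //.
  - by move=> x _; rewrite lee_fin sqr_ge0.
  - by apply/measurable_EFinP; apply: measurable_funX.
  - by apply/measurable_EFinP; apply: measurable_funX.
  move=> x _; rewrite lee_fin -(real_normK (num_real (f x))).
  by rewrite -(real_normK (num_real (h x))) ler_sqr ?nnegrE.
have Lf : L2 mu f by split => //; apply: le_lt_trans key _; case: Lh.
by split => //; rewrite -lee_fin !EFin_dot.
Qed.

Lemma L2_mul_bounded a f (C : R) : measurable_fun setT a -> L2 mu f -> 0 <= C ->
  (forall x, f x != 0 -> `|a x| <= C) ->
  L2 mu (fun x => a x * f x) /\
  dot mu (fun x => a x * f x) (fun x => a x * f x) <= C ^+ 2 * dot mu f f.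
Proof.
move=> ma Lf C0 aC; have mf := L2_measurable Lf; have LC := L2Z C Lf.
have -> : C ^+ 2 * dot mu f f = dot mu (fun x => C * f x) (fun x => C * f x).
  by rewrite (dotZl C Lf LC) (dotZr C Lf Lf) mulrA -expr2.
apply: le_dot => //; first exact: measurable_funM.
move=> x; have [->|f0] := eqVneq (f x) 0; first by rewrite !mulr0.
by rewrite !normrM (ger0_norm C0) ler_wpM2r// aC.
Qed.

End L2_tools.

Section weak_calculus.
Context {R : realType} {n : nat}.
Local Notation X := 'M[R]_(n, 2).
Local Notation mu := (@leb R n).
Implicit Types (u g v z phi : X -> R) (x : X) (s r : R) (j : 'I_n) (k l : 'I_2).

Lemma weakd_move_any j k l r u g : L2 mu u -> L2 mu g -> weakd j k u g ->
  weakd j k (fun x => u (unit_move j l r x)) (fun x => g (unit_move j l r x)).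
Proof.
move=> Lu Lg ug phi tp.
have Ld := L2_test (test_pder [:: (j, k)] tp).
rewrite (dot_move j l r Lu Ld) (dot_move j l r Lg (L2_test tp)).
rewrite -(ug _ (test_translate (- r *: delta_mx j l) tp)).
by congr dot; rewrite pder_translate.
Qed.

Lemma weakd_fwd j k l s (s0 : 0 < s) u g : L2 mu u -> L2 mu g -> weakd j k u g ->
  weakd j k (fwd j l s0 u) (fwd j l s0 g).
Proof.
move=> Lu Lg ug phi tp; have Lp := L2_test tp.
have Ld := L2_test (test_pder [:: (j, k)] tp); have LN := L2N Lg.
rewrite (dot_fwd_bwd j l s0 Lg Lp) -(dotNl Lg (L2_bwd j l s0 Lp)).
rewrite -(dot_fwd_bwd j l s0 LN Lp) (dot_fwd j l s0 Lu Ld) (dot_fwd j l s0 LN Lp).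
apply: eq_Rintegral => r _; rewrite (weakd_move_any l r Lu Lg ug tp).
by rewrite -dotNl//; exact: L2_move.
Qed.

Lemma dot_bwd j l s (s0 : 0 < s) u w : L2 mu u -> L2 mu w ->
  dot mu (bwd j l s0 u) w =
  \int[uniform_prob s0]_r dot mu (fun x => u (unit_move j l (- r) x)) w.
Proof.
move=> Lu Lw; apply: dot_avgl => //; first exact: measurable_unit_moveN.
by move=> r; exact: preserves_unit_move.
Qed.

Lemma weakd_bwd j k l s (s0 : 0 < s) u g : L2 mu u -> L2 mu g -> weakd j k u g ->
  weakd j k (bwd j l s0 u) (bwd j l s0 g).
Proof.
move=> Lu Lg ug phi tp; have Lp := L2_test tp.
have Ld := L2_test (test_pder [:: (j, k)] tp); have LN := L2N Lg.
have E : dot mu (bwd j l s0 (fun x => - g x)) phi = - dot mu (bwd j l s0 g) phi.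
  rewrite dotC -(dot_fwd_bwd j l s0 Lp LN) dotC (dotNl Lg (L2_fwd j l s0 Lp)).
  by rewrite dotC (dot_fwd_bwd j l s0 Lp Lg) dotC.
rewrite -E (dot_bwd j l s0 Lu Ld) (dot_bwd j l s0 LN Lp).
apply: eq_Rintegral => r _; rewrite (weakd_move_any l (- r) Lu Lg ug tp).
by rewrite -dotNl//; exact: L2_move.
Qed.

Lemma fwd_pder j k s (s0 : 0 < s) phi : test_function phi ->
  fwd j k s0 (pder [:: (j, k)] phi) =
  (fun x => s^-1 * (phi (unit_move j k s x) - phi x)).
Proof.
move=> tp; apply/funext => x; rewrite /fwd /avg.
have sp := test_smooth tp.
have dF (t : R) : is_derive (t : R) (1 : R) (fun r => phi (unit_move j k r x))
    (pder [:: (j, k)] phi (unit_move j k t x)).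
  rewrite /unit_move [x + _]addrC.
  have := is_derive_along_line (smooth_is_derive (t *: delta_mx j k + x) j k sp).
  by congr is_derive; apply/funext => r; rewrite addrC.
have cf : continuous (fun r : R => pder [:: (j, k)] phi (unit_move j k r x)).
  move=> t; apply: (@continuous_comp _ _ _ (fun r : R => unit_move j k r x : X)
    (pder [:: (j, k)] phi)); last exact/smooth_continuous/smooth_pder.
  rewrite /unit_move; apply: cvgD; first exact: cvg_cst.
  by apply: cvgZl; exact: cvg_id.
rewrite (mean_of_derivative s0 dF cf).
by rewrite /unit_move scale0r addr0.
Qed.

Lemma weakd_decrement j k s (s0 : 0 < s) u g : L2 mu u -> L2 mu g -> weakd j k u g ->
  {ae mu, forall x, u x - u (unit_move j k (- s) x) = s * bwd j k s0 g x}.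
Proof.
move=> Lu Lg ug.
have Lm := L2_move j k (- s) Lu; have Lb := L2_bwd j k s0 Lg.
have L1 := L2B Lu Lm; have L2' := L2Z s Lb.
suff : {ae mu, forall x, (u x - u (unit_move j k (- s) x)) - s * bwd j k s0 g x = 0}.
  by apply: filterS => x /eqP; rewrite subr_eq0 => /eqP.
apply: du_bois_reymond; first exact: L2B.
move=> phi tp; have Lp := L2_test tp; have Lpm := L2_move j k s Lp.
have Ld := L2_test (test_pder [:: (j, k)] tp).
rewrite -/(dot mu _ phi) dotBl// dotBl// dotZl// (dot_move j k (- s) Lu Lp) opprK.
have -> : dot mu (bwd j k s0 g) phi =
    - dot mu u (fwd j k s0 (pder [:: (j, k)] phi)).
  rewrite [RHS](_ : _ = - dot mu (bwd j k s0 u) (pder [:: (j, k)] phi)); last first.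
    by rewrite [in LHS]dotC (dot_fwd_bwd j k s0 Ld Lu) dotC.
  by rewrite (weakd_bwd k s0 Lu Lg ug tp) opprK.
rewrite fwd_pder// dotZr//; last exact: L2B.
by rewrite dotBr//; field; rewrite gt_eqF.
Qed.

Definition quotient j k (s : R) z x : R := s^-1 * (z (unit_move j k s x) - z x).

Lemma L2_quotient j k s z : L2 mu z -> L2 mu (quotient j k s z).
Proof. by move=> Lz; apply/L2Z/L2B => //; exact: L2_move. Qed.

(** Averages gain a derivative in their direction: applied to a first derivative,
    this is the source of the second derivatives of mollified functions. *)
Lemma weakd_fwd_quotient j k s (s0 : 0 < s) z : L2 mu z ->
  weakd j k (fwd j k s0 z) (quotient j k s z).
Proof.
move=> Lz phi tp; have Lp := L2_test tp.
have Ld := L2_test (test_pder [:: (j, k)] tp).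
have Lm := L2_move j k s Lz; have Lpm := L2_move j k (- s) Lp.
rewrite (dot_fwd_bwd j k s0 Lz Ld) bwd_pder// dotZr//; last exact: L2B.
rewrite dotBr// -(dot_move j k s Lz Lp) /quotient dotZl//; last exact: L2B.
by rewrite dotBl//; ring.
Qed.

(** Summation by parts: the difference quotient acts on [v] through the backward
    increment of [v], which is a backward mean of [v']. *)
Lemma dot_quotient j k s (s0 : 0 < s) z v v' : L2 mu z -> L2 mu v -> L2 mu v' ->
  weakd j k v v' -> dot mu (quotient j k s z) v = - dot mu (fwd j k s0 z) v'.
Proof.
move=> Lz Lv Lv' vv'; have Lm := L2_move j k s Lz.
have Lvm := L2_move j k (- s) Lv; have Lb := L2_bwd j k s0 Lv'.
have LI := L2B Lv Lvm; have LS := L2Z s Lb; have [mz _] := Lz.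
have := ae_eq_dot mz mz (L2_measurable LI) (L2_measurable LS)
  (aeW _ (fun=> erefl)) (weakd_decrement s0 Lv Lv' vv').
rewrite dotBr// dotZr// => h.
rewrite /quotient dotZl//; last exact: L2B.
rewrite dotBl// (dot_move j k s Lz Lv) (dot_fwd_bwd j k s0 Lz Lv').
by rewrite -[dot mu z (bwd _ _ _ _)](mulKf (lt0r_neq0 s0)) -h; ring.
Qed.

Lemma weakd_mul j k (chi : X -> R) (C C' : R) u g : smooth chi ->
  (forall x, `|chi x| <= C) -> (forall x, `|pder [:: (j, k)] chi x| <= C') ->
  L2 mu u -> L2 mu g -> weakd j k u g ->
  weakd j k (fun x => chi x * u x) (fun x => chi x * g x + pder [:: (j, k)] chi x * u x).
Proof.
move=> sc cC cC' Lu Lg ug phi tp.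
have mc := smooth_measurable sc; have md := smooth_measurable (smooth_pder [:: (j, k)] sc).
have C0 : 0 <= C by exact: le_trans (cC 0).
have C'0 : 0 <= C' by exact: le_trans (cC' 0).
have Lp := L2_test tp; have Ldp := L2_test (test_pder [:: (j, k)] tp).
have Lcg := (L2_mul_bounded mc Lg C0 (fun x _ => cC x)).1.
have Ldu := (L2_mul_bounded md Lu C'0 (fun x _ => cC' x)).1.
have Lcp := (L2_mul_bounded mc Lp C0 (fun x _ => cC x)).1.
have Lcdp := (L2_mul_bounded mc Ldp C0 (fun x _ => cC x)).1.
have Ldcp := (L2_mul_bounded md Lp C'0 (fun x _ => cC' x)).1.
have := ug _ (smooth_test_mul sc tp).
have -> : pder [:: (j, k)] (fun x => chi x * phi x) =
    (fun x => chi x * pder [:: (j, k)] phi x + pder [:: (j, k)] chi x * phi x).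
  apply/funext => x.
  have [_] := is_deriveM (smooth_is_derive x j k sc)
                         (smooth_is_derive x j k (test_smooth tp)).
  by rewrite /= => ->; rewrite /GRing.scale/= [phi x * _]mulrC.
rewrite dotDr// dotDl// => h.
have e1 : dot mu (fun x => chi x * u x) (pder [:: (j, k)] phi) =
  dot mu u (fun x => chi x * pder [:: (j, k)] phi x).
  by apply: eq_Rintegral => x _; ring.
have e2 : dot mu (fun x => chi x * g x) phi = dot mu g (fun x => chi x * phi x).
  by apply: eq_Rintegral => x _; ring.
have e3 : dot mu (fun x => pder [:: (j, k)] chi x * u x) phi =
  dot mu u (fun x => pder [:: (j, k)] chi x * phi x).
  by apply: eq_Rintegral => x _; ring.
by rewrite e1 e2 e3; move: h; lra.
Qed.

Lemma fwd_eq0 j k s (s0 : 0 < s) u x : measurable_fun setT u ->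
  (forall r, 0 <= r <= s -> u (unit_move j k r x) = 0) -> fwd j k s0 u x = 0.
Proof.
move=> mu' u0; rewrite /fwd /avg /Rintegral.
have mr : measurable_fun setT (fun r : measurableTypeR R => (u (unit_move j k r x))%:E).
  apply/measurable_EFinP.
  have mp : measurable_fun setT (fun r : measurableTypeR R => (x, r)).
    by apply: measurable_fun_pair => //; exact: measurable_cst.
  exact: (measurableT_comp mu' (measurableT_comp (measurable_unit_move j k) mp)).
rewrite integralE !integral_uniform//; last 2 first.
  exact: measurable_funeneg.
  exact: measurable_funepos.
rewrite !integral0_eq ?mule0 ?sube0//.
  by move=> r /=; rewrite in_itv/= => rs; rewrite funenegE u0// -EFinN oppr0 maxxx.
by move=> r /=; rewrite in_itv/= => rs; rewrite funeposE u0// maxxx.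
Qed.

End weak_calculus.

(** * Cutoffs in the form domain of the oscillator *)

Section approximants.
Context {R : realType} {n : nat} (j : 'I_n).
Local Notation X := 'M[R]_(n, 2).
Local Notation mu := (@leb R n).
Implicit Types (u v : X -> R) (g : 'I_2 -> X -> R) (x : X).

Lemma measurable_coord (k : 'I_2) : measurable_fun setT (fun x : X => x j k : R).
Proof. exact: (@measurable_mx_coord _ (measurableTypeR R) n 2 j k). Qed.

(** The form domain of the oscillator of particle [j], for real functions; the
    family [g] lists the two partial derivatives. *)
Definition osc_dom u g := [/\ L2 mu u, forall k, L2 mu (g k),
  forall k, weakd j k u (g k) & forall k, L2 mu (fun x => x j k * u x)].

(** [u'] is close to [u] and has hardly more energy. The last clause lets several
    cutoffs be composed without losing the supports already gained. *)
Definition osc_approx (e : R) u g u' g' := [/\ osc_dom u' g',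
  dot mu (fun x => u' x - u x) (fun x => u' x - u x) <= e ^+ 2,
  forall k, dot mu (g' k) (g' k) <= dot mu (g k) (g k) + e,
  forall k, dot mu (fun x => x j k * u' x) (fun x => x j k * u' x) <=
            dot mu (fun x => x j k * u x) (fun x => x j k * u x) + e &
  forall x, u x = 0 -> u' x = 0].

Lemma osc_approx_trans e e' u g u' g' u'' g'' : 0 <= e -> 0 <= e' ->
  osc_dom u g -> osc_approx e u g u' g' -> osc_approx e' u' g' u'' g'' ->
  osc_approx (e + e') u g u'' g''.
Proof.
move=> e0 e'0 [Lu _ _ _] [[Lu' _ _ _] d1 h1 x1 s1] [dom d2 h2 x2 s2].
have [Lu'' _ _ _] := dom; split=> //.
- have := dot_triangle (L2B Lu' Lu) (L2B Lu'' Lu') e0 e'0 d1 d2.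
  by under eq_fun do rewrite addrC addrA subrK.
- by move=> k; apply: le_trans (h2 k) _; rewrite addrA lerD2r h1.
- by move=> k; apply: le_trans (x2 k) _; rewrite addrA lerD2r x1.
- by move=> x /s1/s2.
Qed.

Lemma sqrt_dot f : Num.sqrt (dot mu f f) ^+ 2 = dot mu f f.
Proof. by rewrite sqr_sqrtr// dot_ge0. Qed.

Lemma flat1_near1 (t : R) : 0 < t -> 1 - t^-1 <= flat 1 t.
Proof.
by move=> t0; rewrite /flat t0 hornerE mul1r; exact: expR_ge1Dx.
Qed.

(** The factor vanishes for [t] below [- m ^ 2], and where [t] is moderate it is
    close to 1; the remaining region is paid for by the first moment. *)
Lemma flat1_cutoff (m t : R) : 1 <= m -> `|flat 1 (m + t / m) - 1| <= 2 / m * (1 + `|t|).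
Proof.
move=> m1; have m0 : 0 < m by exact: lt_le_trans m1.
have t0 : 0 <= `|t| by []; have F1 := flat1_le1 (m + t / m).
have F0 := flat1_ge0 (m + t / m); rewrite ler0_norm ?subr_le0// opprB.
have [tm|tm] := leP `|t| (m / 2).
  have tmm : - (m / 2) <= t / m.
    rewrite -lerN2 opprK -mulNr ler_pdivrMr//.
    apply: le_trans (ler_norm _) _; rewrite normrN (le_trans tm)//.
    by rewrite ler_peMr// divr_ge0// ltW.
  have h : m / 2 <= m + t / m by lra.
  have p : 0 < m + t / m by apply: lt_le_trans h; rewrite divr_gt0.
  have := flat1_near1 p.
  have : (m + t / m)^-1 <= 2 / m.
    by rewrite -[2 / m]invrK invf_div lef_pV2 ?posrE// divr_gt0.
  have : 0 <= 2 / m * `|t| by rewrite mulr_ge0// divr_ge0// ltW.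
  by rewrite mulrDr mulr1; lra.
have : 1 <= 2 / m * `|t|.
  by rewrite mulrAC ler_pdivlMr// mul1r; lra.
have : 0 <= 2 / m by rewrite divr_ge0// ltW.
by rewrite mulrDr mulr1; lra.
Qed.

Lemma small_scale (B e : R) : 0 <= B -> 0 < e -> exists2 m, 1 <= m & B / m <= e.
Proof.
move=> B0 e0; exists (1 + B / e); first by rewrite lerDl divr_ge0// ltW.
rewrite ler_pdivrMr; last by rewrite ltr_pwDl// divr_ge0// ltW.
by rewrite mulrDr mulr1 mulrCA divff ?gt_eqF// mulr1; lra.
Qed.

(** One flat factor removes a half plane. It is a contraction on [u], on the
    moments of [u] and on the derivatives, except for the derivative of the factor
    itself, which is of order [1 / m]. *)
Lemma cutoff_step (e c : R) (l : 'I_2) u g : 0 < e -> `|c| = 1 -> osc_dom u g ->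
  exists u' g' M, osc_approx e u g u' g' /\ forall x, M <= - c * x j l -> u' x = 0.
Proof.
move=> e0 c1 [Lu Lg ug Lx].
have [C C0 flatC] := flat_bounded ('X^2 * (1 - 1^`()) : {poly R}).
pose A := Num.sqrt (dot mu u u); have A0 : 0 <= A by exact: sqrtr_ge0.
pose G k := Num.sqrt (dot mu (g k) (g k)); have G0 k : 0 <= G k by exact: sqrtr_ge0.
pose D := Num.sqrt (dot mu (fun x => x j l * u x) (fun x => x j l * u x)).
have D0 : 0 <= D by exact: sqrtr_ge0.
(* [B / m] bounds the distance to [u] and the increase of the squared derivatives. *)
pose B := C * A + (2 * A + 2 * D) + (2 * (G ord0 + G ord_max) * (C * A) + (C * A) ^+ 2).
have CA0 : 0 <= C * A by rewrite mulr_ge0.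
have AD0 : 0 <= 2 * A + 2 * D by rewrite addr_ge0// mulr_ge0.
have GC0 k : 0 <= 2 * G k * (C * A) by rewrite !mulr_ge0.
have BE : B = C * A + (2 * A + 2 * D) +
    (2 * G ord0 * (C * A) + 2 * G ord_max * (C * A) + (C * A) ^+ 2) by rewrite /B; ring.
have B0 : 0 <= B by rewrite BE !addr_ge0// ?sqr_ge0// mulr_ge0.
have [m m1 Bm] := small_scale B0 e0.
have m0 : 0 < m by exact: lt_le_trans m1.
have part b : 0 <= b -> b <= B -> b / m <= e.
  by move=> b0 bB; apply: le_trans Bm; rewrite ler_pM2r ?invr_gt0.
pose F x : R := flat 1 (m + c / m * x j l).
have sF : smooth F by exact: smooth_flat.
have FE x : F x = flat 1 (m + (c * x j l) / m) by rewrite /F mulrAC.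
have F0 x : 0 <= F x by exact: flat1_ge0.
have F1 x : `|F x| <= 1 by rewrite ger0_norm// flat1_le1.
have dF k x : `|pder [:: (j, k)] F x| <= C / m.
  have := is_derive_flat_coord 1 1 m (c / m) j j l k x.
  rewrite (_ : (fun _ => _) = F); last by apply/funext => y; rewrite mul1r.
  move=> [_]; rewrite /= => ->; rewrite eqxx mul1r andTb !normrM c1 mul1r mulrC.
  have m1le : `|m^-1| * `|(l == k)%:R| <= m^-1.
    rewrite (gtr0_norm (x := m^-1)) ?invr_gt0// -[leRHS]mulr1.
    rewrite ler_wpM2l ?invr_ge0 ?(ltW m0)//.
    by case: (l == k); rewrite ?normr0 ?normr1.
  by apply: ler_pM => //; rewrite mulr_ge0.
have CM : 0 <= C / m by rewrite divr_ge0// ltW.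
have mF := smooth_measurable sF.
have mdF k := smooth_measurable (smooth_pder [:: (j, k)] sF).
have [LFu LFu_le] := L2_mul_bounded mF Lu ler01 (fun x _ => F1 x).
have LdFu k := L2_mul_bounded (mdF k) Lu CM (fun x _ => dF k x).
have LFg k := L2_mul_bounded mF (Lg k) ler01 (fun x _ => F1 x).
have LxF k := L2_mul_bounded mF (Lx k) ler01 (fun x _ => F1 x).
have xE k : (fun x => F x * (x j k * u x)) = (fun x => x j k * (F x * u x)).
  by apply/funext => x; rewrite mulrCA.
exists (fun x => F x * u x), (fun k x => F x * g k x + pder [:: (j, k)] F x * u x), (m ^+ 2).
split; last first.
  move=> x Mx; rewrite FE /flat ifF ?mul0r//; apply/negbTE; rewrite -leNgt.
  by rewrite -lerBrDl sub0r ler_pdivrMr// mulNr -expr2; move: Mx; rewrite mulNr; lra.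
split.
- split=> //.
  + by move=> k; apply: L2D; [exact: (LFg k).1|exact: (LdFu k).1].
  + by move=> k; exact: (weakd_mul sF F1 (dF k) Lu (Lg k) (ug k)).
  + by move=> k; rewrite -xE; exact: (LxF k).1.
- pose h1 := fun x => 2 / m * `|u x|; pose h2 := fun x => 2 / m * `|x j l * u x|.
  have Labs (f : X -> R) : L2 mu f -> L2 mu (fun x => `|f x|) /\
      dot mu (fun x => `|f x|) (fun x => `|f x|) <= dot mu f f.
    move=> Lf; apply: le_dot => //; last by move=> x; rewrite normr_id.
    by apply: measurableT_comp; last exact: L2_measurable Lf.
  have s0 : 0 <= 2 / m by rewrite divr_ge0// ltW.
  have bound (f : X -> R) (K : R) : L2 mu f -> dot mu f f = K ^+ 2 ->
      dot mu (fun x => 2 / m * `|f x|) (fun x => 2 / m * `|f x|) <= (2 / m * K) ^+ 2.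
    move=> Lf fK; have [La lea] := Labs _ Lf.
    rewrite (dotZl (2 / m) La (L2Z (2 / m) La)) (dotZr (2 / m) La La) mulrA -expr2 [leRHS]exprMn.
    by rewrite ler_wpM2l ?sqr_ge0// -fK.
  have := dot_triangle (L2Z (2 / m) (Labs _ Lu).1) (L2Z (2 / m) (Labs _ (Lx l)).1)
    (mulr_ge0 s0 A0) (mulr_ge0 s0 D0) (bound _ _ Lu (esym (sqrt_dot u)))
    (bound _ _ (Lx l) (esym (sqrt_dot _))).
  move=> h; apply: le_trans (le_trans h _).
    apply: (le_dot _ _ _).2.
    + by apply: L2_measurable; exact: (L2B LFu Lu).
    + by apply: L2D; apply: L2Z; [exact: (Labs _ Lu).1|exact: (Labs _ (Lx l)).1].
    move=> x; have := flat1_cutoff (c * x j l) m1; rewrite -FE => le1.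
    rewrite -[X in _ - X]mul1r -mulrBl normrM.
    have -> : 2 / m * `|u x| + 2 / m * `|x j l * u x| =
        2 / m * (1 + `|c * x j l|) * `|u x| by rewrite !normrM c1; ring.
    by rewrite [leRHS]ger0_norm ?ler_wpM2r// !mulr_ge0// ?addr_ge0// invr_ge0 ltW.
  rewrite ler_sqr ?nnegrE ?(ltW e0) ?(addr_ge0 (mulr_ge0 s0 A0) (mulr_ge0 s0 D0))//.
  rewrite (_ : _ + _ = (2 * A + 2 * D) / m); last by rewrite -mulrDr; ring.
  apply: part => //; rewrite BE.
  by have := GC0 ord0; have := GC0 ord_max; have := sqr_ge0 (C * A); lra.
- move=> k.
  have gk := (LFg k).2; rewrite expr1n mul1r -(sqrt_dot (g k)) -/(G k) in gk.
  have du := (LdFu k).2; rewrite -(sqrt_dot u) -/A -exprMn in du.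
  have := dot_triangle (LFg k).1 (LdFu k).1 (G0 k) (mulr_ge0 CM A0) gk du.
  move/le_trans; apply; rewrite -(sqrt_dot (g k)) -/(G k) sqrrD -addrA lerD2l.
  have -> : G k * (C / m * A) *+ 2 + (C / m * A) ^+ 2 =
     (2 * G k * (C * A) + (C * A) ^+ 2 / m) / m by field; rewrite gt_eqF.
  apply: part; first by rewrite addr_ge0// divr_ge0 ?sqr_ge0// ltW.
  have : (C * A) ^+ 2 / m <= (C * A) ^+ 2 by rewrite ler_pdivrMr// ler_peMr ?sqr_ge0.
  rewrite BE; have := GC0 ord0; have := GC0 ord_max.
  by case: (ord2P k) => ->; lra.
- by move=> k; rewrite -xE; have := (LxF k).2; rewrite expr1n mul1r => /le_trans; apply; rewrite lerDl ltW.
- by move=> x ->; rewrite mulr0.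
Qed.

Lemma cutoff (e : R) u g : 0 < e -> osc_dom u g -> exists u' g' M,
  osc_approx e u g u' g' /\ forall x k, M <= `|x j k| -> u' x = 0.
Proof.
move=> e0 dom; pose d := e / 4; have d0 : 0 < d by rewrite divr_gt0.
have n1 : `|1| = 1 :> R by rewrite normr1.
have n2 : `|-1| = 1 :> R by rewrite normrN1.
have [u1 [g1 [M1 [a1 s1]]]] := cutoff_step 0 d0 n1 dom.
have [dom1 _ _ _ z1] := a1.
have [u2 [g2 [M2 [a2 s2]]]] := cutoff_step 0 d0 n2 dom1.
have [dom2 _ _ _ z2] := a2.
have [u3 [g3 [M3 [a3 s3]]]] := cutoff_step ord_max d0 n1 dom2.
have [dom3 _ _ _ z3] := a3.
have [u4 [g4 [M4 [a4 s4]]]] := cutoff_step ord_max d0 n2 dom3.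
have [dom4 _ _ _ z4] := a4.
exists u4, g4, (Num.max (Num.max M1 M2) (Num.max M3 M4)); split.
  have dd := ltW d0.
  have b2 := osc_approx_trans dd dd dom a1 a2.
  have b3 := osc_approx_trans (addr_ge0 dd dd) dd dom b2 a3.
  have b4 := osc_approx_trans (addr_ge0 (addr_ge0 dd dd) dd) dd dom b3 a4.
  by rewrite (_ : e = d + d + d + d)// /d; field.
move=> x k; rewrite !ge_max => /andP[/andP[h1 h2] /andP[h3 h4]].
have absE (t : R) : `|t| = - 1 * t \/ `|t| = - - 1 * t.
  by case: (ler0P t) => _; [left|right]; ring.
case: (ord2P k) h1 h2 h3 h4 => ->.
  case: (absE (x j 0)) => -> h1 h2 h3 h4.
    by apply/z4/z3/z2/s1.
  by apply/z4/z3/s2.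
case: (absE (x j ord_max)) => -> h1 h2 h3 h4.
  by apply/z4/s3.
exact/s4.
Qed.

End approximants.

(** * Approximation of the form domain by the operator domain *)

Section mollification.
Context {R : realType} {n : nat} (j : 'I_n).
Local Notation X := 'M[R]_(n, 2).
Local Notation mu := (@leb R n).
Implicit Types (u v : X -> R) (g : 'I_2 -> X -> R) (x : X).

Lemma unit_moveE l k (r : R) x :
  (unit_move j l r x) j k = x j k + r * (k == l)%:R.
Proof. by rewrite /unit_move !mxE eqxx. Qed.

Lemma support_fwd l (h M : R) (h0 : 0 < h) u : measurable_fun setT u -> h <= 1 ->
  (forall x k, M <= `|x j k| -> u x = 0) ->
  forall x k, M + 1 <= `|x j k| -> fwd j l h0 u x = 0.
Proof.
move=> mu' h1 uM x k Mx; apply: fwd_eq0 => // r /andP[r0 rh].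
apply: (uM _ k); rewrite unit_moveE.
have := ler_normB (x j k + r * (k == l)%:R) (r * (k == l)%:R); rewrite addrK => h2.
have : `|r * (k == l)%:R| <= 1.
  by rewrite normrM ger0_norm// mulr_ile1// ?(le_trans rh)//; case: (k == l); rewrite ?normr0 ?normr1.
by move: Mx h2; lra.
Qed.

(** [v] averages [u] over short segments in both directions. In each direction its
    second derivative is a difference quotient of a first derivative, hence is
    square integrable, and summation by parts turns its product with [v] into minus
    the square of the first derivative, which the averages do not increase. *)
Lemma mollify (h M : R) u g : 0 < h -> h <= 1 -> osc_dom j u g ->
  (forall x k, M <= `|x j k| -> u x = 0) ->
  exists v (v' w : 'I_2 -> X -> R),
  [/\ L2 mu v, forall k, L2 mu (v' k) /\ L2 mu (w k),
      forall k, weakd j k v (v' k) /\ weakd j k (v' k) (w k),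
      forall k, dot mu (w k) v = - dot mu (v' k) (v' k) /\
                dot mu (v' k) (v' k) <= dot mu (g k) (g k) &
      (forall x k, M + 2 <= `|x j k| -> v x = 0) /\
      dot mu (fun x => v x - u x) (fun x => v x - u x) <=
        (h * (Num.sqrt (dot mu (g ord0) (g ord0)) + Num.sqrt (dot mu (g ord_max) (g ord_max)))) ^+ 2].
Proof.
move=> h0 h1 [Lu Lg ug Lx] uM.
pose A0 := fwd j ord0 h0; pose A1 := fwd j ord_max h0.
have L0 f : L2 mu f -> L2 mu (A0 f) by exact: L2_fwd.
have L1 f : L2 mu f -> L2 mu (A1 f) by exact: L2_fwd.
pose v := A0 (A1 u); pose v' k := A0 (A1 (g k)).
pose w (k : 'I_2) := if k == ord0 then quotient j ord0 h (A1 (g ord0))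
  else A0 (quotient j ord_max h (g ord_max)).
have Lv : L2 mu v by exact/L0/L1.
have Lv' k : L2 mu (v' k) by exact/L0/L1.
have Lq : L2 mu (quotient j ord_max h (g ord_max)) by exact: L2_quotient.
have vv' k : weakd j k v (v' k).
  by apply: weakd_fwd; [exact: L1|exact: L1|exact: weakd_fwd].
exists v, v', w; split; first exact: Lv.
- move=> k; split; first exact: Lv'.
  rewrite /w; case: (k == ord0); last exact: L0.
  by apply: L2_quotient; exact: L1.
- move=> k; split; first exact: vv'.
  rewrite /w; case: (ord2P k) => -> /=.
    by apply: weakd_fwd_quotient; exact: L1.
  apply: weakd_fwd; [exact: L1|exact: Lq|exact: weakd_fwd_quotient].
- move=> k; split; last first.
    by apply: le_trans (dot_fwd_le j ord0 h0 (L1 _ (Lg k))) (dot_fwd_le j ord_max h0 (Lg k)).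
  rewrite /w; case: (ord2P k) => -> /=.
    by rewrite (dot_quotient h0 (L1 _ (Lg ord0)) Lv (Lv' ord0) (vv' ord0)).
  rewrite (dot_fwd_bwd j ord0 h0 Lq Lv).
  have Lb f : L2 mu f -> L2 mu (bwd j ord0 h0 f) by exact: L2_bwd.
  have wb := weakd_bwd ord0 h0 Lv (Lv' ord_max) (vv' ord_max).
  rewrite (dot_quotient h0 (Lg ord_max) (Lb _ Lv) (Lb _ (Lv' ord_max)) wb).
  by rewrite -(dot_fwd_bwd j ord0 h0 (L1 _ (Lg ord_max)) (Lv' ord_max)).
- split.
    move=> x k Mx; apply: (@support_fwd ord0 h (M + 1) h0 _ _ h1 _ x k); last by move: Mx; lra.
      by apply: L2_measurable; exact: L1.
    by apply: support_fwd => //; exact: L2_measurable Lu.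
  have G2 k : Num.sqrt (dot mu (g k) (g k)) ^+ 2 = dot mu (g k) (g k).
    by rewrite sqr_sqrtr// dot_ge0.
  have hG k : 0 <= h * Num.sqrt (dot mu (g k) (g k)).
    by rewrite mulr_ge0 ?sqrtr_ge0// ltW.
  have d0 := dot_fwd_sub_le h0 (L1 _ Lu) (L1 _ (Lg ord0)) (weakd_fwd ord_max h0 Lu (Lg ord0) (ug ord0)).
  have d1 := dot_fwd_sub_le h0 Lu (Lg ord_max) (ug ord_max).
  have {}d0 : dot mu (fun x => A0 (A1 u) x - A1 u x) (fun x => A0 (A1 u) x - A1 u x) <=
     (h * Num.sqrt (dot mu (g ord0) (g ord0))) ^+ 2.
    apply: le_trans d0 _; rewrite exprMn G2 ler_wpM2l ?sqr_ge0//.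
    exact: (dot_fwd_le j ord_max h0 (Lg ord0)).
  have {}d1 : dot mu (fun x => A1 u x - u x) (fun x => A1 u x - u x) <=
     (h * Num.sqrt (dot mu (g ord_max) (g ord_max))) ^+ 2 by rewrite exprMn G2.
  have := dot_triangle (L2B Lv (L1 _ Lu)) (L2B (L1 _ Lu) Lu) (hG _) (hG _) d0 d1.
  rewrite -mulrDr.
  by under eq_fun do rewrite addrA subrK.
Qed.

Lemma laplacianE (phi : X -> R) x : laplacian j phi x =
  pder [:: (j, ord0)] (pder [:: (j, ord0)] phi) x +
  pder [:: (j, ord_max)] (pder [:: (j, ord_max)] phi) x.
Proof.
by rewrite /laplacian big_ord_recl big_ord1; congr (_ + _).
Qed.

Lemma sqlenE (z : 'rV[R]_2) : sqlen z = z ord0 ord0 ^+ 2 + z ord0 ord_max ^+ 2.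
Proof.
by rewrite /sqlen big_ord_recl big_ord1; congr (_ + z _ _ ^+ 2); exact: val_inj.
Qed.

Lemma sqlen_rowE x : sqlen (row j x) = x j ord0 ^+ 2 + x j ord_max ^+ 2.
Proof. by rewrite sqlenE !mxE. Qed.

Definition osc_energy (omega : R) u g : R :=
  dot mu (g ord0) (g ord0) + dot mu (g ord_max) (g ord_max) +
  omega ^+ 2 * (dot mu (fun x => x j ord0 * u x) (fun x => x j ord0 * u x) +
                dot mu (fun x => x j ord_max * u x) (fun x => x j ord_max * u x)).

(** [tau] is the oscillator applied to [v]: the support of [v] is bounded in the
    coordinates of particle [j], so multiplying twice by a coordinate is harmless. *)
Lemma osc_approximation (omega e M : R) u g : 0 < e -> osc_dom j u g ->
  (forall x k, M <= `|x j k| -> u x = 0) ->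
  exists v tau, [/\ L2 mu v, L2 mu tau,
    forall phi, test_function phi ->
      dot mu v (fun x => - laplacian j phi x + omega ^+ 2 * sqlen (row j x) * phi x) =
      dot mu tau phi,
    dot mu tau v <= osc_energy omega u g + e &
    dot mu (fun x => v x - u x) (fun x => v x - u x) <= e ^+ 2].
Proof.
move=> e0 dom uM; have [Lu Lg ug Lx] := dom.
pose G := Num.sqrt (dot mu (g ord0) (g ord0)) + Num.sqrt (dot mu (g ord_max) (g ord_max)).
have G0 : 0 <= G by rewrite addr_ge0 ?sqrtr_ge0.
pose P k := Num.sqrt (dot mu (fun x => x j k * u x) (fun x => x j k * u x)).
have P0 k : 0 <= P k by exact: sqrtr_ge0.
have P2 k : P k ^+ 2 = dot mu (fun x => x j k * u x) (fun x => x j k * u x).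
  by rewrite sqr_sqrtr// dot_ge0.
(* Outside the strip of half-width [L] both [u] and [v] vanish. *)
pose L := `|M| + 2; have L0 : 0 <= L by rewrite addr_ge0.
pose b k := 2 * P k * (L * G) + (L * G) ^+ 2.
have LG0 : 0 <= L * G by rewrite mulr_ge0.
have b0 k : 0 <= b k by rewrite addr_ge0 ?sqr_ge0// !mulr_ge0.
pose B := G + omega ^+ 2 * (b ord0 + b ord_max).
have ob0 : 0 <= omega ^+ 2 * (b ord0 + b ord_max).
  by rewrite mulr_ge0 ?sqr_ge0// addr_ge0.
have [m m1 Bm] := small_scale (addr_ge0 G0 ob0) e0.
have m0 : 0 < m by exact: lt_le_trans m1.
have h0 : 0 < m^-1 by rewrite invr_gt0.
have h1 : m^-1 <= 1 by rewrite invf_le1.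
have Ge : m^-1 * G <= e.
  by apply: le_trans Bm; rewrite mulrC ler_pM2r// lerDl.
have be : m^-1 * (omega ^+ 2 * (b ord0 + b ord_max)) <= e.
  by apply: le_trans Bm; rewrite mulrC ler_pM2r// lerDr.
have [v [v' [w [Lv Lv'w vv' wv [vM vu]]]]] := mollify h0 h1 dom uM.
have Lv' k := (Lv'w k).1; have Lw k := (Lv'w k).2.
have vL x k : v x != 0 -> `|x j k| <= L.
  apply: contra_neqT; rewrite -ltNge => Lx'; apply: (vM x k); apply: le_trans (ltW Lx').
  by rewrite lerD2r ler_norm.
have Lxv k := (L2_mul_bounded (measurable_coord j k) Lv L0 (fun x => vL x k)).1.
have xvL x k : x j k * v x != 0 -> `|x j k| <= L.
  by move=> h; apply: vL; apply: contra_neq h => ->; rewrite mulr0.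
have Lxxv k := (L2_mul_bounded (measurable_coord j k) (Lxv k) L0 (fun x => xvL x k)).1.
have Lvu := L2B Lv Lu.
have xvP k : dot mu (fun x => x j k * v x) (fun x => x j k * v x) <= P k ^+ 2 + m^-1 * b k.
  have vuL x : v x - u x != 0 -> `|x j k| <= L.
    apply: contra_neqT; rewrite -ltNge => Lx'; rewrite (vM x k) ?(uM x k) ?subrr//.
      by apply: le_trans (ltW Lx'); rewrite (le_trans (ler_norm _))// lerDl.
    by apply: le_trans (ltW Lx'); rewrite lerD2r ler_norm.
  have [Ld led] := L2_mul_bounded (measurable_coord j k) Lvu L0 vuL.
  have {}led := le_trans led (ler_wpM2l (sqr_ge0 L) vu).
  rewrite -exprMn -/G in led.
  have LhG : 0 <= L * (m^-1 * G) by rewrite !mulr_ge0// ltW.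
  have := dot_triangle (Lx k) Ld (P0 k) LhG _ led; rewrite P2 => /(_ (lexx _)).
  under eq_fun do rewrite -mulrDr addrC subrK.
  move/le_trans; apply; rewrite -P2 sqrrD -addrA lerD2l.
  have -> : P k * (L * (m^-1 * G)) *+ 2 + (L * (m^-1 * G)) ^+ 2 =
    m^-1 * (2 * P k * (L * G) + m^-1 * (L * G) ^+ 2) by ring.
  rewrite ler_wpM2l ?(ltW h0)// /b lerD2l ler_piMl// sqr_ge0//.
pose xx k x := x j k * (x j k * v x).
exists v, (fun x => - (w ord0 x + w ord_max x) + omega ^+ 2 * (xx ord0 x + xx ord_max x)).
have LW := L2N (L2D (Lw ord0) (Lw ord_max)).
have LX : L2 mu (fun x => xx ord0 x + xx ord_max x) by exact: (L2D (Lxxv ord0) (Lxxv ord_max)).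
have LoX := L2Z (omega ^+ 2) LX.
split; first exact: Lv.
- exact: L2D LW LoX.
- move=> phi tphi; have Lphi := L2_test tphi.
  have tdd k : test_function (pder [:: (j, k)] (pder [:: (j, k)] phi)).
    by apply: test_pder; exact: test_pder.
  have Ldd k := L2_test (tdd k).
  have [_ [K phiK]] := tphi.
  have phiN x k : phi x != 0 -> `|x j k| <= `|K|.
    apply: contra_neqT; rewrite -ltNge => Kx; apply: phiK.
    by apply: le_lt_trans (ler_norm K) (lt_le_trans Kx (mx_entry_le_norm _ _ _)).
  have Lxp k := (L2_mul_bounded (measurable_coord j k) Lphi (normr_ge0 K) (fun x => phiN x k)).1.
  have Lxxp k : L2 mu (fun x => x j k * (x j k * phi x)).
    apply: (L2_mul_bounded (measurable_coord j k) (Lxp k) (normr_ge0 K) _).1 => x h.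
    by apply: phiN; apply: contra_neq h => ->; rewrite mulr0.
  have -> : (fun x => - laplacian j phi x + omega ^+ 2 * sqlen (row j x) * phi x) =
    (fun x => - (pder [:: (j, ord0)] (pder [:: (j, ord0)] phi) x +
                 pder [:: (j, ord_max)] (pder [:: (j, ord_max)] phi) x) +
       omega ^+ 2 * (x j ord0 * (x j ord0 * phi x) + x j ord_max * (x j ord_max * phi x))).
    apply/funext => x; rewrite laplacianE sqlen_rowE; congr (_ + _); ring.
  rewrite (dotDr (L2N (L2D (Ldd ord0) (Ldd ord_max))) (L2Z (omega ^+ 2) (L2D (Lxxp ord0) (Lxxp ord_max))) Lv).
  rewrite (dotNr (L2D (Ldd ord0) (Ldd ord_max)) Lv) (dotDr (Ldd ord0) (Ldd ord_max) Lv).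
  rewrite (dotZr (omega ^+ 2) (L2D (Lxxp ord0) (Lxxp ord_max)) Lv) (dotDr (Lxxp ord0) (Lxxp ord_max) Lv).
  rewrite (dotDl LW LoX Lphi) (dotNl (L2D (Lw ord0) (Lw ord_max)) Lphi) (dotDl (Lw ord0) (Lw ord_max) Lphi).
  rewrite (dotZl (omega ^+ 2) LX Lphi) (dotDl (Lxxv ord0) (Lxxv ord_max) Lphi).
  have ddE k : dot mu v (pder [:: (j, k)] (pder [:: (j, k)] phi)) = dot mu (w k) phi.
    by rewrite (vv' k).1 ?(vv' k).2 ?opprK//; exact: test_pder.
  have xE k : dot mu v (fun x => x j k * (x j k * phi x)) = dot mu (xx k) phi.
    by apply: eq_Rintegral => x _; rewrite /xx; ring.
  by congr (- (_ + _) + _ * (_ + _)); [exact: ddE|exact: ddE|exact: xE|exact: xE].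
- rewrite (dotDl LW LoX Lv) (dotNl (L2D (Lw ord0) (Lw ord_max)) Lv) (dotDl (Lw ord0) (Lw ord_max) Lv).
  rewrite (dotZl (omega ^+ 2) LX Lv) (dotDl (Lxxv ord0) (Lxxv ord_max) Lv).
  have xE k : dot mu (xx k) v = dot mu (fun x => x j k * v x) (fun x => x j k * v x).
    by apply: eq_Rintegral => x _; rewrite /xx; ring.
  rewrite (xE ord0) (xE ord_max) (wv ord0).1 (wv ord_max).1 /osc_energy -!P2.
  have o2 := sqr_ge0 omega.
  have := ler_wpM2l o2 (lerD (xvP ord0) (xvP ord_max)).
  have := (wv ord0).2; have := (wv ord_max).2; move: be.
  by rewrite !mulrDr ![m^-1 * (_ * _)]mulrCA; lra.
- apply: le_trans vu _; rewrite ler_sqr ?nnegrE ?(ltW e0)// mulr_ge0// ltW//.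
Qed.

Lemma osc_approximants (omega e : R) u g : 0 < e -> osc_dom j u g ->
  exists v tau, [/\ L2 mu v, L2 mu tau,
    forall phi, test_function phi ->
      dot mu v (fun x => - laplacian j phi x + omega ^+ 2 * sqlen (row j x) * phi x) =
      dot mu tau phi,
    dot mu tau v <= osc_energy omega u g + e &
    dot mu (fun x => v x - u x) (fun x => v x - u x) <= e ^+ 2].
Proof.
move=> e0 dom; have o2 := sqr_ge0 omega.
pose d := e / (4 + 2 * omega ^+ 2).
have p : 0 < 4 + 2 * omega ^+ 2 by lra.
have d0 : 0 < d by rewrite divr_gt0.
have de : (4 + 2 * omega ^+ 2) * d = e by rewrite mulrC divfK// gt_eqF.
have [u' [g' [M [[dom' d1 dg dx _] uM]]]] := cutoff d0 dom.
have [v [tau [Lv Lt vt tv vu]]] := osc_approximation omega d0 dom' uM.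
have [Lu _ _ _] := dom; have [Lu' _ _ _] := dom'.
exists v, tau; split; [exact: Lv|exact: Lt|exact: vt| |].
  apply: le_trans tv _; rewrite /osc_energy -de.
  have := dg ord0; have := dg ord_max.
  have := ler_wpM2l o2 (lerD (dx ord0) (dx ord_max)).
  by rewrite !mulrDr; lra.
have := dot_triangle (L2B Lu' Lu) (L2B Lv Lu') (ltW d0) (ltW d0) d1 vu.
under eq_fun do rewrite addrC addrA subrK.
move/le_trans; apply; rewrite ler_sqr ?nnegrE ?addr_ge0 ?(ltW d0) ?(ltW e0)//.
have : 0 <= omega ^+ 2 * d by rewrite mulr_ge0// ltW.
by rewrite -de mulrDl -mulrA; lra.
Qed.

End mollification.

(** * The oscillator form bounds the square root of the oscillator *)

Section square_root.
Context {R : realType} {n : nat}.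
Local Notation X := 'M[R]_(n, 2).
Local Notation mu := (@leb R n).
Local Notation pair := ((X -> R) * (X -> R))%type.
Implicit Types (psi chi : X -> R[i]) (p q : pair) (S T : @operator R n).

(** Hilbert space arguments are carried out over the reals, a complex function being
    given by its real and imaginary parts. *)
Definition cpx (p : pair) : X -> R[i] := fun x => Complex (p.1 x) (p.2 x).

Lemma cRe_cpx p : cRe (cpx p) = p.1. Proof. by apply/funext. Qed.
Lemma cIm_cpx p : cIm (cpx p) = p.2. Proof. by apply/funext. Qed.

Lemma cpxK psi : cpx (cRe psi, cIm psi) = psi.
Proof. by apply/funext => x; rewrite /cpx /cRe /cIm /=; case: (psi x). Qed.

Lemma is_L2_cpx p : is_L2 (cpx p) <-> L2 mu p.1 /\ L2 mu p.2.
Proof. by rewrite is_L2P cRe_cpx cIm_cpx. Qed.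

Definition rdot p q : R := dot mu p.1 q.1 + dot mu p.2 q.2.
Definition idot p q : R := dot mu p.1 q.2 - dot mu p.2 q.1.

Lemma inner_cpx p q : is_L2 (cpx p) -> is_L2 (cpx q) ->
  inner (cpx p) (cpx q) = Complex (rdot p q) (idot p q).
Proof. by move=> Lp Lq; rewrite innerE// !cRe_cpx !cIm_cpx. Qed.

Lemma self_adjoint_cpx S p q : self_adjoint S -> S (cpx p) (cpx q) <->
  [/\ is_L2 (cpx p), is_L2 (cpx q) & forall p' q', S (cpx p') (cpx q') ->
    rdot q' p = rdot p' q /\ idot q' p = idot p' q].
Proof.
move=> [_ sa]; split.
  move=> Spq; have [Lp Lq h] := (sa _ _).1 Spq; split=> // p' q' S'.
  have [Lp' Lq' _] := (sa _ _).1 S'.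
  by have := h _ _ S'; rewrite !inner_cpx// => -[].
move=> [Lp Lq h]; apply/sa; split=> // psi' chi'.
rewrite -(cpxK psi') -(cpxK chi') => S'.
have [Lp' Lq' _] := (sa _ _).1 S'.
by have [h1 h2] := h _ _ S'; rewrite !inner_cpx// h1 h2.
Qed.

(** Complex linearity of a self-adjoint operator is what recovers imaginary parts of
    inner products from real ones. *)
Definition mul_i p : pair := (fun x => - p.2 x, p.1).

Lemma is_L2_mul_i p : is_L2 (cpx p) -> is_L2 (cpx (mul_i p)).
Proof. by move/is_L2_cpx => [L1 L2']; apply/is_L2_cpx; split => //; exact: L2N. Qed.

Lemma rdot_mul_i p q : is_L2 (cpx p) -> is_L2 (cpx q) ->
  rdot (mul_i p) q = idot p q /\ idot (mul_i p) q = - rdot p q.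
Proof.
move=> /is_L2_cpx[L1 L2'] /is_L2_cpx[M1 M2]; rewrite /rdot /idot /= !dotNl//.
by split; ring.
Qed.

Lemma rdot_mul_ir p q : is_L2 (cpx p) -> is_L2 (cpx q) ->
  rdot p (mul_i q) = - idot p q /\ idot p (mul_i q) = rdot p q.
Proof.
move=> /is_L2_cpx[L1 L2'] /is_L2_cpx[M1 M2]; rewrite /rdot /idot /= !dotNr//.
by split; ring.
Qed.

Lemma self_adjoint_mul_i S p q : self_adjoint S -> S (cpx p) (cpx q) ->
  S (cpx (mul_i p)) (cpx (mul_i q)).
Proof.
move=> sa /(self_adjoint_cpx _ _ sa)[Lp Lq h]; apply/(self_adjoint_cpx _ _ sa).
split; [exact: is_L2_mul_i|exact: is_L2_mul_i|] => p' q' S'.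
have [Lp' Lq' _] := (self_adjoint_cpx _ _ sa).1 S'; have [h1 h2] := h _ _ S'.
have [-> ->] := rdot_mul_ir Lq' Lp; have [-> ->] := rdot_mul_ir Lp' Lq.
by rewrite h1 h2.
Qed.

Lemma rdot_lin_r a p q r : is_L2 (cpx p) -> is_L2 (cpx q) -> is_L2 (cpx r) ->
  rdot r (a *: p + q) = a * rdot r p + rdot r q /\
  idot r (a *: p + q) = a * idot r p + idot r q.
Proof.
move=> /is_L2_cpx[L1 L2'] /is_L2_cpx[M1 M2] /is_L2_cpx[N1 N2].
have e f g h : L2 mu f -> L2 mu g -> L2 mu h ->
    dot mu h (a *: f + g) = a * dot mu h f + dot mu h g.
  move=> Lf Lg Lh; have -> : a *: f + g = (fun x => a * f x + g x) by apply/funext.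
  by rewrite (dotDr (L2Z a Lf) Lg Lh) dotZr.
by rewrite /rdot /idot /= !e//; split; ring.
Qed.

Lemma is_L2_lin a p q : is_L2 (cpx p) -> is_L2 (cpx q) -> is_L2 (cpx (a *: p + q)).
Proof.
move=> /is_L2_cpx[L1 L2'] /is_L2_cpx[M1 M2]; apply/is_L2_cpx; split.
  exact: L2D (L2Z a L1) M1.
exact: L2D (L2Z a L2') M2.
Qed.

Lemma rdotC p q : rdot p q = rdot q p.
Proof. by rewrite /rdot (dotC _ p.1) (dotC _ p.2). Qed.

Lemma quadratic_bound (b l Q : R) : 0 <= b -> 0 <= Q ->
  (forall t, 2 * t * l <= t ^+ 2 * b + Q) -> l ^+ 2 <= Q * b.
Proof.
move=> b0 Q0 h; have [b00|bn0] := eqVneq b 0.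
  have [->|l0] := eqVneq l 0; first by rewrite b00 mulr0 expr0n.
  have := h ((Q + 1) / (2 * l)); rewrite b00 mulr0.
  by rewrite (_ : 2 * _ * l = Q + 1) ?add0r; [lra|field].
have bp : 0 < b by rewrite lt_def bn0.
have := h (l / b); rewrite -subr_ge0.
rewrite (_ : _ + Q - _ = (Q * b - l ^+ 2) / b); last by field.
by rewrite pmulr_lge0 ?invr_gt0// subr_ge0.
Qed.

Lemma le_of_small_error (x y c : R) : 0 <= c ->
  (forall e, 0 < e -> x <= y + e * c) -> x <= y.
Proof.
move=> c0 h; apply/ler_addgt0Pr => e e0.
have c1 : 0 < 1 + c by lra.
apply: le_trans (h (e / (1 + c)) (divr_gt0 e0 c1)) _.
rewrite lerD2l mulrAC ler_pdivrMr//; have := mulr_ge0 (ltW e0) c0; lra.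
Qed.

(** Let [T v = tau] and [xi' = S v], so that [|xi'|^2 = <tau, v> <= Q + e]. For [eta] in
    the domain of [S], [<S eta, v> = <eta, xi'>] is at most [|eta|] times the square root
    of [Q + e], and [v] tends to [psi]. Hence [<S eta, psi>] is bounded by [|eta|] times
    the square root of [Q]. By Riesz it is represented by some [xi]
    of square norm at most [Q], and self-adjointness says that [S psi = xi]. *)
Lemma sqrt_op_dom S T (psi : pair) (Q : R) : is_sqrt_op S T -> 0 <= Q ->
  is_L2 (cpx psi) ->
  (forall e, 0 < e -> exists v tau : pair, [/\ T (cpx v) (cpx tau),
     rdot v tau <= Q + e,
     dot mu (fun x => v.1 x - psi.1 x) (fun x => v.1 x - psi.1 x) <= e ^+ 2 &
     dot mu (fun x => v.2 x - psi.2 x) (fun x => v.2 x - psi.2 x) <= e ^+ 2]) ->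
  exists2 xi, S (cpx psi) (cpx xi) & rdot xi xi <= Q.
Proof.
move=> [sa _ SST] Q0 Lpsi approx.
have sap p q := self_adjoint_cpx p q sa.
(* Pairs stand for points of the graph of [S]; the form [b] ignores the second entry,
   so completeness only concerns the first one. *)
pose V : lmodType R := (pair * pair)%type.
pose H : set V := fun u => is_L2 (cpx u.1) /\ is_L2 (cpx u.2).
pose b (u w : V) := rdot u.1 w.1.
pose D : set V := fun u => S (cpx u.1) (cpx u.2).
pose l (u : V) := rdot u.2 psi.
have DH : D `<=` H by move=> u /sap[].
have H_lin a u v : H u -> H v -> H (a *: u + v).
  by move=> [? ?] [? ?]; split; exact: is_L2_lin.
have bC u v : b u v = b v u by exact: rdotC.
have b_lin a u v w : H u -> H v -> H w -> b (a *: u + v) w = a * b u w + b v w.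
  by move=> [? _] [? _] [? _]; rewrite !(bC _ w); exact: (rdot_lin_r _ _ _ _).1.
have b_ge0 u : H u -> 0 <= b u u by move=> _; rewrite addr_ge0 ?dot_ge0.
have b_complete (u : nat -> V) : (forall k, H (u k)) ->
  (forall k, b (u k.+1 - u k) (u k.+1 - u k) <= 16^-1 ^+ k) ->
  exists2 v, H v & forall e : R, 0 < e ->
    exists N, forall k, (N <= k)%N -> b (v - u k) (v - u k) <= e.
  move=> Hu bu.
  have L1 k : L2 mu (u k).1.1 by have [/is_L2_cpx[]] := Hu k.
  have L2' k : L2 mu (u k).1.2 by have [/is_L2_cpx[]] := Hu k.
  have [g1 Lg1 g1u] : exists2 g, L2 mu g & forall k,
      dot mu (fun x => g x - (u k).1.1 x) (fun x => g x - (u k).1.1 x) <= 8 * 4^-1 ^+ k.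
    apply: (L2_complete L1) => k; apply: le_trans (bu k); rewrite /b /rdot.
    by rewrite lerDl; exact: dot_ge0.
  have [g2 Lg2 g2u] : exists2 g, L2 mu g & forall k,
      dot mu (fun x => g x - (u k).1.2 x) (fun x => g x - (u k).1.2 x) <= 8 * 4^-1 ^+ k.
    apply: (L2_complete L2') => k; apply: le_trans (bu k); rewrite /b /rdot.
    by rewrite lerDr; exact: dot_ge0.
  exists ((g1, g2), (g1, g2)); first by split; apply/is_L2_cpx.
  move=> e e0; exists (Num.truncn (16 / e)).+1 => k Nk.
  apply: (@le_trans _ _ (16 * 4^-1 ^+ k)).
    have := lerD (g1u k) (g2u k); rewrite /b /rdot => /le_trans; apply; lra.
  rewrite exprVn ler_pdivrMr ?exprn_gt0// mulrC -ler_pdivrMr//.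
  have := truncnS_gt (16 / e); move/ltW/le_trans; apply.
  apply: (@le_trans _ _ k%:R); first by rewrite ler_nat.
  by rewrite -natrX ler_nat ltnW// ltn_expl.
have D0 : D 0.
  apply/sap; split.
  - by apply/is_L2_cpx; split; exact: L20.
  - by apply/is_L2_cpx; split; exact: L20.
  move=> p' q' /sap[/is_L2_cpx[L1 L2'] /is_L2_cpx[M1 M2] _].
  have z f : L2 mu f -> dot mu f (0 : X -> R) = 0.
    move=> Lf; have := dotZr (0 : R) Lf Lf; rewrite mul0r => <-.
    by congr dot; apply/funext => x; rewrite mul0r.
  by rewrite /rdot /idot !z// !addr0 !subr0.
have D_lin a u v : D u -> D v -> D (a *: u + v).
  move=> /sap[Lu1 Lu2 hu] /sap[Lv1 Lv2 hv]; apply/sap.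
  split; [exact: is_L2_lin|exact: is_L2_lin|] => p' q' S'.
  have [Lp' Lq' _] := (sap _ _).1 S'.
  have [-> ->] := rdot_lin_r a Lu1 Lv1 Lq'; have [-> ->] := rdot_lin_r a Lu2 Lv2 Lp'.
  by have [-> ->] := hu _ _ S'; have [-> ->] := hv _ _ S'.
have l_lin a u v : D u -> D v -> l (a *: u + v) = a * l u + l v.
  move=> /DH[_ Lu] /DH[_ Lv]; rewrite /l !(rdotC _ psi).
  exact: (rdot_lin_r _ _ _ _).1.
have l_bounded u : D u -> l u ^+ 2 <= Q * b u u.
  move=> Du; have [L1 L2'] := DH _ Du; apply: quadratic_bound => //; first exact: b_ge0.
  move=> t; have [/is_L2_cpx[Lz1 Lz2]] := (L2', I); move=> _.
  have [Lpsi1 Lpsi2] := (is_L2_cpx psi).1 Lpsi.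
  pose Z f := Num.sqrt (dot mu f f).
  have Z0 f : 0 <= Z f by exact: sqrtr_ge0.
  have Z2 f : dot mu f f <= Z f ^+ 2 by rewrite sqr_sqrtr ?dot_ge0.
  apply: (@le_of_small_error _ _ (1 + 2 * `|t| * (Z u.2.1 + Z u.2.2))).
    by rewrite addr_ge0// !mulr_ge0// addr_ge0.
  move=> e e0; have [v [tau [Tvt vt d1 d2]]] := approx e e0.
  have [xi0 Svx Sxt] := (SST _ _).2 Tvt.
  move: Svx Sxt; rewrite -(cpxK xi0); set xi := (cRe xi0, cIm xi0) => Svx Sxt.
  have [Lv Lxi hv] := (sap _ _).1 Svx; have [_ Lt hx] := (sap _ _).1 Sxt.
  have [uxi _] := hv _ _ Du; have [xx _] := hx _ _ Svx.
  have [Lv1 Lv2] := (is_L2_cpx v).1 Lv; have [Lx1 Lx2] := (is_L2_cpx xi).1 Lxi.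
  have [Lu1 Lu2] := (is_L2_cpx _).1 L1.
  have cs1 := normr_dot_le Lz1 (L2B Lv1 Lpsi1) (Z0 u.2.1) (ltW e0) (Z2 _) d1.
  have cs2 := normr_dot_le Lz2 (L2B Lv2 Lpsi2) (Z0 u.2.2) (ltW e0) (Z2 _) d2.
  have lE : l u = rdot u.1 xi - dot mu u.2.1 (fun x => v.1 x - psi.1 x)
                              - dot mu u.2.2 (fun x => v.2 x - psi.2 x).
    by rewrite /l -uxi !dotBr// /rdot; ring.
  have sq : 2 * t * rdot u.1 xi <= t ^+ 2 * b u u + (Q + e).
    apply: (@le_trans _ _ (t ^+ 2 * b u u + rdot xi xi)); last by rewrite lerD2l xx.
    have := dot_ge0 mu (fun x => t * u.1.1 x - xi.1 x).
    have := dot_ge0 mu (fun x => t * u.1.2 x - xi.2 x).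
    rewrite (dotBB (L2Z t Lu1) Lx1) (dotBB (L2Z t Lu2) Lx2).
    rewrite (dotZl t Lu1 (L2Z t Lu1)) (dotZr t Lu1 Lu1) (dotZl t Lu1 Lx1).
    rewrite (dotZl t Lu2 (L2Z t Lu2)) (dotZr t Lu2 Lu2) (dotZl t Lu2 Lx2).
    by rewrite /b /rdot; lra.
  set a1 := dot mu u.2.1 _ in cs1 lE; set a2 := dot mu u.2.2 _ in cs2 lE.
  have err (a z : R) : `|a| <= z * e -> - (2 * t * a) <= 2 * `|t| * (z * e).
    move=> h; apply: le_trans (ler_norm _) _; rewrite normrN !normrM (ger0_norm (ler0n _ 2)).
    by rewrite ler_wpM2l// mulr_ge0.
  have e1 := err _ _ cs1; have e2 := err _ _ cs2; rewrite lE; move: sq e1 e2.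
  by move: (b u u) (rdot u.1 xi) (Z u.2.1) (Z u.2.2) => B r z1 z2; lra.
have [xi [Hxi bxi rep]] := riesz H_lin bC b_lin b_ge0 b_complete DH D0 D_lin l_lin l_bounded Q0.
exists xi.1 => //; apply/sap; split => //; first by case: Hxi.
move=> p' q' S'; have [Lp' Lq' _] := (sap _ _).1 S'.
have r1 := rep (p', q') S'; have r2 := rep (mul_i p', mul_i q') (self_adjoint_mul_i sa S').
split; first exact: r1.
have [<- _] := rdot_mul_i Lq' Lpsi; have [<- _] := rdot_mul_i Lp' Hxi.1.
exact: r2.
Qed.

End square_root.

Section oscillator_domain.
Context {R : realType} {n : nat} (j : 'I_n) (omega : R).
Hypothesis omega_gt0 : 0 < omega.
Local Notation X := 'M[R]_(n, 2).
Local Notation mu := (@leb R n).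
Implicit Types (psi g : X -> R[i]).

Lemma osc_energy_ge0 u (f : 'I_2 -> X -> R) : 0 <= osc_energy j omega u f.
Proof.
apply: addr_ge0; first by apply: addr_ge0; exact: dot_ge0.
by apply: mulr_ge0; [exact: sqr_ge0|apply: addr_ge0; exact: dot_ge0].
Qed.

Lemma potential_L2 psi : is_L2 psi ->
  (\int[mu]_x (omega ^+ 2 * sqlen (row j x) * ComplexField.Normc.normc (psi x) ^+ 2)%:E < +oo)%E ->
  (forall k, L2 mu (fun x => x j k * cRe psi x) /\ L2 mu (fun x => x j k * cIm psi x)) /\
  (\int[mu]_x (omega ^+ 2 * sqlen (row j x) * ComplexField.Normc.normc (psi x) ^+ 2)%:E =
   (omega ^+ 2 * (dot mu (fun x => x j ord0 * cRe psi x) (fun x => x j ord0 * cRe psi x) +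
                  dot mu (fun x => x j ord_max * cRe psi x) (fun x => x j ord_max * cRe psi x)) +
    omega ^+ 2 * (dot mu (fun x => x j ord0 * cIm psi x) (fun x => x j ord0 * cIm psi x) +
                  dot mu (fun x => x j ord_max * cIm psi x) (fun x => x j ord_max * cIm psi x)))%:E)%E.
Proof.
move=> /is_L2P[LR LI].
have mR := L2_measurable LR; have mI := L2_measurable LI.
have mx k := @measurable_coord R n j k.
have mxR k : measurable_fun setT (fun x : X => x j k * cRe psi x) by exact: measurable_funM.
have mxI k : measurable_fun setT (fun x : X => x j k * cIm psi x) by exact: measurable_funM.
have msq (f : X -> R) : measurable_fun setT f -> measurable_fun setT (fun x => (f x ^+ 2)%:E).
  by move=> mf; apply/measurable_EFinP; apply: measurable_funX.
have sq0 (f : X -> R) : forall x, setT x -> (0 <= (f x ^+ 2)%:E)%E.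
  by move=> x _; rewrite lee_fin sqr_ge0.
pose I (f : X -> R) : \bar R := (\int[mu]_x (f x ^+ 2)%:E)%E.
have I0 f : (0 <= I f)%E by apply: integral_ge0 => x _; exact: sq0.
pose xR k (x : X) := x j k * cRe psi x; pose xI k (x : X) := x j k * cIm psi x.
have mxR' k : measurable_fun setT (xR k) by exact: mxR.
have mxI' k : measurable_fun setT (xI k) by exact: mxI.
have PE : (\int[mu]_x (omega ^+ 2 * sqlen (row j x) * ComplexField.Normc.normc (psi x) ^+ 2)%:E =
  (omega ^+ 2)%:E * ((I (xR ord0) + I (xR ord_max)) +
     (I (xI ord0) + I (xI ord_max))))%E.
  rewrite /I -!ge0_integralD//; try (by move=> x _; rewrite adde_ge0// sq0);
    try exact: msq; try (by apply: emeasurable_funD; exact: msq); try exact: sq0.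
  rewrite -ge0_integralZl//; first last.
  - by rewrite lee_fin sqr_ge0.
  - by move=> x _; rewrite !adde_ge0// sq0.
  - by apply: emeasurable_funD; apply: emeasurable_funD; exact: msq.
  apply: eq_integral => x _; rewrite -!EFinD -EFinM; congr EFin.
  by rewrite sqlen_rowE sqr_modulus /xR /xI /cRe /cIm; ring.
have o2 : 0 < omega ^+ 2 by rewrite exprn_gt0.
rewrite PE => fin.
have fin' : ((I (xR ord0) + I (xR ord_max)) +
     (I (xI ord0) + I (xI ord_max)) < +oo)%E.
  rewrite ltey; apply/eqP => h; move: fin; rewrite h gt0_muley ?ltxx// lte_fin//.
have : [/\ (I (xR ord0) < +oo)%E, (I (xR ord_max) < +oo)%E,
   (I (xI ord0) < +oo)%E & (I (xI ord_max) < +oo)%E].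
  split; apply: le_lt_trans fin'.
  - by apply: (le_trans _ (leeDl _ (adde_ge0 (I0 _) (I0 _)))); exact: leeDl.
  - by apply: (le_trans _ (leeDl _ (adde_ge0 (I0 _) (I0 _)))); exact: leeDr.
  - by apply: (le_trans _ (leeDr _ (adde_ge0 (I0 _) (I0 _)))); exact: leeDl.
  - by apply: (le_trans _ (leeDr _ (adde_ge0 (I0 _) (I0 _)))); exact: leeDr.
move=> [f1 f2 f3 f4].
have LL k : L2 mu (fun x => x j k * cRe psi x) /\ L2 mu (fun x => x j k * cIm psi x).
  by case: (ord2P k) => ->.
split; first exact: LL.
rewrite /I -!EFin_dot; try exact: (LL _).1; try exact: (LL _).2.
by rewrite -!EFinD -EFinM mulrDr.
Qed.

(** A function of finite form energy is approximated by functions of the operator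
    domain with no more energy in the limit, as [sqrt_op_dom] requires. *)
Lemma oscillator_form_ge S psi : is_sqrt_op S (oscillator omega j) -> is_L2 psi ->
  (op_sqnorm S psi <= oscillator_form omega j psi)%E.
Proof.
move=> sS Lpsi; have [/eqP ->|] := boolP (oscillator_form omega j psi == +oo%E).
  by rewrite leey.
rewrite -ltey => fin; have [LR LI] := (is_L2P psi).1 Lpsi.
have p0 : (0 <= \int[mu]_x (omega ^+ 2 * sqlen (row j x) * ComplexField.Normc.normc (psi x) ^+ 2)%:E)%E.
  apply: integral_ge0 => x _; rewrite lee_fin; apply: mulr_ge0; last exact: sqr_ge0.
  apply: mulr_ge0; first exact: sqr_ge0.
  by apply: sumr_ge0 => k _; exact: sqr_ge0.
have G0 := gradient_form_ge0 j psi.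
have fg : (gradient_form j psi < +oo)%E.
  by apply: le_lt_trans fin; exact: leeDl.
have fp : (\int[mu]_x (omega ^+ 2 * sqlen (row j x) * ComplexField.Normc.normc (psi x) ^+ 2)%:E < +oo)%E.
  by apply: le_lt_trans fin; exact: leeDr.
have [Lx potE] := potential_L2 Lpsi fp.
have [g gP] := gradient_form_lty fg.
have Lg k := (is_L2P (g k)).1 (gP k).1.
have wg k := (weak_derivativeP j k psi (g k)).1 (gP k).2.
have domR : osc_dom j (cRe psi) (fun k => cRe (g k)).
  by split=> [|k|k|k]; [exact: LR|exact: (Lg k).1|exact: (wg k).1|exact: (Lx k).1].
have domI : osc_dom j (cIm psi) (fun k => cIm (g k)).
  by split=> [|k|k|k]; [exact: LI|exact: (Lg k).2|exact: (wg k).2|exact: (Lx k).2].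
pose Q := osc_energy j omega (cRe psi) (fun k => cRe (g k)) +
          osc_energy j omega (cIm psi) (fun k => cIm (g k)).
have formE : oscillator_form omega j psi = Q%:E.
  rewrite /oscillator_form gradient_formE potE.
  rewrite (dirichlet_formE (gP ord0).1 (gP ord0).2) (dirichlet_formE (gP ord_max).1 (gP ord_max).2).
  rewrite (sqnorm_dot (gP ord0).1) (sqnorm_dot (gP ord_max).1) -!EFinD.
  by congr EFin; rewrite /Q /osc_energy; ring.
have Q0 : 0 <= Q.
  by apply: addr_ge0; exact: osc_energy_ge0.
rewrite formE.
have [|e e0|xi Sxi xiQ] := @sqrt_op_dom R n S (oscillator omega j) (cRe psi, cIm psi) Q sS Q0.
- by rewrite cpxK.
- have e20 : 0 < e / 2 by rewrite divr_gt0.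
  have [v1 [t1 [Lv1 Lt1 h1 q1 d1]]] := osc_approximants omega e20 domR.
  have [v2 [t2 [Lv2 Lt2 h2 q2 d2]]] := osc_approximants omega e20 domI.
  have ee : (e / 2) ^+ 2 <= e ^+ 2.
    by rewrite ler_sqr ?nnegrE ?(ltW e0) ?(ltW e20)//; lra.
  exists (v1, v2), (t1, t2); split.
  + split; [by apply/is_L2_cpx|by apply/is_L2_cpx|] => phi tphi.
    rewrite !cintegral_real !cRe_cpx !cIm_cpx /=; congr Complex; [exact: h1|exact: h2].
  + rewrite /rdot /= (dotC _ v1) (dotC _ v2) /Q; move: q1 q2; lra.
  + exact: le_trans d1 ee.
  + exact: le_trans d2 ee.
rewrite cpxK in Sxi; apply: (@le_trans _ _ (sqnorm (cpx xi))).
  by apply: ereal_inf_lbound; exists (cpx xi).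
have [sa _ _] := sS; have [_ Lxi _] := (sa.2 _ _).1 Sxi.
by rewrite sqnorm_dot// cRe_cpx cIm_cpx lee_fin.
Qed.

End oscillator_domain.

(** * Permutation symmetry *)

Section permutations.
Context {R : realType} {n : nat}.
Local Notation X := 'M[R]_(n, 2).
Local Notation mu := (@leb R n).
Implicit Types (psi g : X -> R[i]) (f phi : X -> R) (s : 'S_n) (x v w : X).

Definition dens psi x : R := cRe psi x ^+ 2 + cIm psi x ^+ 2.

Lemma dens_ge0 psi x : 0 <= dens psi x.
Proof. by rewrite addr_ge0 ?sqr_ge0. Qed.

Lemma measurable_dens psi : is_L2 psi -> measurable_fun setT (dens psi).
Proof.
move=> /is_L2P[[mr _] [mi _]].
by apply: measurable_funD; apply: measurable_funX.
Qed.

Lemma measurable_row_perm s : measurable_fun setT (row_perm s : X -> X).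
Proof. by have [] := @preserves_row_perm R n s. Qed.

Lemma sym_integral psi s (F : X -> \bar R) : L2_sym psi ->
  measurable_fun setT F -> (forall x, 0 <= F x)%E ->
  (\int[mu]_x (F (row_perm s x) * (dens psi x)%:E) = \int[mu]_x (F x * (dens psi x)%:E))%E.
Proof.
move=> [Lpsi sym] mF F0; have md := measurable_dens Lpsi.
have mP := measurable_row_perm s.
rewrite -(@preserves_ge0_integral _ _ _ _ _ (@preserves_row_perm R n s)
  (fun x => F x * (dens psi x)%:E)%E); first last.
- by move=> x; rewrite mule_ge0// lee_fin dens_ge0.
- by apply: emeasurable_funM => //; exact/measurable_EFinP.
have mFP : measurable_fun setT (fun x : X => F (row_perm s x)) by exact: measurableT_comp.
have mdP : measurable_fun setT (fun x : X => dens psi (row_perm s x)) by exact: measurableT_comp.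
apply: ae_eq_integral => //.
- by apply: emeasurable_funM => //; exact/measurable_EFinP.
- by apply: emeasurable_funM => //; exact/measurable_EFinP.
by apply: filterS (sym s) => x sx _; rewrite /dens /cRe /cIm sx.
Qed.

Lemma row_permD s v w : row_perm s (v + w) = row_perm s v + row_perm s w.
Proof. by apply/matrixP => i k; rewrite !mxE. Qed.

Lemma row_permZ s (a : R) v : row_perm s (a *: v) = a *: row_perm s v.
Proof. by apply/matrixP => i k; rewrite !mxE. Qed.

Lemma row_perm_delta s j k : row_perm s (delta_mx j k : X) = delta_mx (s^-1%g j) k.
Proof. by apply/matrixP => i l; rewrite !mxE (canF_eq (permK s)). Qed.

Lemma derive_row_perm s f w :
  'D_w (fun x => f (row_perm s x)) = (fun x => 'D_(row_perm s w) f (row_perm s x)).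
Proof.
apply/funext => x; rewrite /derive.
set g1 := fun h => h^-1 *: _; set g2 := fun h => h^-1 *: _; suff -> : g1 = g2 by [].
by apply/funext => h; rewrite /g1 /g2/= row_permD row_permZ.
Qed.

Lemma derivable_row_perm s f w x : derivable f (row_perm s x) (row_perm s w) ->
  derivable (fun x => f (row_perm s x)) x w.
Proof.
rewrite /derivable.
set g1 := fun h => h^-1 *: _; set g2 := fun h => h^-1 *: _; suff -> : g1 = g2 by [].
by apply/funext => h; rewrite /g1 /g2/= row_permD row_permZ.
Qed.

Lemma pder_row_perm s l f : pder l (fun x => f (row_perm s x)) =
  (fun x => pder [seq (s^-1%g jk.1, jk.2) | jk <- l] f (row_perm s x)).
Proof.
elim: l => [//|[j k] l IHl] /=.
by rewrite IHl derive_row_perm row_perm_delta.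
Qed.

Lemma norm_row_perm_le s x : `|row_perm s x| <= `|x|.
Proof. by apply/mx_norm_leP => // i k; rewrite mxE mx_entry_le_norm. Qed.

Lemma continuous_row_perm s : continuous (row_perm s : X -> X).
Proof.
move=> x A [B Bx BA]; exists (fun i k => B (s^-1%g i) k).
  by move=> i k; have := Bx (s^-1%g i) k; rewrite mxE permKV.
by move=> y yB; apply: BA => i k; have := yB (s i) k; rewrite permK mxE.
Qed.

Lemma test_row_perm s phi : test_function phi ->
  test_function (fun x => phi (row_perm s x)).
Proof.
move=> [sp [M hM]]; split.
  move=> l; rewrite pder_row_perm; split.
    move=> x; apply: (@continuous_comp _ _ _ (row_perm s : X -> X) (pder _ phi)).
      exact: continuous_row_perm.
    exact: (sp _).1.
  by move=> x j k; apply: derivable_row_perm; rewrite row_perm_delta; exact: (sp _).2.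
exists M => x Mx; apply: hM; apply: lt_le_trans Mx _.
apply: le_trans (norm_row_perm_le s^-1%g _).
by rewrite -row_permM mulVg row_perm1.
Qed.

(** Permuting the particles maps the derivative in [x_j] to the one in another
    particle, while a symmetric function is unchanged. *)
Lemma sym_weakd s j k (u g : X -> R) : L2 mu u -> L2 mu g ->
  {ae mu, forall x, u (row_perm s x) = u x} -> weakd (s^-1%g j) k u g ->
  weakd j k u (fun x => g (row_perm s x)).
Proof.
move=> Lu Lg us ug phi tphi; have mP := measurable_row_perm s.
have pP := @preserves_row_perm R n s.
have mu' := L2_measurable Lu; have mg := L2_measurable Lg.
pose phi' x := phi (row_perm s^-1%g x).
have tphi' : test_function phi' := test_row_perm s^-1%g tphi.
have phiE x : phi x = phi' (row_perm s x).
  by rewrite /phi' -row_permM mulVg row_perm1.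
have -> : phi = (fun x => phi' (row_perm s x)) by apply/funext.
rewrite pder_row_perm /=.
have md := test_measurable (test_pder [:: (s^-1%g j, k)] tphi').
have -> : dot mu u (fun x => pder [:: (s^-1%g j, k)] phi' (row_perm s x)) =
    dot mu (fun x => u (row_perm s x)) (fun x => pder [:: (s^-1%g j, k)] phi' (row_perm s x)).
  apply: ae_eq_dot => //.
  - exact: measurableT_comp.
  - exact: measurableT_comp md mP.
  - exact: measurableT_comp md mP.
  - by apply: filterS us => x ->.
  - exact: aeW.
have mphi' := test_measurable tphi'.
rewrite /dot (preserves_Rintegral pP (g := fun x => u x * pder [:: (s^-1%g j, k)] phi' x)); last first.
  exact: measurable_funM.
rewrite (preserves_Rintegral pP (g := fun x => g x * phi' x)); last exact: measurable_funM.
exact: ug.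
Qed.

Lemma L2_row_perm s (u : X -> R) : L2 mu u -> L2 mu (fun x => u (row_perm s x)).
Proof.
move=> [mu' foo]; have mP := measurable_row_perm s.
split; first exact: measurableT_comp.
rewrite (preserves_ge0_integral (@preserves_row_perm R n s) (g := fun x => (u x ^+ 2)%:E))//.
  by apply/measurable_EFinP; apply: measurable_funX.
by move=> x; rewrite lee_fin sqr_ge0.
Qed.

Lemma sym_dirichlet_le s j k psi : L2_sym psi ->
  (dirichlet_form j k psi <= dirichlet_form (s^-1%g j) k psi)%E.
Proof.
move=> [Lpsi sym]; apply: le_ereal_inf_tmp => _ [g [Lg wg] <-].
have [LR LI] := (is_L2P psi).1 Lpsi; have [LgR LgI] := (is_L2P g).1 Lg.
have [wR wI] := (weak_derivativeP _ _ _ _).1 wg.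
have sR : {ae mu, forall x, cRe psi (row_perm s x) = cRe psi x}.
  by apply: filterS (sym s) => x; rewrite /cRe => ->.
have sI : {ae mu, forall x, cIm psi (row_perm s x) = cIm psi x}.
  by apply: filterS (sym s) => x; rewrite /cIm => ->.
have Lgs : is_L2 (fun x => g (row_perm s x)).
  by apply/is_L2P; split; [exact: (L2_row_perm s LgR)|exact: (L2_row_perm s LgI)].
rewrite (@dirichlet_formE _ _ j k psi (fun x => g (row_perm s x)))//.
  rewrite !sqnormE (preserves_ge0_integral (@preserves_row_perm R n s) (g := fun x => (dens g x)%:E))//.
    by apply/measurable_EFinP; exact: measurable_dens.
  by move=> x; rewrite lee_fin dens_ge0.
apply/weak_derivativeP; split; [exact: sym_weakd wR|exact: sym_weakd wI].
Qed.

Lemma sym_dirichlet j j' k psi : L2_sym psi ->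
  dirichlet_form j k psi = dirichlet_form j' k psi.
Proof.
move=> sym; apply/eqP; rewrite eq_le; apply/andP; split.
  by have := sym_dirichlet_le (tperm j j') j k sym; rewrite tpermV tpermL.
by have := sym_dirichlet_le (tperm j j') j' k sym; rewrite tpermV tpermR.
Qed.

Lemma potentialE (omega : R) j psi :
  (\int[mu]_x (omega ^+ 2 * sqlen (row j x) * ComplexField.Normc.normc (psi x) ^+ 2)%:E =
   \int[mu]_x ((omega ^+ 2 * sqlen (row j x))%:E * (dens psi x)%:E))%E.
Proof. by apply: eq_integral => x _; rewrite sqr_modulus -EFinM. Qed.

Lemma measurable_potential (omega : R) j :
  measurable_fun setT (fun x : X => (omega ^+ 2 * sqlen (row j x))%:E).
Proof.
apply/measurable_EFinP; apply: measurable_funM; first exact: measurable_cst.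
rewrite (_ : (fun _ => _) = (fun x : X => x j ord0 ^+ 2 + x j ord_max ^+ 2)); last first.
  by apply/funext => x; rewrite sqlen_rowE.
by apply: measurable_funD; apply: measurable_funX; exact: measurable_coord.
Qed.

Lemma sqlen_ge0 (v : 'rV[R]_2) : 0 <= sqlen v.
Proof. by apply: sumr_ge0 => k _; exact: sqr_ge0. Qed.

Lemma sym_oscillator (omega : R) j j' psi : L2_sym psi ->
  oscillator_form omega j psi = oscillator_form omega j' psi.
Proof.
move=> sym; have eP : (\int[mu]_x ((omega ^+ 2 * sqlen (row j x))%:E * (dens psi x)%:E) =
    \int[mu]_x ((omega ^+ 2 * sqlen (row j' x))%:E * (dens psi x)%:E))%E.
  have F0 (x : X) : (0 <= (omega ^+ 2 * sqlen (row j' x))%:E)%E.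
    by rewrite lee_fin mulr_ge0 ?sqr_ge0 ?sqlen_ge0.
  rewrite -(sym_integral (tperm j j') sym (measurable_potential omega j') F0).
  apply: eq_integral => x _.
  have -> // : row j' (row_perm (tperm j j') x) = row j x.
  by apply/matrixP => i k; rewrite !mxE tpermR.
have eG : gradient_form j psi = gradient_form j' psi.
  by apply: eq_bigr => k _; exact: sym_dirichlet.
by rewrite /oscillator_form !potentialE eP eG.
Qed.

End permutations.

(** * Convolutions and boxes in the plane *)

(* Simplification would otherwise expose the product measure behind [leb 1]. *)
Local Arguments leb {R} n : simpl never.

Section plane.
Context {R : realType}.
Local Notation P2 := 'M[R]_(1, 2).
Local Notation lam := (@leb R 1).
Implicit Types (f g h u rho : P2 -> R) (x y z : P2).

Lemma measurable_sub : measurable_fun setT (fun p : P2 * P2 => p.1 - p.2).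
Proof.
apply: measurable_mx => i k; under eq_fun do rewrite !mxE.
apply: measurable_funB.
  exact: (measurableT_comp (measurable_mx_coord i k) measurable_fst).
exact: (measurableT_comp (measurable_mx_coord i k) measurable_snd).
Qed.

Lemma measurable_sub_l y : measurable_fun setT (fun x : P2 => x - y).
Proof. by have [] := @preserves_translation R 1 (- y). Qed.

Lemma measurable_sub_r x : measurable_fun setT (fun y : P2 => x - y).
Proof.
have mN : measurable_fun setT (-%R : P2 -> P2) by have [] := @preserves_opp R 1.
have [mD _] := @preserves_translation R 1 x.
rewrite (_ : (fun _ => _) = (fun y : P2 => (fun z : P2 => z + x) (- y))); last first.
  by apply/funext => y; rewrite addrC.
exact: measurableT_comp mD mN.
Qed.

Lemma integral_sub_l g y : measurable_fun setT g -> (forall x, 0 <= g x) ->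
  (\int[lam]_x (g (x - y))%:E = \int[lam]_x (g x)%:E)%E.
Proof.
move=> mg g0; apply: (preserves_ge0_integral (@preserves_translation R 1 (- y)) (g := EFin \o g)).
  exact/measurable_EFinP.
by move=> x; rewrite lee_fin.
Qed.

Lemma integral_sub_r g x : measurable_fun setT g -> (forall x, 0 <= g x) ->
  (\int[lam]_y (g (x - y))%:E = \int[lam]_y (g y)%:E)%E.
Proof.
move=> mg g0; have mgN : measurable_fun setT (fun y : P2 => g (- y)).
  by apply: measurableT_comp => //; have [] := @preserves_opp R 1.
rewrite -(preserves_ge0_integral (@preserves_opp R 1) (g := EFin \o g)); first last.
- by move=> y; rewrite lee_fin.
- exact/measurable_EFinP.
rewrite -(@integral_sub_l (fun y => g (- y)) x mgN)//.
by apply: eq_integral => y _; rewrite opprB.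
Qed.

Lemma convolution_l h g : measurable_fun setT h -> measurable_fun setT g ->
  (forall x, 0 <= h x) -> (forall x, 0 <= g x) ->
  (\int[lam]_x \int[lam]_y (h x * g (x - y))%:E =
   \int[lam]_x (h x)%:E * \int[lam]_x (g x)%:E)%E.
Proof.
move=> mh mg h0 g0.
have I0 : (0 <= \int[lam]_x (g x)%:E)%E by apply: integral_ge0 => x _; rewrite lee_fin.
rewrite muleC -ge0_integralZl//; first last.
- by move=> x _; rewrite lee_fin.
- exact/measurable_EFinP.
apply: eq_integral => x _; rewrite -(integral_sub_r x mg g0) muleC.
under eq_integral do rewrite EFinM.
rewrite ge0_integralZl//.
- by apply/measurable_EFinP; exact: measurableT_comp mg (measurable_sub_r x).
- by move=> y _; rewrite lee_fin.
- by rewrite lee_fin.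
Qed.

Lemma convolution_r h g : measurable_fun setT h -> measurable_fun setT g ->
  (forall x, 0 <= h x) -> (forall x, 0 <= g x) ->
  (\int[lam]_x \int[lam]_y (h y * g (x - y))%:E =
   \int[lam]_x (h x)%:E * \int[lam]_x (g x)%:E)%E.
Proof.
move=> mh mg h0 g0.
have I0 : (0 <= \int[lam]_x (g x)%:E)%E by apply: integral_ge0 => x _; rewrite lee_fin.
rewrite (@fubini_tonelli _ _ _ _ _ lam lam (fun p => (h p.2 * g (p.1 - p.2))%:E)); first last.
- by move=> p; rewrite lee_fin mulr_ge0.
- apply/measurable_EFinP; apply: measurable_funM.
    exact: measurableT_comp mh measurable_snd.
  exact: measurableT_comp mg measurable_sub.
rewrite muleC -ge0_integralZl//; first last.
- by move=> x _; rewrite lee_fin.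
- exact/measurable_EFinP.
apply: eq_integral => y _; rewrite /= -(integral_sub_l y mg g0) muleC.
under eq_integral do rewrite EFinM.
rewrite ge0_integralZl//.
- by apply/measurable_EFinP; exact: measurableT_comp mg (measurable_sub_l y).
- by move=> x _; rewrite lee_fin.
- by rewrite lee_fin.
Qed.

Lemma measurable_conv (F : P2 * P2 -> R) : measurable_fun setT F -> (forall p, 0 <= F p) ->
  measurable_fun setT (fun x => \int[lam]_y (F (x, y))%:E)%E.
Proof.
move=> mF F0; apply: (@measurable_fun_fubini_tonelli_F _ _ _ _ _ lam (EFin \o F)).
  exact/measurable_EFinP.
by move=> p; rewrite lee_fin.
Qed.

(** Bound [f x * h y] by [a * f x ^ 2 + b * h y ^ 2] and integrate the free variable
    of each term against [g]. *)
Lemma young_convolution (a b : R) f h g : 0 <= a -> 0 <= b ->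
  measurable_fun setT f -> measurable_fun setT h -> measurable_fun setT g ->
  (forall x, 0 <= f x) -> (forall x, 0 <= h x) -> (forall x, 0 <= g x) ->
  1 <= 4 * a * b ->
  (\int[lam]_x \int[lam]_y (f x * h y * g (x - y))%:E <=
   (a%:E * \int[lam]_x (f x ^+ 2)%:E + b%:E * \int[lam]_x (h x ^+ 2)%:E) *
   \int[lam]_x (g x)%:E)%E.
Proof.
move=> a0 b0 mf mh mg f0 h0 g0 ab.
have mf2 : measurable_fun setT (fun x => a * f x ^+ 2).
  by apply: measurable_funM; [exact: measurable_cst|exact: measurable_funX].
have mh2 : measurable_fun setT (fun x => b * h x ^+ 2).
  by apply: measurable_funM; [exact: measurable_cst|exact: measurable_funX].
have mgs : measurable_fun setT (fun p : P2 * P2 => g (p.1 - p.2)).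
  exact: measurableT_comp mg measurable_sub.
pose F1 (p : P2 * P2) := a * f p.1 ^+ 2 * g (p.1 - p.2).
pose F2 (p : P2 * P2) := b * h p.2 ^+ 2 * g (p.1 - p.2).
have mF1 : measurable_fun setT F1.
  by apply: measurable_funM => //; exact: measurableT_comp mf2 measurable_fst.
have mF2 : measurable_fun setT F2.
  by apply: measurable_funM => //; exact: measurableT_comp mh2 measurable_snd.
have F10 p : 0 <= F1 p by rewrite !mulr_ge0// sqr_ge0.
have F20 p : 0 <= F2 p by rewrite !mulr_ge0// sqr_ge0.
have mF : measurable_fun setT (fun p : P2 * P2 => f p.1 * h p.2 * g (p.1 - p.2)).
  apply: measurable_funM => //; apply: measurable_funM.
    exact: measurableT_comp mf measurable_fst.
  exact: measurableT_comp mh measurable_snd.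
have F0 (p : P2 * P2) : 0 <= f p.1 * h p.2 * g (p.1 - p.2) by rewrite !mulr_ge0.
have sec (F : P2 * P2 -> R) x : measurable_fun setT F ->
    measurable_fun setT (fun y => (F (x, y))%:E).
  by move=> mF'; apply/measurable_EFinP; exact: measurableT_comp mF' (pair1_measurable x).
apply: (@le_trans _ _ (\int[lam]_x (\int[lam]_y (F1 (x, y))%:E + \int[lam]_y (F2 (x, y))%:E))%E).
  apply: ge0_le_integral => //.
  - by move=> x _; apply: integral_ge0 => y _; rewrite lee_fin; exact: (F0 (x, y)).
  - exact: (measurable_conv mF F0).
  - by apply: emeasurable_funD; exact: measurable_conv.
  move=> x _; rewrite -ge0_integralD//; try exact: sec; try by move=> y _; rewrite lee_fin.
  apply: ge0_le_integral => //.
  - by move=> y _; rewrite lee_fin; exact: (F0 (x, y)).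
  - exact: (sec _ x mF).
  - by apply: emeasurable_funD; exact: sec.
  move=> y _; rewrite -EFinD lee_fin /F1 /F2 /= -mulrDl ler_wpM2r//.
  have [a00|an0] := eqVneq a 0; first by move: ab; rewrite a00 mulr0 mul0r ler10.
  have ap : 0 < a by rewrite lt_def an0.
  rewrite -subr_ge0.
  have -> : a * f x ^+ 2 + b * h y ^+ 2 - f x * h y =
    ((2 * a * f x - h y) ^+ 2 + (4 * a * b - 1) * h y ^+ 2) / (4 * a) by field.
  by rewrite divr_ge0 ?mulr_ge0 ?(ltW ap)// addr_ge0 ?sqr_ge0// mulr_ge0 ?sqr_ge0// subr_ge0.
rewrite ge0_integralD//; first last.
- exact: measurable_conv.
- by move=> x _; apply: integral_ge0 => y _; rewrite lee_fin.
- exact: measurable_conv.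
- by move=> x _; apply: integral_ge0 => y _; rewrite lee_fin.
rewrite /F1 /F2 /= (convolution_l mf2 mg)//; last by move=> x; rewrite mulr_ge0 ?sqr_ge0.
rewrite (convolution_r mh2 mg)//; last by move=> x; rewrite mulr_ge0 ?sqr_ge0.
rewrite -ge0_muleDl; try by apply: integral_ge0 => x _; rewrite lee_fin mulr_ge0 ?sqr_ge0.
have Z c (k : P2 -> R) : 0 <= c -> measurable_fun setT k ->
    (\int[lam]_x (c * k x ^+ 2)%:E = c%:E * \int[lam]_x (k x ^+ 2)%:E)%E.
  move=> c0 mk; under eq_integral do rewrite EFinM.
  rewrite ge0_integralZl//.
  - by apply/measurable_EFinP; exact: measurable_funX.
  - by move=> x _; rewrite lee_fin sqr_ge0.
by rewrite !Z.
Qed.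

Definition half_box (l : R) : set P2 := obox (const_mx (- (l / 2))) (const_mx (l / 2)).

(** The uniform probability density on a square of side [l]. *)
Definition box (l : R) z : R := l ^- 2 * \1_(half_box l) z.

Section box_theory.
Variable l : R.
Hypothesis l0 : 0 < l.

Lemma measurable_box : measurable_fun setT (box l).
Proof.
apply: measurable_funM; first exact: measurable_cst.
by apply: measurable_indic; exact: measurable_obox.
Qed.

Lemma box_ge0 z : 0 <= box l z.
Proof. by rewrite mulr_ge0// invr_ge0 sqr_ge0. Qed.

Lemma sqr_box z : box l z ^+ 2 = l ^- 2 * box l z.
Proof. by rewrite /box indicE; case: (_ \in _); rewrite ?mulr0 ?mulr1 ?expr0n// expr2. Qed.

Lemma box_neq0 z : box l z != 0 -> forall k, `|z ord0 k| < l / 2.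
Proof.
rewrite /box indicE; have [zin _ k|_] := boolP (z \in half_box l); last by rewrite mulr0 eqxx.
by have := set_mem zin ord0 k; rewrite !mxE ltr_norml.
Qed.

Lemma integral_box : (\int[lam]_z (box l z)%:E = 1)%E.
Proof.
under eq_integral do rewrite EFinM.
rewrite ge0_integralZl//; first last.
- by rewrite lee_fin invr_ge0 sqr_ge0.
- apply/measurable_EFinP; apply: measurable_indic; exact: measurable_obox.
rewrite integral_indic//; last exact: measurable_obox.
rewrite setIT [X in (_ * X)%E](leb_obox (n := 1)) !big_ord_recl !big_ord0 !mxE !lebesgue_measure_itv/= !lte_fin.
have -> : - (l / 2) < l / 2 by have := l0; lra.
rewrite !mule1 -!EFinD -!EFinM; congr EFin.
by field; rewrite gt_eqF.
Qed.

Lemma L2_box x : L2 lam (fun z => box l (x - z)).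
Proof.
have mb := measurableT_comp measurable_box (measurable_sub_r x).
split => //; under eq_integral do rewrite sqr_box.
rewrite (@integral_sub_r (fun z => l ^- 2 * box l z)).
- under eq_integral do rewrite EFinM.
  rewrite ge0_integralZl//; first by rewrite integral_box mule1 ltry.
  + by apply/measurable_EFinP; exact: measurable_box.
  + by move=> z _; rewrite lee_fin box_ge0.
  + by rewrite lee_fin invr_ge0 sqr_ge0.
- by apply: measurable_funM; [exact: measurable_cst|exact: measurable_box].
- by move=> z; rewrite mulr_ge0 ?box_ge0// invr_ge0 sqr_ge0.
Qed.

Lemma dot_box x : dot lam (fun z => box l (x - z)) (fun z => box l (x - z)) = l ^- 2.
Proof.
apply: EFin_inj; rewrite EFin_dot; last exact: L2_box.
under eq_integral do rewrite sqr_box EFinM.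
rewrite ge0_integralZl//.
- by rewrite (integral_sub_r x measurable_box box_ge0) integral_box mule1.
- by apply/measurable_EFinP; exact: measurableT_comp measurable_box (measurable_sub_r x).
- by move=> z _; rewrite lee_fin box_ge0.
- by rewrite lee_fin invr_ge0 sqr_ge0.
Qed.

End box_theory.

(** Scaling boxes in both directions; boxes determine the measure. *)
Lemma integral_scale (t : R) g : 0 < t -> measurable_fun setT g -> (forall x, 0 <= g x) ->
  (\int[lam]_x (t ^+ 2 * g (t *: x))%:E = \int[lam]_x (g x)%:E)%E.
Proof.
move=> t0 mg g0.
have ms : measurable_fun setT (fun x : P2 => t *: x).
  apply: measurable_mx => i k; under eq_fun do rewrite mxE.
  by apply: measurable_funM; [exact: measurable_cst|exact: measurable_mx_coord].
pose sm : {mfun P2 >-> P2} := HB.pack (fun x : P2 => t *: x)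
  (isMeasurableFun.Build _ _ _ _ _ ms).
have t20 : 0 <= t ^+ 2 by exact: sqr_ge0.
pose pf : {measure set P2 -> \bar R} := pushforward lam sm.
pose nu : {measure set P2 -> \bar R} := mscale (NngNum t20) (pf ms).
have boxE a b : nu (obox a b) = lam (obox a b).
  change (((t ^+ 2)%:E * lam (sm @^-1` obox a b))%E = lam (obox a b)).
  have -> : sm @^-1` obox a b = obox (t^-1 *: a) (t^-1 *: b).
    apply/seteqP; split=> x h i k; have := h i k; rewrite /= !mxE.
      by rewrite ltr_pdivlMl// ltr_pdivrMl// mulrC.
    by rewrite ltr_pdivlMl// ltr_pdivrMl// mulrC.
  rewrite [X in (_ * X)%E](leb_obox (n := 1)) [RHS](leb_obox (n := 1)).
  rewrite !big_ord_recl !big_ord0 !mule1 !lebesgue_measure_itv/= !mxE.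
  rewrite !lte_fin !ltr_pM2l ?invr_gt0//.
  case: ifP => _; last by rewrite !mul0e mule0.
  case: ifP => _; last by rewrite !mule0.
  rewrite -!EFinD -!EFinM; congr EFin.
  by field; rewrite gt_eqF.
have -> : (\int[lam]_x (g x)%:E = \int[nu]_x (g x)%:E)%E.
  apply: eq_measure_integral => A mA _.
  apply: (obox_measure_unique (mu := lam) (nu := nu)) => // a b; exact: leb_obox_lty.
have mEg : measurable_fun setT (EFin \o g) by exact/measurable_EFinP.
rewrite (ge0_integral_mscale _ measurableT _ mEg); last by move=> x _; rewrite lee_fin.
have Eg0 : {in setT, forall y, (0 <= (EFin \o g) y)%E} by move=> x _; rewrite lee_fin.
rewrite (ge0_integral_pushforward ms lam measurableT mEg Eg0) preimage_setT.
rewrite -ge0_integralZl//.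
- by apply/measurable_EFinP; exact: measurableT_comp mg ms.
- by move=> x _; rewrite lee_fin.
Qed.

End plane.

(** * Gagliardo-Nirenberg with the other particles frozen *)

Section gagliardo_nirenberg_density.
Context {R : realType}.
Local Notation P2 := 'M[R]_(1, 2).
Local Notation lam := (@leb R 1).
Implicit Types (phi : P2 -> R[i]) (u : P2 -> R).

(** The fourth power of the inequality. *)
Lemma gagliardo_nirenberg_dens (C : R) phi : 0 <= C -> gagliardo_nirenberg C ->
  is_L2 phi -> (gradient_form ord0 phi < +oo)%E ->
  (\int[lam]_x (dens phi x ^+ 2)%:E <= (C ^+ 4)%:E * (sqnorm phi * gradient_form ord0 phi))%E.
Proof.
move=> C0 gn Lphi gfin; have := gn _ Lphi gfin.
have G0 : (0 <= gradient_form ord0 phi)%E.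
  exact: gradient_form_ge0.
have L20' : (0 <= Lp_norm 2 phi)%E by exact: Lnorm_ge0.
have L40 : (0 <= Lp_norm 4 phi)%E by exact: Lnorm_ge0.
move=> h; have := @gt0_ler_poweR R 4 (ler0n _ 4) _ _ _ _ h.
rewrite !in_itv/= !leey !andbT => /(_ L40).
have R0 : (0 <= C%:E * Lp_norm 2 phi `^ 2^-1 * (gradient_form ord0 phi `^ 2^-1) `^ 2^-1)%E.
  by rewrite !mule_ge0 ?poweR_ge0.
move=> /(_ R0).
rewrite {1}/Lp_norm powR_Lnorm ?pnatr_eq0// => h4.
have -> : (\int[lam]_x (dens phi x ^+ 2)%:E =
    \int[lam]_x (`|(ComplexField.Normc.normc (phi x))%:E| `^ 4))%E.
  apply: eq_integral => x _; rewrite abse_EFin poweR_EFin; congr EFin.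
  rewrite (ger0_norm (modulus_ge0 _)) powR_mulrn ?modulus_ge0//.
  by rewrite (exprM _ 2 2) sqr_modulus.
apply: le_trans h4 _.
rewrite !poweRM ?mule_ge0 ?poweR_ge0// -!poweRrM poweR_EFin powR_mulrn//.
have -> : 2^-1 * 4 = 2 :> R by field.
have -> : 2^-1 * 2 = 1 :> R by field.
by rewrite poweRe1// -poweR2_sqr// -muleA.
Qed.

(** Young's inequality with the weight [S = |phi|^2] on [u ^ 2] and its inverse on the
    squared density: Gagliardo-Nirenberg bounds the integral of the latter by
    [C ^ 4 * S * |grad phi|^2], in which [S] cancels. *)
Lemma one_body (C l : R) phi u : 0 <= C -> gagliardo_nirenberg C -> 0 < l ->
  is_L2 phi -> (gradient_form ord0 phi < +oo)%E ->
  measurable_fun setT u -> (forall x, 0 <= u x) -> 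
  (\int[lam]_x \int[lam]_y (dens phi x * u y * box l (x - y))%:E <=
   2^-1%:E * (\int[lam]_y (u y ^+ 2)%:E * sqnorm phi) +
   (2^-1 * C ^+ 4)%:E * gradient_form ord0 phi)%E.
Proof.
move=> C0 gn l0 Lphi gfin mu' u0.
have md := measurable_dens Lphi; have d0 := dens_ge0 phi.
have mb := measurable_box l; have b0 := box_ge0 l.
have G0 : (0 <= gradient_form ord0 phi)%E.
  exact: gradient_form_ge0.
have U0 : (0 <= \int[lam]_y (u y ^+ 2)%:E)%E.
  by apply: integral_ge0 => y _; rewrite lee_fin sqr_ge0.
have SE := sqnorm_dot Lphi; set S := (X in X%:E) in SE.
have S0 : 0 <= S by rewrite addr_ge0 ?dot_ge0.
have [S00|Sn0] := eqVneq S 0.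
  have d00 : {ae lam, forall x, dens phi x = 0}.
    have : (\int[lam]_x `|(dens phi x)%:E| = 0)%E.
      have sE : sqnorm phi = 0%E by rewrite SE S00.
      rewrite -sE sqnormE.
      by apply: eq_integral => x _; rewrite gee0_abs// lee_fin dens_ge0.
    have mEd : measurable_fun setT (EFin \o dens phi) by exact/measurable_EFinP.
    move=> I0; have h := (ae_eq_integral_abs lam measurableT mEd).1 I0.
    by apply: filterS h => x /(_ I) -[].
  have mF : measurable_fun setT (fun p : P2 * P2 => dens phi p.1 * u p.2 * box l (p.1 - p.2)).
    apply: measurable_funM; last exact: measurableT_comp mb measurable_sub.
    apply: measurable_funM; first exact: measurableT_comp md measurable_fst.
    exact: measurableT_comp mu' measurable_snd.
  have F0 (p : P2 * P2) : 0 <= dens phi p.1 * u p.2 * box l (p.1 - p.2).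
    by apply: mulr_ge0 (b0 _); exact: mulr_ge0 (d0 _) (u0 _).
  have -> : (\int[lam]_x \int[lam]_y (dens phi x * u y * box l (x - y))%:E = 0)%E.
    rewrite -[RHS](@integral0 _ _ _ lam setT); apply: ae_eq_integral => //.
      exact: (measurable_conv mF F0).
    apply: filterS d00 => x dx _; rewrite -[RHS](@integral0 _ _ _ lam setT).
    by apply: eq_integral => y _; rewrite dx !mul0r.
  have h0 : (0 <= 2^-1%:E :> \bar R)%E by rewrite lee_fin.
  have c0 : (0 <= (2^-1 * C ^+ 4)%:E)%E by rewrite lee_fin mulr_ge0// exprn_ge0.
  exact: adde_ge0 (mule_ge0 h0 (mule_ge0 U0 (sqnorm_ge0 _))) (mule_ge0 c0 G0).
have Sp : 0 < S by rewrite lt_def Sn0.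
have a0 : 0 <= (2 * S)^-1 by rewrite invr_ge0 mulr_ge0.
have b0' : 0 <= S / 2 by rewrite divr_ge0.
have ab : 1 <= 4 * (2 * S)^-1 * (S / 2).
  rewrite (_ : _ * _ = 1)//; by field.
have := young_convolution a0 b0' md mu' mb d0 u0 b0 ab.
rewrite (integral_box l0) mule1 => /le_trans; apply.
rewrite addeC; apply: leeD.
  by rewrite SE muleCA -EFinM muleC mulrC.
apply: le_trans (lee_wpmul2l _ (gagliardo_nirenberg_dens C0 gn Lphi gfin)) _.
  by rewrite lee_fin.
rewrite SE !muleA -!EFinM (_ : (2 * S)^-1 * C ^+ 4 * S = 2^-1 * C ^+ 4)//.
by field.
Qed.

End gagliardo_nirenberg_density.

Lemma ge0_integral_comb d (T : measurableType d) (R : realType)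
    (mu : {measure set T -> \bar R}) (a b : \bar R) (F G : T -> \bar R) :
  (0 <= a)%E -> (0 <= b)%E ->
  measurable_fun setT F -> (forall x, 0 <= F x)%E ->
  measurable_fun setT G -> (forall x, 0 <= G x)%E ->
  (\int[mu]_x (a * F x + b * G x) = a * \int[mu]_x F x + b * \int[mu]_x G x)%E.
Proof.
move=> a0 b0 mF F0 mG G0; rewrite ge0_integralD//; first last.
- by apply: emeasurable_funM => //; exact: measurable_cst.
- by move=> y _; exact: mule_ge0.
- by apply: emeasurable_funM => //; exact: measurable_cst.
- by move=> y _; exact: mule_ge0.
by rewrite !ge0_integralZl.
Qed.

Section one_body_configurations.
Context {R : realType} {n : nat}.
Local Notation P2 := 'M[R]_(1, 2).
Local Notation X := 'M[R]_(n.+1, 2).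
Local Notation lam := (@leb R 1).
Local Notation mu := (@leb R n.+1).
Implicit Types (psi : X -> R[i]).

Lemma row0_cons_particle (x : P2) (y : 'M[R]_(n, 2)) : row ord0 (cons_particle x y) = x.
Proof.
apply/matrixP => i k; rewrite !mxE; case: splitP => [j|j] /= jE; last by [].
by rewrite !ord1.
Qed.

(** For almost every position of the other particles, the slice in the first particle
    has for weak derivatives the slices of those of [psi], so that [one_body] applies
    with a density [w x] that does not depend on the first particle. *)
Lemma one_body_config (C l : R) psi (w : X -> P2 -> R) :
  0 <= C -> gagliardo_nirenberg C -> 0 < l -> is_L2 psi ->
  (gradient_form ord0 psi < +oo)%E ->
  measurable_fun setT (fun p : X * P2 => w p.1 p.2) -> (forall x z, 0 <= w x z) ->
  (forall x x' y z, w (cons_particle x y) z = w (cons_particle x' y) z) ->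
  (\int[mu]_x ((\int[lam]_z (w x z * box l (row ord0 x - z))%:E) * (dens psi x)%:E) <=
   2^-1%:E * \int[mu]_x ((\int[lam]_z (w x z ^+ 2)%:E) * (dens psi x)%:E) +
   (2^-1 * C ^+ 4)%:E * gradient_form ord0 psi)%E.
Proof.
move=> C0 gn l0 Lpsi gfin mw w0 wc.
have mb := measurable_box l; have b0 := box_ge0 l.
have md := measurable_dens Lpsi.
have mrow : measurable_fun setT (fun p : X * P2 => row ord0 p.1 - p.2).
  apply: measurable_mx => i k; under eq_fun do rewrite !mxE.
  apply: measurable_funB.
    exact: (measurableT_comp (measurable_mx_coord ord0 k) measurable_fst).
  exact: (measurableT_comp (measurable_mx_coord i k) measurable_snd).
have mF1 : measurable_fun setT (fun p : X * P2 => (w p.1 p.2 * box l (row ord0 p.1 - p.2))%:E).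
  by apply/measurable_EFinP; apply: measurable_funM => //; exact: measurableT_comp mb mrow.
have mF2 : measurable_fun setT (fun p : X * P2 => (w p.1 p.2 ^+ 2)%:E).
  by apply/measurable_EFinP; apply: measurable_funX.
have F10 (p : X * P2) : (0 <= (w p.1 p.2 * box l (row ord0 p.1 - p.2))%:E)%E.
  by rewrite lee_fin mulr_ge0.
have F20 (p : X * P2) : (0 <= (w p.1 p.2 ^+ 2)%:E)%E by rewrite lee_fin sqr_ge0.
have mI1 := @measurable_fun_fubini_tonelli_F _ _ _ _ _ lam _ mF1 F10.
have mI2 := @measurable_fun_fubini_tonelli_F _ _ _ _ _ lam _ mF2 F20.
have mE : measurable_fun setT (EFin \o dens psi) by exact/measurable_EFinP.
pose J1 x := ((\int[lam]_z (w x z * box l (row ord0 x - z))%:E) * (dens psi x)%:E)%E.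
pose J2 x := ((\int[lam]_z (w x z ^+ 2)%:E) * (dens psi x)%:E)%E.
have mJ1 : measurable_fun setT J1 := emeasurable_funM mI1 mE.
have mJ2 : measurable_fun setT J2 := emeasurable_funM mI2 mE.
have J10 x : (0 <= J1 x)%E.
  apply: mule_ge0; last by rewrite lee_fin dens_ge0.
  by apply: integral_ge0 => z _; exact: (F10 (x, z)).
have J20 x : (0 <= J2 x)%E.
  apply: mule_ge0; last by rewrite lee_fin dens_ge0.
  by apply: integral_ge0 => z _; exact: (F20 (x, z)).
have [g gP] := gradient_form_lty gfin.
have Lg k := (is_L2P (g k)).1 (gP k).1.
have wg k := (weak_derivativeP ord0 k psi (g k)).1 (gP k).2.
have [LR LI] := (is_L2P psi).1 Lpsi.
pose sl (f : X -> R[i]) y x := f (cons_particle x y).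
have aeL (f : X -> R[i]) : is_L2 f -> {ae leb n, forall y, is_L2 (sl f y)}.
  move=> /is_L2P[L1 L2']; apply: filterS2 (L2_slices L1) (L2_slices L2') => y h1 h2.
  exact/is_L2P.
have aew k : {ae leb n, forall y, weak_derivative ord0 k (sl psi y) (sl (g k) y)}.
  apply: filterS2 (weakd_slices LR (Lg k).1 (wg k).1) (weakd_slices LI (Lg k).2 (wg k).2) => y h1 h2.
  exact/weak_derivativeP.
have mdg k : measurable_fun setT (EFin \o dens (g k)).
  by apply/measurable_EFinP; apply: measurable_dens; exact: (gP k).1.
have dg0 k x : (0 <= (EFin \o dens (g k)) x)%E by rewrite lee_fin dens_ge0.
have GE : gradient_form ord0 psi = (\int[leb n]_y
    (\int[lam]_x (dens (g ord0) (cons_particle x y))%:E +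
     \int[lam]_x (dens (g ord_max) (cons_particle x y))%:E))%E.
  rewrite gradient_formE (dirichlet_formE (gP ord0).1 (gP ord0).2) (dirichlet_formE (gP ord_max).1 (gP ord_max).2).
  rewrite !sqnormE ge0_integralD//; first last.
  - exact: (measurable_slice_integral (mdg ord_max) (dg0 ord_max)).
  - by move=> y _; apply: integral_ge0 => x _; exact: (dg0 ord_max).
  - exact: (measurable_slice_integral (mdg ord0) (dg0 ord0)).
  - by move=> y _; apply: integral_ge0 => x _; exact: (dg0 ord0).
  by rewrite -(integral_slices (mdg ord0) (dg0 ord0)) -(integral_slices (mdg ord_max) (dg0 ord_max)).
rewrite GE (integral_slices mJ1 J10) (integral_slices mJ2 J20).
pose G y := (\int[lam]_x (dens (g ord0) (cons_particle x y))%:E +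
     \int[lam]_x (dens (g ord_max) (cons_particle x y))%:E)%E.
have mG : measurable_fun setT G.
  by apply: emeasurable_funD; [exact: (measurable_slice_integral (mdg ord0) (dg0 ord0))|
    exact: (measurable_slice_integral (mdg ord_max) (dg0 ord_max))].
have G0 y : (0 <= G y)%E.
  by rewrite adde_ge0//; apply: integral_ge0 => x _; [exact: (dg0 ord0)|exact: (dg0 ord_max)].
have mS2 := measurable_slice_integral mJ2 J20.
have S20 (y : 'M[R]_(n, 2)) : (0 <= \int[lam]_x J2 (cons_particle x y))%E.
  by apply: integral_ge0 => x _; exact: J20.
have c0 : (0 <= (2^-1 * C ^+ 4)%:E)%E by rewrite lee_fin mulr_ge0// exprn_ge0.
have h0 : (0 <= 2^-1%:E :> \bar R)%E by rewrite lee_fin.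
rewrite -[leRHS](ge0_integral_comb (leb n) h0 c0 mS2 S20 mG G0).
have mS1 := measurable_slice_integral mJ1 J10.
pose c1 : \bar R := 2^-1%:E; pose c2 : \bar R := (2^-1 * C ^+ 4)%:E.
pose S2 y := (\int[lam]_x J2 (cons_particle x y))%E.
have mR : measurable_fun setT (fun y => c1 * S2 y + c2 * G y)%E.
  by apply: emeasurable_funD; [exact: emeasurable_funM (measurable_cst c1) mS2|exact: emeasurable_funM (measurable_cst c2) mG].
have S10 y : setT y -> (0 <= \int[lam]_x J1 (cons_particle x y))%E.
  by move=> _; apply: integral_ge0 => x _; exact: J10.
have R0 y : setT y -> (0 <= c1 * S2 y + c2 * G y)%E.
  by move=> _; exact: adde_ge0 (mule_ge0 h0 (S20 y)) (mule_ge0 c0 (G0 y)).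
apply: (ae_ge0_le_integral measurableT S10 mS1 R0 mR).
apply: filterS3 (aeL _ Lpsi) (filterI (aeL _ (gP ord0).1) (aeL _ (gP ord_max).1))
  (filterI (aew ord0) (aew ord_max)) => y Ly [Lg0 Lg1] [w0' w1'] _.
have GyE : gradient_form ord0 (sl psi y) = G y.
  by rewrite gradient_formE (dirichlet_formE Lg0 w0') (dirichlet_formE Lg1 w1') !sqnormE.
have Gyfin : (gradient_form ord0 (sl psi y) < +oo)%E.
  by rewrite gradient_formE (dirichlet_formE Lg0 w0') (dirichlet_formE Lg1 w1') !sqnorm_dot// -EFinD ltry.
pose u z := w (cons_particle 0 y) z.
have mu' : measurable_fun setT u.
  by exact: (measurableT_comp mw (pair1_measurable (cons_particle (0 : P2) y))).
have := one_body C0 gn l0 Ly Gyfin mu' (fun z => w0 _ z); rewrite GyE.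
have wu x z : w (cons_particle x y) z = u z by exact: wc.
have mdy : measurable_fun setT (fun x => (dens (sl psi y) x)%:E).
  by apply/measurable_EFinP; exact: (measurable_dens Ly).
have dy0 x : setT x -> (0 <= (dens (sl psi y) x)%:E)%E by rewrite lee_fin dens_ge0.
have U0 : (0 <= \int[lam]_z (u z ^+ 2)%:E)%E.
  by apply: integral_ge0 => z _; rewrite lee_fin sqr_ge0.
rewrite sqnormE -[X in (_ * X + _)%E](ge0_integralZl lam measurableT mdy dy0 U0) => h.
have E2 : S2 y = (\int[lam]_x (\int[lam]_z (u z ^+ 2)%:E * (dens (sl psi y) x)%:E))%E.
  apply: eq_integral => x _; rewrite /J2; congr (_ * _)%E.
  by apply: eq_integral => z _; rewrite wu.
have E1 : (\int[lam]_x J1 (cons_particle x y) =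
    \int[lam]_x \int[lam]_z (dens (sl psi y) x * u z * box l (x - z))%:E)%E.
  apply: eq_integral => x _; rewrite /J1 row0_cons_particle muleC.
  have mw1 : measurable_fun setT (fun z => (w (cons_particle x y) z * box l (x - z))%:E).
    have := measurableT_comp mF1 (pair1_measurable (cons_particle x y)).
    by congr (measurable_fun _ _); apply/funext => z /=; rewrite row0_cons_particle.
  have w10 z : setT z -> (0 <= (w (cons_particle x y) z * box l (x - z))%:E)%E.
    by move=> _; rewrite lee_fin; exact: mulr_ge0 (w0 _ _) (b0 _).
  rewrite -(ge0_integralZl lam measurableT mw1 w10); last by rewrite lee_fin dens_ge0.
  by apply: eq_integral => z _; rewrite wu -EFinM mulrA.
by rewrite E1 E2.
Qed.

End one_body_configurations.

(** * Overlaps of boxes carried by the particles *)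

Section means.
Context {R : realType} {n : nat}.
Local Notation X := 'M[R]_(n, 2).
Local Notation mu := (@leb R n).
Variable psi : X -> R[i].
Hypothesis Lpsi : is_L2 psi.
Implicit Types (F G : X -> R).

Definition bounded_measurable F := measurable_fun setT F /\ exists C : R, forall x, `|F x| <= C.

(** The expectation in the state [psi], times its squared norm. *)
Definition mean F : R := \int[mu]_x (F x * dens psi x).

Lemma bounded_measurable_cst (c : R) : bounded_measurable (fun=> c).
Proof. by split; [exact: measurable_cst|exists `|c|]. Qed.

Lemma bounded_measurableD F G : bounded_measurable F -> bounded_measurable G -> bounded_measurable (fun x => F x + G x).
Proof.
move=> [mF [C FC]] [mG [D GD]]; split; first exact: measurable_funD.
by exists (C + D) => x; rewrite (le_trans (ler_normD _ _))// lerD.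
Qed.

Lemma bounded_measurableZ (c : R) F : bounded_measurable F -> bounded_measurable (fun x => c * F x).
Proof.
move=> [mF [C FC]]; split; first by apply: measurable_funM => //; exact: measurable_cst.
by exists (`|c| * C) => x; rewrite normrM ler_wpM2l.
Qed.

Lemma bounded_measurable_sum (I : Type) (s : seq I) (P : pred I) (F : I -> X -> R) :
  (forall i, P i -> bounded_measurable (F i)) -> bounded_measurable (fun x => \sum_(i <- s | P i) F i x).
Proof.
move=> bF; elim: s => [|i s IHs].
  by under eq_fun do rewrite big_nil; exact: bounded_measurable_cst.
under eq_fun do rewrite big_cons; case: (boolP (P i)) => Pi; last exact: IHs.
exact: bounded_measurableD (bF i Pi) IHs.
Qed.

Lemma integrable_mean F : bounded_measurable F ->
  mu.-integrable setT (EFin \o (fun x => F x * dens psi x)).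
Proof.
move=> [mF [C FC]]; have md := measurable_dens Lpsi.
have mFd : measurable_fun setT (fun x => F x * dens psi x) by exact: measurable_funM.
have C0 : 0 <= C by exact: le_trans (FC 0).
have mEd : measurable_fun setT (fun x => (dens psi x)%:E) by exact/measurable_EFinP.
have d0 x : setT x -> (0 <= (dens psi x)%:E)%E by rewrite lee_fin dens_ge0.
apply/integrableP; split; first exact/measurable_EFinP.
apply: (@le_lt_trans _ _ (\int[mu]_x (C%:E * (dens psi x)%:E))%E).
  apply: ge0_le_integral => //=.
  - by apply/measurable_EFinP; exact: measurableT_comp.
  - by apply: emeasurable_funM => //; exact: measurable_cst.
  by move=> x _; rewrite lee_fin normrM (ger0_norm (dens_ge0 _ _)) ler_wpM2r ?dens_ge0.
by rewrite ge0_integralZl// -sqnormE (sqnorm_dot Lpsi) -EFinM ltry.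
Qed.

Lemma meanD F G : bounded_measurable F -> bounded_measurable G ->
  mean (fun x => F x + G x) = mean F + mean G.
Proof.
move=> bF bG; rewrite /mean -(RintegralD measurableT (integrable_mean bF) (integrable_mean bG)).
by apply: eq_Rintegral => x _; rewrite mulrDl.
Qed.

Lemma meanZ c F : bounded_measurable F -> mean (fun x => c * F x) = c * mean F.
Proof.
move=> bF; rewrite /mean -(RintegralZl c measurableT (integrable_mean bF)).
by apply: eq_Rintegral => x _; rewrite mulrA.
Qed.

Lemma mean_sum (I : Type) (s : seq I) (P : pred I) (F : I -> X -> R) :
  (forall i, P i -> bounded_measurable (F i)) ->
  mean (fun x => \sum_(i <- s | P i) F i x) = \sum_(i <- s | P i) mean (F i).
Proof.
move=> bF; elim: s => [|i s IHs].
  rewrite big_nil /mean; under eq_Rintegral do rewrite big_nil mul0r.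
  by rewrite /Rintegral integral0.
rewrite big_cons -IHs; case: ifPn => Pi; last first.
  by apply: eq_Rintegral => x _; rewrite big_cons (negbTE Pi).
rewrite -(meanD (bF i Pi) (bounded_measurable_sum s bF)).
by apply: eq_Rintegral => x _; rewrite big_cons Pi.
Qed.

Lemma le_mean F G : bounded_measurable F -> bounded_measurable G -> (forall x, F x <= G x) ->
  mean F <= mean G.
Proof.
move=> bF bG FG; apply: (le_Rintegral measurableT (integrable_mean bF) (integrable_mean bG)).
by move=> x _; rewrite ler_wpM2r ?dens_ge0.
Qed.

Lemma EFin_mean F : bounded_measurable F -> ((mean F)%:E = \int[mu]_x (F x * dens psi x)%:E)%E.
Proof.
by move=> bF; rewrite /mean /Rintegral fineK//; exact: (integrable_fin_num measurableT (integrable_mean bF)).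
Qed.

Lemma mean1 : ((mean (fun=> 1))%:E = sqnorm psi)%E.
Proof.
rewrite (EFin_mean (bounded_measurable_cst 1)) sqnormE.
by apply: eq_integral => x _; rewrite mul1r.
Qed.

Lemma mean_sym F s : L2_sym psi -> bounded_measurable F -> (forall x, 0 <= F x) ->
  mean (fun x => F (row_perm s x)) = mean F.
Proof.
move=> sym bF F0; have [mF _] := bF.
have := sym_integral s sym (F := EFin \o F); rewrite /mean /Rintegral /= => h.
congr fine; under eq_integral do rewrite EFinM; under [RHS]eq_integral do rewrite EFinM.
by apply: h => [|x]; [exact/measurable_EFinP|rewrite lee_fin].
Qed.

End means.

Section overlaps.
Context {R : realType} {n : nat} (l : R).
Hypothesis l0 : 0 < l.
Local Notation P2 := 'M[R]_(1, 2).
Local Notation lam := (@leb R 1).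
Local Notation X := 'M[R]_(n, 2).
Implicit Types (x : X) (z : P2) (i j : 'I_n).

Definition particle_box i x z : R := box l (row i x - z).

(** A mean-field substitute for the interaction of particles [i] and [j]. *)
Definition overlap i j x : R := dot lam (particle_box i x) (particle_box j x).

Lemma L2_particle_box i x : L2 lam (particle_box i x).
Proof. exact: L2_box. Qed.

Lemma measurable_particle_box i :
  measurable_fun setT (fun p : X * P2 => particle_box i p.1 p.2).
Proof.
apply: (measurableT_comp (measurable_box l)).
apply: measurable_mx => a k; under eq_fun do rewrite !mxE.
apply: measurable_funB.
  exact: (measurableT_comp (measurable_mx_coord i k) measurable_fst).
exact: (measurableT_comp (measurable_mx_coord a k) measurable_snd).
Qed.

Lemma overlapC i j x : overlap i j x = overlap j i x.
Proof. exact: dotC. Qed.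

Lemma overlapii i x : overlap i i x = l ^- 2.
Proof. exact: dot_box. Qed.

Lemma overlap_ge0 i j x : 0 <= overlap i j x.
Proof.
by apply: Rintegral_ge0 => z _; rewrite mulr_ge0// box_ge0.
Qed.

Lemma overlap_le i j x : overlap i j x <= l ^- 2.
Proof.
have e : l ^- 2 = l^-1 ^+ 2 by rewrite exprVn.
have l1 : 0 <= l^-1 by rewrite invr_ge0 ltW.
apply: le_trans (ler_norm _) _; rewrite {1}e expr2.
apply: normr_dot_le => //; try exact: L2_particle_box.
  by rewrite -e -/(overlap i i x) overlapii.
by rewrite -e -/(overlap j j x) overlapii.
Qed.

Lemma bounded_overlap i j : bounded_measurable (overlap i j).
Proof.
split; last first.
  by exists (l ^- 2) => x; rewrite ger0_norm ?overlap_ge0// overlap_le.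
apply: (measurableT_comp (fine_measurable measurableT)).
apply: (@measurable_fun_fubini_tonelli_F _ _ _ _ _ lam
  (fun p : X * P2 => (particle_box i p.1 p.2 * particle_box j p.1 p.2)%:E)).
  by apply/measurable_EFinP; apply: measurable_funM; exact: measurable_particle_box.
by move=> p; rewrite lee_fin mulr_ge0// box_ge0.
Qed.

Lemma overlap_row_perm i j (s : 'S_n) x : overlap i j (row_perm s x) = overlap (s i) (s j) x.
Proof.
have e a : particle_box a (row_perm s x) = particle_box (s a) x.
  apply/funext => z; rewrite /particle_box; congr (box l (_ - z)).
  by apply/matrixP => b k; rewrite !mxE.
by rewrite /overlap !e.
Qed.

Lemma L2_sum (I : Type) (s : seq I) (P : pred I) (f : I -> P2 -> R) :
  (forall i : I, L2 lam (f i)) -> L2 lam (fun z => \sum_(i <- s | P i) f i z).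
Proof.
move=> Lf; elim: s => [|i s IHs].
  by under eq_fun do rewrite big_nil; exact: L20.
by under eq_fun do rewrite big_cons; case: (P i) => //; exact: L2D.
Qed.

Lemma dot_suml (I : Type) (s : seq I) (P : pred I) (f : I -> P2 -> R) g :
  (forall i : I, L2 lam (f i)) -> L2 lam g ->
  dot lam (fun z => \sum_(i <- s | P i) f i z) g = \sum_(i <- s | P i) dot lam (f i) g.
Proof.
move=> Lf Lg; elim: s => [|i s IHs].
  rewrite big_nil /dot; under eq_Rintegral do rewrite big_nil mul0r.
  by rewrite /Rintegral integral0.
rewrite big_cons -IHs; case: (boolP (P i)) => Pi.
  rewrite -(dotDl (Lf i) (L2_sum s P Lf) Lg).
  by apply: eq_Rintegral => z _; rewrite big_cons Pi.
by apply: eq_Rintegral => z _; rewrite big_cons (negbTE Pi).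
Qed.

Lemma EFin_dot_mul (f g : P2 -> R) : L2 lam f -> L2 lam g ->
  ((dot lam f g)%:E = \int[lam]_z (f z * g z)%:E)%E.
Proof.
move=> Lf Lg; rewrite /dot /Rintegral fineK//.
exact: (integrable_fin_num measurableT (L2_integrable_mul Lf Lg)).
Qed.

Definition particle_density (P : pred 'I_n) x z : R := \sum_(i | P i) particle_box i x z.

Lemma measurable_particle_density P : measurable_fun setT (fun p : X * P2 => particle_density P p.1 p.2).
Proof.
rewrite /particle_density; under eq_fun do rewrite big_mkcond/=.
apply: measurable_sum => i; case: (P i); last exact: measurable_cst.
exact: measurable_particle_box.
Qed.

Lemma particle_density_ge0 P x z : 0 <= particle_density P x z.
Proof. by apply: sumr_ge0 => i _; exact: box_ge0. Qed.

Lemma L2_particle_density P x : L2 lam (particle_density P x).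
Proof. by apply: L2_sum => i; exact: L2_particle_box. Qed.

Lemma dot_particle_density P Q x : dot lam (particle_density P x) (particle_density Q x) =
  \sum_(i | P i) \sum_(j | Q j) overlap i j x.
Proof.
rewrite (dot_suml _ _ (fun i => L2_particle_box i x) (L2_particle_density Q x)).
apply: eq_bigr => i _; rewrite dotC (dot_suml _ _ (fun i => L2_particle_box i x) (L2_particle_box i x)).
by apply: eq_bigr => j _; exact: dotC.
Qed.

(** If [g] dominates [U] up to displacements of size [l], averaging each particle
    over its box replaces [U] by [g], and Young's inequality then separates the
    two densities. *)
Lemma pair_bound (U g : P2 -> R) (k : R) x : (forall z, 0 <= U z) ->
  measurable_fun setT g -> (forall z, 0 <= g z) ->
  (forall z z', (forall a, `|z ord0 a - z' ord0 a| <= l) -> U z <= g z') ->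
  (\int[lam]_z (g z)%:E <= k%:E)%E ->
  \sum_i \sum_(j | j != i) U (row i x - row j x) <= k * \sum_i \sum_j overlap i j x.
Proof.
move=> U0 mg g0 Ug gk.
pose F := particle_density predT x.
have LF : L2 lam F by exact: L2_particle_density.
have F0 z : 0 <= F z by exact: particle_density_ge0.
have mF := L2_measurable LF.
have FF : (\int[lam]_z (F z ^+ 2)%:E = (\sum_i \sum_j overlap i j x)%:E)%E.
  by rewrite -EFin_dot// dot_particle_density.
have h0 : 0 <= 2^-1 :> R by [].
have hh : 1 <= 4 * 2^-1 * 2^-1 :> R by rewrite le_eqVlt; apply/orP; left; apply/eqP; field.
have Y := young_convolution h0 h0 mF mF mg F0 F0 g0 hh.
have O0 : 0 <= \sum_i \sum_j overlap i j x.
  by apply: sumr_ge0 => i _; apply: sumr_ge0 => j _; exact: overlap_ge0.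
have {}Y : (\int[lam]_z \int[lam]_z' (F z * F z' * g (z - z'))%:E <=
    (k * \sum_i \sum_j overlap i j x)%:E)%E.
  apply: le_trans Y _; rewrite FF -!EFinM -EFinD -mulrDl.
  rewrite (_ : 2^-1 + 2^-1 = 1 :> R) ?mul1r; last by field.
  by rewrite mulrC EFinM lee_wpmul2l// lee_fin.
rewrite -lee_fin; apply: le_trans Y.
pose b i := particle_box i x.
have b0 i z : 0 <= b i z by exact: box_ge0.
have mb i : measurable_fun setT (b i) by exact: L2_measurable (L2_particle_box i x).
have b1 i : (\int[lam]_z (b i z)%:E = 1)%E.
  by rewrite /b (integral_sub_r (row i x) (measurable_box l) (box_ge0 l)) integral_box.
pose c (p : 'I_n * 'I_n) := if p.2 != p.1 then U (row p.1 x - row p.2 x) else 0.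
have c0 p : 0 <= c p by rewrite /c; case: ifP.
have -> : \sum_i \sum_(j | j != i) U (row i x - row j x) = \sum_p c p.
  rewrite -(pair_bigA _ (fun i j => c (i, j)))/=; apply: eq_bigr => i _.
  by rewrite big_mkcond.
pose B (p : 'I_n * 'I_n) (q : P2 * P2) := c p * b p.1 q.1 * b p.2 q.2.
have mB p : measurable_fun setT (B p).
  apply: measurable_funM; last exact: measurableT_comp (mb p.2) measurable_snd.
  apply: measurable_funM; [exact: measurable_cst|exact: measurableT_comp (mb p.1) measurable_fst].
have B0 p q : 0 <= B p q by rewrite /B; apply: mulr_ge0 => //; exact: mulr_ge0.
have cE p : ((c p)%:E = \int[lam]_z \int[lam]_z' (B p (z, z'))%:E)%E.
  have inner z : (\int[lam]_z' (B p (z, z'))%:E = (c p * b p.1 z)%:E)%E.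
    have m : measurable_fun setT (fun z' => (b p.2 z')%:E) by exact/measurable_EFinP.
    rewrite /B /=; under eq_integral do rewrite EFinM.
    rewrite (ge0_integralZl lam measurableT m) ?b1 ?mule1//.
      by move=> z' _; rewrite lee_fin.
    by rewrite lee_fin mulr_ge0.
  under eq_integral do rewrite inner EFinM.
  have m : measurable_fun setT (fun z => (b p.1 z)%:E) by exact/measurable_EFinP.
  rewrite (ge0_integralZl lam measurableT m) ?b1 ?mule1//.
    by move=> z' _; rewrite lee_fin.
  by rewrite lee_fin.
rewrite -sumEFin; under eq_bigr do rewrite cE.
have mBz p z : measurable_fun setT (fun z' => (B p (z, z'))%:E).
  by apply/measurable_EFinP; exact: measurableT_comp (mB p) (pair1_measurable z).
rewrite -(ge0_integral_sum lam measurableT (f := fun p z => \int[lam]_z' (B p (z, z'))%:E)%E);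
  [|by move=> p; exact: measurable_conv (mB p) (B0 p)
   |by move=> p z _; apply: integral_ge0 => z' _; rewrite lee_fin].
apply: ge0_le_integral => //.
- move=> z _; apply: sume_ge0 => p _; apply: integral_ge0 => z' _; by rewrite lee_fin.
- by apply: emeasurable_sum => p; exact: measurable_conv (mB p) (B0 p).
- apply: (@measurable_conv _ (fun q => F q.1 * F q.2 * g (q.1 - q.2))).
    apply: measurable_funM; last exact: measurableT_comp mg measurable_sub.
    by apply: measurable_funM; [exact: measurableT_comp mF measurable_fst|
      exact: measurableT_comp mF measurable_snd].
  by move=> q; apply: mulr_ge0 => //; exact: mulr_ge0.
move=> z _.
rewrite -(ge0_integral_sum lam measurableT (f := fun p z' => (B p (z, z'))%:E));
  [|by move=> p; exact: mBz|by move=> p z' _; rewrite lee_fin].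
apply: ge0_le_integral => //.
- by move=> z' _; apply: sume_ge0 => p _; rewrite lee_fin.
- by apply: emeasurable_sum => p; exact: mBz.
- apply/measurable_EFinP; apply: measurable_funM.
    by apply: measurable_funM => //; exact: measurable_cst.
  exact: measurableT_comp mg (measurable_sub_r z).
move=> z' _; rewrite sumEFin lee_fin.
have -> : F z * F z' * g (z - z') = \sum_(p : 'I_n * 'I_n) b p.1 z * b p.2 z' * g (z - z').
  rewrite -mulr_suml; congr (_ * _); rewrite /F /particle_density big_distrlr/=.
  by rewrite -(pair_bigA _ (fun i j => b i z * b j z')).
apply: ler_sum => p _; rewrite /B /= -mulrA mulrC.
have bb0 : 0 <= b p.1 z * b p.2 z' by exact: mulr_ge0.
have [->|n1] := eqVneq (b p.1 z) 0; first by rewrite !mul0r.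
have [->|n2] := eqVneq (b p.2 z') 0; first by rewrite mulr0 !mul0r.
apply: ler_wpM2l => //; rewrite /c; case: ifP => // _; apply: Ug => a.
have := box_neq0 n1 a; have := box_neq0 n2 a; rewrite !mxE => h2 h1.
rewrite (_ : _ - _ = (x p.1 a - z ord0 a) - (x p.2 a - z' ord0 a)); last by ring.
apply: le_trans (ler_normB _ _) _; lra.
Qed.

End overlaps.

(** * Counting overlaps in a symmetric state *)

Section symmetric_means.
Context {R : realType} {n : nat} (l C : R).
Hypotheses (l0 : 0 < l) (n0 : (0 < n)%N) (C0 : 0 <= C).
Hypothesis gnC : gagliardo_nirenberg C.
Local Notation P2 := 'M[R]_(1, 2).
Local Notation lam := (@leb R 1).
Local Notation X := 'M[R]_(n.+1, 2).
Local Notation mu := (@leb R n.+1).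
Variable psi : X -> R[i].
Hypothesis sym : L2_sym psi.
Let Lpsi : is_L2 psi. Proof. by case: sym. Qed.
Local Notation K := (overlap l).
Local Notation E := (mean psi).

Definition overlap_with i (x : X) : R := \sum_(j | j != i) K i j x.

Lemma bounded_overlap_with i : bounded_measurable (overlap_with i).
Proof. by apply: bounded_measurable_sum => j _; exact: bounded_overlap. Qed.

Lemma overlap_with_ge0 i x : 0 <= overlap_with i x.
Proof. by apply: sumr_ge0 => j _; exact: overlap_ge0. Qed.

Lemma mean_overlap_with i : E (overlap_with i) = E (overlap_with ord0).
Proof.
rewrite -(mean_sym (tperm ord0 i) sym (bounded_overlap_with ord0) (overlap_with_ge0 ord0)).
apply: eq_Rintegral => x _; congr (_ * _); rewrite /overlap_with.
rewrite [RHS](eq_bigr (fun j => K i (tperm ord0 i j) x)); last first.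
  by move=> j _; rewrite overlap_row_perm tpermL.
rewrite [RHS](reindex_inj (@perm_inj _ (tperm ord0 i))) /=.
apply: eq_big => [j|j _]; last by rewrite tpermK.
by rewrite -(inj_eq (@perm_inj _ (tperm ord0 i)) _ ord0) tpermK tpermL.
Qed.

Lemma sum_overlap x : \sum_i \sum_j K i j x =
  \sum_i overlap_with i x + n.+1%:R * l ^- 2.
Proof.
rewrite mulr_natl -[X in _ *+ X](card_ord n.+1) -sumr_const -big_split/=.
apply: eq_bigr => i _; rewrite (bigD1 i)//= overlapii// addrC.
by rewrite /overlap_with.
Qed.

Lemma dot_other_densities x :
  dot lam (particle_density l (fun i => i != ord0) x) (particle_density l (fun i => i != ord0) x) =
  \sum_i overlap_with i x - 2 * overlap_with ord0 x + n%:R * l ^- 2.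
Proof.
rewrite (dot_particle_density l0).
have := sum_overlap x; rewrite (bigD1 ord0)//= (bigD1 ord0)//= overlapii//.
have -> : \sum_(i | i != ord0) \sum_j K i j x =
    \sum_(i | i != ord0) (K ord0 i x + \sum_(j | j != ord0) K i j x).
  by apply: eq_bigr => i _; rewrite (bigD1 ord0)//= overlapC.
rewrite big_split/= -/(overlap_with ord0 x) -[n.+1%:R]natr1 mulrDl mul1r.
by move: (overlap_with _ _) (\sum_(i | _) _) (\sum_i _) => a b c; lra.
Qed.

(** Let [A] be the mean on the left. The particles other than the first have an
    average density [u] of mean square [((n - 1) * A + n * l^-2 * S) / n ^ 2], by
    symmetry, and [one_body_config] bounds [A / n], the interaction of the first
    particle with [u], by half of it plus a gradient. The factor one half
    lets [A] be absorbed. *)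
Lemma mean_overlap_le (G S : R) : gradient_form ord0 psi = G%:E -> sqnorm psi = S%:E ->
  E (overlap_with ord0) <= l ^- 2 * S + C ^+ 4 * (n%:R * G).
Proof.
move=> GE SE; set A := E (overlap_with ord0).
have nR : 0 < n%:R :> R by rewrite ltr0n.
have A0 : 0 <= A.
  by apply: Rintegral_ge0 => x _; rewrite mulr_ge0 ?overlap_with_ge0 ?dens_ge0.
pose D := particle_density l (fun i : 'I_n.+1 => i != ord0).
have D0 x z : 0 <= D x z by exact: particle_density_ge0.
pose w x z := n%:R^-1 * D x z.
have LD x : L2 lam (D x) by exact: L2_particle_density.
have mw : measurable_fun setT (fun p : X * P2 => w p.1 p.2).
  apply: measurable_funM; first exact: measurable_cst.
  exact: measurable_particle_density.
have w0 x z : 0 <= w x z by rewrite mulr_ge0 ?invr_ge0.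
have wc (x x' : P2) y z : w (cons_particle x y) z = w (cons_particle x' y) z.
  congr (_ * _); apply: eq_bigr => i i0; congr (box l (_ - z)).
  apply/matrixP => a k; rewrite !mxE.
  by case: splitP i0 => [j|j] ij //; rewrite -val_eqE /= ij ord1.
have := one_body_config C0 gnC l0 Lpsi _ mw w0 wc; rewrite GE => /(_ (ltry _)).
have bD : bounded_measurable (fun x => n%:R^-1 * overlap_with ord0 x).
  by apply: bounded_measurableZ; exact: bounded_overlap_with.
have bT : bounded_measurable (fun x => \sum_i overlap_with i x).
  by apply: bounded_measurable_sum => i _; exact: bounded_overlap_with.
pose Q x := \sum_i overlap_with i x + (- 2) * overlap_with ord0 x + n%:R * l ^- 2.
have b2 : bounded_measurable (fun x => (- 2) * overlap_with ord0 x).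
  by apply: bounded_measurableZ; exact: bounded_overlap_with.
have bQ' := bounded_measurableD bT b2.
have bQ : bounded_measurable Q by exact: (bounded_measurableD bQ' (bounded_measurable_cst (n%:R * l ^- 2))).
have bQn := bounded_measurableZ (n%:R ^- 2) bQ.
have E1 : (\int[mu]_x ((\int[lam]_z (w x z * box l (row ord0 x - z))%:E) * (dens psi x)%:E) =
    (n%:R^-1 * A)%:E)%E.
  rewrite -(meanZ Lpsi _ (bounded_overlap_with ord0)) (EFin_mean Lpsi bD).
  apply: eq_integral => x _; rewrite [RHS]EFinM; congr (_ * _)%E.
  rewrite -(EFin_dot_mul (L2Z _ (LD x)) (L2_particle_box l0 ord0 x)).
  rewrite (dotZl _ (LD x) (L2_particle_box l0 ord0 x)); congr (_ * _)%:E.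
  rewrite dotC /D /particle_density dotC (dot_suml _ _ (fun i => L2_particle_box l0 i x) (L2_particle_box l0 ord0 x)).
  by apply: eq_bigr => j _; exact: dotC.
have E2 : (\int[mu]_x ((\int[lam]_z (w x z ^+ 2)%:E) * (dens psi x)%:E) =
    (n%:R ^- 2 * (n.+1%:R * A - 2 * A + n%:R * l ^- 2 * S))%:E)%E.
  have -> : n.+1%:R * A - 2 * A + n%:R * l ^- 2 * S = E Q.
    rewrite (meanD Lpsi bQ' (bounded_measurable_cst _)) (meanD Lpsi bT b2).
    rewrite (meanZ Lpsi _ (bounded_overlap_with ord0)).
    rewrite (mean_sum Lpsi _ (fun i _ => bounded_overlap_with i)).
    rewrite (eq_bigr _ (fun i _ => mean_overlap_with i)) sumr_const card_ord -mulr_natl.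
    have -> : E (fun=> n%:R * l ^- 2) = n%:R * l ^- 2 * S.
      have := meanZ Lpsi (n%:R * l ^- 2) (bounded_measurable_cst 1); rewrite mulr1 => ->.
      by congr (_ * _); apply: EFin_inj; rewrite (mean1 Lpsi) SE.
    by rewrite -/A; ring.
  rewrite -(meanZ Lpsi _ bQ) (EFin_mean Lpsi bQn).
  apply: eq_integral => x _; rewrite [RHS]EFinM; congr (_ * _)%E.
  rewrite -EFin_dot; last exact: (L2Z _ (LD x)).
  rewrite (dotZl _ (LD x) (L2Z _ (LD x))) (dotZr _ (LD x) (LD x)) dot_other_densities.
  by rewrite mulrA -expr2 exprVn /Q mulNr.
rewrite E1 E2 -!EFinM -!EFinD lee_fin => h.
have n21 : 1 <= n%:R :> R by rewrite ler1n.
have {}h : 2 * n%:R * A <= n.+1%:R * A - 2 * A + n%:R * l ^- 2 * S + C ^+ 4 * (n%:R ^+ 2 * G).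
  have := ler_wpM2l (ltW (mulr_gt0 (ltr0n R 2) (exprn_gt0 2 nR))) h.
  rewrite (_ : 2 * n%:R ^+ 2 * (n%:R^-1 * A) = 2 * n%:R * A); last by field; rewrite gt_eqF.
  move=> /le_trans; apply; rewrite le_eqVlt; apply/orP; left; apply/eqP.
  by field; rewrite !gt_eqF.
rewrite -(ler_pM2l nR); move: h; rewrite -[n.+1%:R]natr1 => h.
have -> : n%:R * (l ^- 2 * S + C ^+ 4 * (n%:R * G)) =
  n%:R * l ^- 2 * S + C ^+ 4 * (n%:R ^+ 2 * G) by ring.
by move: h; lra.
Qed.

End symmetric_means.

Section interaction_bound.
Context {R : realType} {n : nat}.
Local Notation P2 := 'M[R]_(1, 2).
Local Notation X := 'M[R]_(n.+1, 2).
Local Notation mu := (@leb R n.+1).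

Lemma sum_pairs (N : nat) (c : 'I_N -> 'I_N -> R) : (forall i j, c i j = c j i) ->
  \sum_i \sum_(j | j != i) c i j = 2 * \sum_(i < N) \sum_(j < N | (i < j)%N) c i j.
Proof.
move=> cC; rewrite mulrDl !mul1r.
have -> : \sum_i \sum_(j | j != i) c i j =
    \sum_(i < N) (\sum_(j < N | (i < j)%N) c i j + \sum_(j < N | (j < i)%N) c i j).
  apply: eq_bigr => i _; rewrite (bigID (fun j : 'I_N => (i < j)%N))/=; congr (_ + _).
    by apply: eq_bigl => j; rewrite -val_eqE/=; case: ltngtP.
  by apply: eq_bigl => j; rewrite -val_eqE/=; case: ltngtP.
rewrite big_split/=; congr (_ + _).
have e : \sum_(i < N) \sum_(j < N | (j < i)%N) c i j =
    \sum_(i < N) \sum_(j < N) (if (j < i)%N then c i j else 0).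
  by apply: eq_bigr => i _; rewrite big_mkcond.
rewrite e exchange_big/=; apply: eq_bigr => j _; rewrite -big_mkcond.
by apply: eq_bigr => i _; exact: cC.
Qed.

(** A rescaling of the plane that preserves integrals. *)
Definition scaled (W : P2 -> R) (t : R) (z : P2) : R := t ^+ 2 * W (t *: z).

Lemma interactionE (V : P2 -> R) (beta : R) (x : X) : (forall z, V (- z) = V z) ->
  interaction V beta x = - (2^-1 * n.+1%:R^-1 *
    \sum_i \sum_(j | j != i) scaled (fun z => - V z) (n.+1%:R `^ beta) (row i x - row j x)).
Proof.
move=> Ve; rewrite sum_pairs; last first.
  by move=> i j; rewrite /scaled -opprB scalerN Ve.
rewrite /interaction -mulrA mulrCA [2^-1 * _]mulrA mulVf// mul1r -mulrN; congr (_ * _).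
rewrite -sumrN; apply: eq_bigr => i _; rewrite -sumrN; apply: eq_bigr => j _.
rewrite /scaled mulrN opprK; congr (_ * _).
by rewrite -powR_mulrn ?powR_ge0// -powRrM mulrC.
Qed.

Lemma measurable_interaction (V : P2 -> R) (beta : R) : measurable_fun setT V ->
  measurable_fun setT (interaction V beta : X -> R).
Proof.
move=> mV; apply: measurable_funM; first exact: measurable_cst.
apply: measurable_sum => i; rewrite /=.
under eq_fun do rewrite big_mkcond/=.
apply: measurable_sum => j /=; case: (i < j)%N; last exact: measurable_cst.
apply: measurable_funM; first exact: measurable_cst.
apply: (measurableT_comp mV); apply: measurable_mx => a k; under eq_fun do rewrite !mxE.
apply: measurable_funM; first exact: measurable_cst.
by apply: measurable_funB; exact: measurable_mx_coord.
Qed.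

Lemma bounded_interaction (V : P2 -> R) (beta : R) : bounded_measurable (n := 1) V ->
  bounded_measurable (interaction V beta : X -> R).
Proof.
move=> [mV [C VC]]; split; first exact: measurable_interaction.
exists (n.+1%:R^-1 * \sum_(i < n.+1) \sum_(j < n.+1 | (i < j)%N) n.+1%:R `^ (2 * beta) * C) => x.
rewrite normrM ger0_norm ?invr_ge0// ler_wpM2l ?invr_ge0//.
apply: le_trans (ler_norm_sum _ _ _) _; apply: ler_sum => i _.
apply: le_trans (ler_norm_sum _ _ _) _; apply: ler_sum => j _.
by rewrite normrM (ger0_norm (powR_ge0 _ _)) ler_wpM2l ?powR_ge0.
Qed.

(** The boxes have side [d / N ^ beta], the scale at which the majorant [g] of [- V]
    absorbs displacements. Summing [pair_bound] over the pairs and taking means, the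
    overlaps of distinct particles are controlled by [mean_overlap_le]; the diagonal
    ones are the constant [l ^ -2]. *)
Lemma interaction_mean_ge (V g : P2 -> R) (beta d k C alpha : R) (psi : X -> R[i]) (G S : R) :
  (0 < n)%N -> bounded_measurable (n := 1) V -> (forall z, V (- z) = V z) -> (forall z, V z <= 0) ->
  measurable_fun setT g -> (forall z, 0 <= g z) ->
  (forall z z' : P2, (forall a, `|z ord0 a - z' ord0 a| <= d) -> - V z <= g z') ->
  (\int[leb 1]_z (g z)%:E <= k%:E)%E -> 0 < d -> 0 <= k -> 0 <= C ->
  gagliardo_nirenberg C -> k * C ^+ 4 <= 2 * alpha ->
  L2_sym psi -> gradient_form ord0 psi = G%:E -> sqnorm psi = S%:E -> 0 <= G ->
  - (k * (d / n.+1%:R `^ beta) ^- 2 * S + alpha * (n.+1%:R * G)) <=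
    mean psi (interaction V beta).
Proof.
move=> n0 bV Ve V0 mg g0 Vg gk d0 k0 C0 gnC kC sym GE SE G0.
have Lpsi : is_L2 psi by case: sym.
have N0 : 0 < n.+1%:R :> R by rewrite ltr0n.
set t := n.+1%:R `^ beta; have t0 : 0 < t by exact: powR_gt0.
pose l := d / t; have l0 : 0 < l by rewrite divr_gt0.
have [mV _] := bV.
have mt : measurable_fun setT (fun x : P2 => t *: x).
  apply: measurable_mx => i a; under eq_fun do rewrite mxE.
  by apply: measurable_funM; [exact: measurable_cst|exact: measurable_mx_coord].
pose gt := scaled g t.
have mgt : measurable_fun setT gt.
  by apply: measurable_funM; [exact: measurable_cst|exact: measurableT_comp mg mt].
have gt0' z : 0 <= gt z by rewrite mulr_ge0 ?sqr_ge0.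
pose U := scaled (fun z => - V z) t.
have U0 z : 0 <= U z by rewrite mulr_ge0 ?sqr_ge0// oppr_ge0.
have Ug (z z' : P2) : (forall a, `|z ord0 a - z' ord0 a| <= l) -> U z <= gt z'.
  move=> h; rewrite ler_wpM2l ?sqr_ge0//; apply: Vg => a; rewrite !mxE -mulrBr normrM.
  by rewrite gtr0_norm// mulrC -ler_pdivlMr.
have gtk : (\int[leb 1]_z (gt z)%:E <= k%:E)%E by rewrite (integral_scale t0 mg g0).
have PB x := pair_bound l0 x U0 mgt gt0' Ug gtk.
have bT : bounded_measurable (fun x : X => \sum_i overlap_with l i x).
  by apply: bounded_measurable_sum => i _; exact: bounded_overlap_with.
pose M (x : X) := - (2^-1 * n.+1%:R^-1 * k) * (\sum_i overlap_with l i x + n.+1%:R * l ^- 2).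
have bM' := bounded_measurableD bT (bounded_measurable_cst (n.+1%:R * l ^- 2)).
have bM : bounded_measurable M by apply: bounded_measurableZ bM'.
apply: (@le_trans _ _ (mean psi M)); last first.
  apply: (le_mean Lpsi bM (bounded_interaction beta bV)) => x.
  rewrite interactionE// /M mulNr lerN2 -[leRHS]mulrA ler_wpM2l ?mulr_ge0 ?invr_ge0//.
  by rewrite -(sum_overlap l0); exact: PB.
rewrite (meanZ Lpsi _ bM') (meanD Lpsi bT (bounded_measurable_cst _)).
rewrite (mean_sum Lpsi _ (fun i _ => bounded_overlap_with l0 i)).
rewrite (eq_bigr _ (fun i _ => mean_overlap_with l0 sym i)) sumr_const card_ord -[mean psi _ *+ _]mulr_natl.
have -> : mean psi (fun=> n.+1%:R * l ^- 2) = n.+1%:R * l ^- 2 * S.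
  have := meanZ Lpsi (n.+1%:R * l ^- 2) (bounded_measurable_cst 1); rewrite mulr1 => ->.
  by congr (_ * _); apply: EFin_inj; rewrite (mean1 Lpsi) SE.
have A := mean_overlap_le l0 n0 C0 gnC sym GE SE.
rewrite -/l; move: A; set z := l ^- 2; set a := mean psi _ => A.
have -> : - (2^-1 * n.+1%:R^-1 * k) * (n.+1%:R * a + n.+1%:R * z * S) =
    - (2^-1 * k * (a + z * S)) by field; rewrite gt_eqF.
rewrite lerN2; have kk : 0 <= 2^-1 * k by rewrite mulr_ge0.
apply: le_trans (ler_wpM2l kk (lerD A (lexx (z * S)))) _.
have nG : 0 <= n%:R * G by rewrite mulr_ge0.
have := ler_wpM2r nG kC.
have a0 : 0 <= alpha * G.
  have := ler_wpM2r G0 kC; have := mulr_ge0 (mulr_ge0 k0 (exprn_ge0 4 C0)) G0.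
  by rewrite -mulrA; lra.
rewrite -[n.+1%:R]natr1 => h.
have -> : alpha * ((n%:R + 1) * G) = alpha * n%:R * G + alpha * G by ring.
move: h; rewrite (_ : k * C ^+ 4 * (n%:R * G) = 2 * (2^-1 * k * (C ^+ 4 * (n%:R * G)))); last by field.
by rewrite (_ : 2 * alpha * (n%:R * G) = 2 * (alpha * n%:R * G)); [lra|ring].
Qed.

End interaction_bound.

(** * Potentials of rapid decrease and the sharp constant *)

Section schwartz_domination.
Context {R : realType}.
Local Notation P2 := 'M[R]_(1, 2).
Local Notation lam := (@leb R 1).
Implicit Types (x y z : P2) (V : P2 -> R).

Definition decay (t : R) : R := (oneDsqr t)^-1.

Definition plane_decay z : R := decay (z ord0 ord0) * decay (z ord0 ord_max).

Lemma decay_gt0 t : 0 < decay t.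
Proof. by rewrite invr_gt0 (lt_le_trans ltr01)// oneDsqr_ge1. Qed.

Lemma continuous_decay : continuous decay.
Proof. exact: continuous_oneDsqrV. Qed.

Lemma measurable_decay : measurable_fun setT decay.
Proof. by apply: continuous_measurable_fun; exact: continuous_decay. Qed.

Lemma plane_decay_ge0 z : 0 <= plane_decay z.
Proof. by apply: mulr_ge0; apply: ltW; exact: decay_gt0. Qed.

Lemma measurable_plane_decay : measurable_fun setT plane_decay.
Proof.
by apply: measurable_funM; apply: (measurableT_comp measurable_decay);
  exact: (@measurable_mx_coord _ (measurableTypeR R)).
Qed.

Lemma integral_decay : (\int[lebesgue_measure]_t (decay t)%:E = pi%:E)%E.
Proof.
have even : decay =1 decay \o -%R.
  by move=> t; rewrite /= /decay /oneDsqr /= sqrrN.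
rewrite (ge0_symfun_integralT (fun t => ltW (decay_gt0 t)) continuous_decay even).
by rewrite -set_itvcy integral0y_oneDsqr -EFinM; congr EFin; field.
Qed.

Lemma measurable_mkpoint : measurable_fun setT (@mkpoint R).
Proof.
apply: measurable_mx => i k; under eq_fun do rewrite mxE.
by case: (k == 0); [exact: measurable_fst|exact: measurable_snd].
Qed.

Lemma integral_plane_decay : (\int[lam]_z (plane_decay z)%:E = (pi * pi)%:E)%E.
Proof.
rewrite eq_integral_leb1.
have mp : measurable_fun setT (EFin \o plane_decay).
  by apply/measurable_EFinP; exact: measurable_plane_decay.
have p0 : {in setT, forall z, (0 <= (EFin \o plane_decay) z)%E}.
  by move=> z _; rewrite lee_fin plane_decay_ge0.
have := ge0_integral_pushforward measurable_mkpoint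
  (prod_measure (@lebesgue_measure R) (@lebesgue_measure R)) measurableT mp p0.
rewrite preimage_setT; set q := (X in _ = X -> _) => e.
transitivity q; first exact: e.
rewrite /q; have mq : measurable_fun setT ((EFin \o plane_decay) \o @mkpoint R).
  exact: measurableT_comp mp measurable_mkpoint.
have q0 p : (0 <= ((EFin \o plane_decay) \o @mkpoint R) p)%E.
  by rewrite lee_fin plane_decay_ge0.
have := @fubini_tonelli1 _ _ _ _ R (@lebesgue_measure R) (@lebesgue_measure R) _ mq q0.
move=> h1; etransitivity; first exact: h1.
have md : measurable_fun setT (fun t : measurableTypeR R => (decay t)%:E).
  by apply/measurable_EFinP; exact: measurable_decay.
have d0 (t : measurableTypeR R) : setT t -> (0 <= (decay t)%:E)%E.
  by rewrite lee_fin => _; exact/ltW/decay_gt0.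
transitivity (\int[@lebesgue_measure R]_a ((decay a)%:E * \int[lebesgue_measure]_b (decay b)%:E))%E.
  apply: eq_integral => a _; rewrite /fubini_F -(ge0_integralZl (@lebesgue_measure R) measurableT md d0); last exact: (d0 a I).
  by apply: eq_integral => b _; rewrite /= /plane_decay !mxE EFinM.
rewrite integral_decay; under eq_integral do rewrite muleC.
rewrite (ge0_integralZl (@lebesgue_measure R) measurableT md d0) ?integral_decay ?EFinM//.
by rewrite lee_fin pi_ge0.
Qed.

Lemma mean_value_coord V k x (r B : R) : smooth V ->
  (forall t, `|t| <= `|r| -> `|pder [:: (ord0, k)] V (t *: delta_mx ord0 k + x)| <= B) ->
  `|V (r *: delta_mx ord0 k + x) - V x| <= `|r| * B.
Proof.
move=> sV VB; pose h (t : R) := V (t *: delta_mx ord0 k + x).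
pose dh (t : R) := pder [:: (ord0, k)] V (t *: delta_mx ord0 k + x).
have dhP (t : R) : is_derive t (1 : R) h (dh t).
  apply: is_derive_along_line; exact: smooth_is_derive.
have ch : continuous h.
  move=> t; apply: differentiable_continuous; apply/derivable1_diffP.
  by have [] := dhP t.
have h0 : V x = h 0 by rewrite /h scale0r add0r.
rewrite h0 -/(h r).
have [r0|r0] := leP 0 r.
  have [|c cr ->] := @MVT_segment R h dh 0 r r0 (fun t _ => dhP t).
    exact: continuous_subspaceT.
  rewrite subr0 normrM mulrC ler_wpM2l//; apply: VB.
  by move: cr; rewrite in_itv/= => /andP[c0 cr]; rewrite !ger0_norm.
have [|c cr] := @MVT_segment R h dh r 0 (ltW r0) (fun t _ => dhP t).
  exact: continuous_subspaceT.
rewrite distrC sub0r => ->; rewrite normrM normrN mulrC ler_wpM2l//; apply: VB.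
by move: cr; rewrite in_itv/= => /andP[c0 cr]; rewrite (ler0_norm cr) (ler0_norm (ltW r0)) lerN2.
Qed.

Lemma decay_near (z y : P2) : (forall a, `|y ord0 a - z ord0 a| <= 1) ->
  (1 + sqlen y) ^- 2 <= 9 * plane_decay z.
Proof.
move=> zy.
have s0 : 0 < 1 + sqlen y by have := sqlen_ge0 y; lra.
have le1 a : oneDsqr (z ord0 a) <= 3 * (1 + sqlen y).
  have h := zy a.
  have : (y ord0 a - z ord0 a) ^+ 2 <= 1 by rewrite -real_normK ?num_real// expr_le1.
  have : y ord0 a ^+ 2 <= sqlen y.
    by rewrite sqlenE; case: (ord2P a) => ->; rewrite ?lerDl ?lerDr sqr_ge0.
  rewrite /oneDsqr; have := sqr_ge0 (2 * y ord0 a - z ord0 a); nra.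
have g0 a : 0 < oneDsqr (z ord0 a) by rewrite (lt_le_trans ltr01)// oneDsqr_ge1.
rewrite /plane_decay /decay -invfM -ler_pdivrMl//.
rewrite -invfM lef_pV2 ?posrE ?mulr_gt0 ?exprn_gt0//.
apply: le_trans (ler_pM (ltW (g0 _)) (ltW (g0 _)) (le1 _) (le1 _)) _.
rewrite le_eqVlt; apply/orP; left; apply/eqP; ring.
Qed.

(** Rapid decay of the gradient makes [V] vary by at most a multiple of the
    integrable function [plane_decay] over unit displacements. *)
Lemma schwartz_lipschitz V : schwartz V -> exists2 D, 0 <= D &
  forall d z z', 0 <= d <= 1 -> (forall a, `|z ord0 a - z' ord0 a| <= d) ->
  `|V z - V z'| <= d * D * plane_decay z'.
Proof.
move=> [sV decV].
have [D0' D0P] := decV 2 [:: (ord0, ord0)]; have [D1 D1P] := decV 2 [:: (ord0, ord_max)].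
pose D := Num.max 0 (Num.max D0' D1).
have D0 : 0 <= D by rewrite le_max lexx.
have dP k y : `|pder [:: (ord0, k)] V y| <= D * (1 + sqlen y) ^- 2.
  have s0 : 0 < (1 + sqlen y) ^+ 2 by rewrite exprn_gt0//; have := sqlen_ge0 y; lra.
  rewrite ler_pdivlMr// mulrC.
  case: (ord2P k) => ->; [apply: le_trans (D0P y) _|apply: le_trans (D1P y) _].
    by rewrite !le_max lexx !orbT.
  by rewrite !le_max lexx !orbT.
(* Two coordinate segments, with a factor 9 from [decay_near] on each. *)
exists (18 * D); first by rewrite mulr_ge0.
move=> d z z' /andP[d0 d1] zz'.
have near y : (forall a, `|y ord0 a - z' ord0 a| <= d) -> forall k,
    `|pder [:: (ord0, k)] V y| <= 9 * D * plane_decay z'.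
  move=> yz k; apply: le_trans (dP k y) _; rewrite [9 * D]mulrC -mulrA ler_wpM2l//.
  by apply: decay_near => a; exact: le_trans (yz a) d1.
have deltaE (k a : 'I_2) (t : R) : (t *: delta_mx ord0 k : P2) ord0 a = t * (a == k)%:R.
  by rewrite !mxE eqxx.
pose r0 := z ord0 ord0 - z' ord0 ord0; pose r1 := z ord0 ord_max - z' ord0 ord_max.
pose w := r0 *: delta_mx ord0 ord0 + z'.
have zE : z = r1 *: delta_mx ord0 ord_max + w.
  apply/matrixP => i a; rewrite !mxE ord1 eqxx.
  by case: (ord2P a) => ->; rewrite /= /r0 /r1; ring.
have B0 : 0 <= 9 * D * plane_decay z'.
  by apply: mulr_ge0 (plane_decay_ge0 _); exact: mulr_ge0.
have h1 : `|V w - V z'| <= `|r0| * (9 * D * plane_decay z').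
  apply: mean_value_coord => // t tr; apply: near => a.
  rewrite mxE deltaE addrK normrM; apply: le_trans (zz' ord0).
  by case: (a == _); rewrite ?normr1 ?normr0 ?mulr1 ?mulr0.
have h2 : `|V z - V w| <= `|r1| * (9 * D * plane_decay z').
  rewrite zE; apply: mean_value_coord => // t tr; apply: near => a.
  rewrite mxE deltaE /w mxE deltaE.
  case: (ord2P a) => ->; rewrite /= ?mulr0 ?mulr1 ?add0r ?addrK.
    exact: (zz' ord0).
  by apply: le_trans (zz' ord_max).
rewrite (_ : V z - V z' = (V z - V w) + (V w - V z')); last by ring.
apply: le_trans (ler_normD _ _) _.
have l1 := ler_wpM2r B0 (zz' ord0); have l2 := ler_wpM2r B0 (zz' ord_max).
by move: h1 h2 l1 l2; rewrite -/r0 -/r1; lra.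
Qed.

Lemma schwartz_bounded V : schwartz V -> bounded_measurable (n := 1) V.
Proof.
move=> [sV decV]; split; first exact: smooth_measurable sV.
by have [C CP] := decV 0%N [::]; exists C => x; have := CP x; rewrite expr0 mul1r.
Qed.

(** The majorant [- V + c * plane_decay] used for pairs of displaced particles. *)
Lemma schwartz_majorant V (v k : R) : schwartz V -> (forall z, V z <= 0) ->
  (\int[lam]_z (- V z)%:E = v%:E)%E -> v < k ->
  exists (d : R) (g : P2 -> R), [/\ 0 < d, measurable_fun setT g, forall z, 0 <= g z,
    forall z z' : P2, (forall a, `|z ord0 a - z' ord0 a| <= d) -> - V z <= g z' &
    (\int[lam]_z (g z)%:E <= k%:E)%E].
Proof.
move=> sV V0 Vv vk; have [D D0 VD] := schwartz_lipschitz sV.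
have [mV _] := schwartz_bounded sV.
pose J := D * (pi * pi); have J0 : 0 <= J by rewrite !mulr_ge0// pi_ge0.
have kv : 0 < k - v by rewrite subr_gt0.
have [m m1 Jm] := small_scale J0 kv.
have m0 : 0 < m by exact: lt_le_trans m1.
pose d := m^-1; have d0 : 0 < d by rewrite invr_gt0.
have d1 : d <= 1 by rewrite invf_le1.
have dD0 : 0 <= d * D by rewrite mulr_ge0// ltW.
exists d, (fun z => - V z + d * D * plane_decay z); split => //.
- apply: measurable_funD; first exact: measurableT_comp.
  by apply: measurable_funM; [exact: measurable_cst|exact: measurable_plane_decay].
- by move=> z; rewrite addr_ge0 ?oppr_ge0// mulr_ge0 ?plane_decay_ge0.
- move=> z z' h; have := VD d z z' _ h; rewrite (ltW d0) d1 => /(_ isT).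
  by move=> /(le_trans (ler_norm _)) ; have := VD d z z' _ h; rewrite (ltW d0) d1 => /(_ isT); rewrite distrC => /(le_trans (ler_norm _)); lra.
have mE : measurable_fun setT (fun z => (- V z)%:E) by apply/measurable_EFinP; exact: measurableT_comp.
have mp : measurable_fun setT (fun z => (plane_decay z)%:E).
  by apply/measurable_EFinP; exact: measurable_plane_decay.
have h1 : (0 <= 1%:E :> \bar R)%E by rewrite lee_fin.
have h2 : (0 <= (d * D)%:E)%E by rewrite lee_fin.
have V0' z : (0 <= (- V z)%:E)%E by rewrite lee_fin oppr_ge0.
have p0' z : (0 <= (plane_decay z)%:E)%E by rewrite lee_fin plane_decay_ge0.
have := ge0_integral_comb lam h1 h2 mE V0' mp p0'.
rewrite Vv integral_plane_decay => e.
rewrite (_ : (\int[lam]_z (- V z + d * D * plane_decay z)%:E =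
  1%:E * v%:E + (d * D)%:E * (pi * pi)%:E)%E); last first.
  by rewrite -e; apply: eq_integral => z _; rewrite EFinD EFinM mul1e.
rewrite -!EFinM -EFinD lee_fin mul1r -mulrA -/J mulrC; move: Jm; rewrite -/d; lra.
Qed.

End schwartz_domination.

Section gagliardo_nirenberg_constant.
Context {R : realType}.

(** The strict inequality forces [Cgn R] to be nonzero, and the infimum of an empty
    set is 0, so the inequality does hold for constants close to [Cgn R]. *)
Lemma near_optimal_constant (a v : R) : 0 < a -> 0 <= v -> v < 2 * a / Cgn R ^+ 4 ->
  exists k C, [/\ v < k, 0 <= C, gagliardo_nirenberg C & k * C ^+ 4 <= 2 * a].
Proof.
move=> a0 v0 va; set A := [set C : R | 0 <= C /\ gagliardo_nirenberg C].
have c0 : Cgn R != 0.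
  by apply: contraTneq va => ->; rewrite expr0n/= invr0 mulr0 -leNgt.
have [A0 lbA] : has_inf A.
  apply/not_notP => nA; move/eqP: c0; apply; exact: (inf_out nA).
have cge : 0 <= Cgn R by apply: lb_le_inf => // C [].
have cgt : 0 < Cgn R by rewrite lt_def c0.
set u := 2 * a / Cgn R ^+ 4 in va; pose k := (v + u) / 2.
have vk : v < k by rewrite /k; lra.
have ku : k < u by rewrite /k; lra.
have k0 : 0 < k by exact: le_lt_trans vk.
(* The largest constant allowed by [k * c ^ 4 <= 2 * a]. *)
pose c := Num.sqrt (Num.sqrt (2 * a / k)).
have cE : c ^+ 4 = 2 * a / k.
  have q0 : 0 <= 2 * a / k by apply: divr_ge0 (ltW k0); apply: mulr_ge0 => //; exact: ltW.
  by rewrite (exprM c 2 2) (sqr_sqrtr (sqrtr_ge0 _)) sqr_sqrtr.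
have cc : Cgn R < c.
  rewrite -(@ltr_pXn2r _ 4)// ?nnegrE ?sqrtr_ge0// cE ltr_pdivlMr// mulrC.
  by rewrite -ltr_pdivlMr// exprn_gt0.
have [C [C0 gn] Cc] := inf_lt A0 cc.
exists k, C; split => //.
rewrite mulrC -ler_pdivlMr// -cE; apply: lerXn2r; rewrite ?nnegrE ?sqrtr_ge0//; exact: ltW.
Qed.

End gagliardo_nirenberg_constant.

(** * Stability *)

Section stability.
Context {R : realType}.

(** Symmetry turns the kinetic and trapping energy into that of one particle, of which
    the interaction consumes at most a fraction [alpha], plus an error of
    order [N ^ (2 * beta)], with [N = n + 1]. The first alternative is the case of
    infinite energy. *)
Lemma hamiltonian_form_ge n (V g : 'M[R]_(1, 2) -> R) (omega beta d k C alpha : R)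
    (psi : 'M[R]_(n.+1, 2) -> R[i]) (S : R) :
  (0 < n)%N -> bounded_measurable (n := 1) V -> (forall z, V (- z) = V z) ->
  (forall z, V z <= 0) ->
  measurable_fun setT g -> (forall z, 0 <= g z) ->
  (forall z z' : 'M[R]_(1, 2), (forall a, `|z ord0 a - z' ord0 a| <= d) -> - V z <= g z') ->
  (\int[leb 1]_z (g z)%:E <= k%:E)%E -> 0 < d -> 0 <= k -> 0 <= C ->
  gagliardo_nirenberg C -> k * C ^+ 4 <= 2 * alpha -> 0 <= alpha ->
  L2_sym psi -> sqnorm psi = S%:E ->
  hamiltonian_form V omega beta psi = +oo%E \/
  exists o h : R, [/\ oscillator_form omega ord0 psi = o%:E, 0 <= o,
    hamiltonian_form V omega beta psi = h%:E &
    (1 - alpha) * n.+1%:R * o - k * d ^- 2 * n.+1%:R `^ (2 * beta) * S <= h].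
Proof.
move=> n0 bV Ve V0 mg g0 Vg gk d0 k0 C0 gnC kC a0 sym SE.
have Lpsi : is_L2 psi by case: sym.
have iE : (\int[leb n.+1]_x (interaction V beta x * ComplexField.Normc.normc (psi x) ^+ 2)%:E =
    (mean psi (interaction V beta))%:E)%E.
  rewrite (EFin_mean Lpsi (bounded_interaction beta bV)).
  by apply: eq_integral => x _; rewrite sqr_modulus.
have sumE : (\sum_(j < n.+1) oscillator_form omega j psi =
    n.+1%:R%:E * oscillator_form omega ord0 psi)%E.
  rewrite mule_natl (eq_bigr (fun=> oscillator_form omega ord0 psi)).
    by rewrite sumr_const card_ord.
  by move=> j _; exact: sym_oscillator.
have p0 : (0 <= \int[leb n.+1]_x (omega ^+ 2 * sqlen (row ord0 x) *
    ComplexField.Normc.normc (psi x) ^+ 2)%:E)%E.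
  apply: integral_ge0 => x _; rewrite lee_fin; apply: mulr_ge0; last exact: sqr_ge0.
  by apply: mulr_ge0; [exact: sqr_ge0|exact: sqlen_ge0].
have G0 := gradient_form_ge0 ord0 psi.
have HE : hamiltonian_form V omega beta psi =
    (n.+1%:R%:E * oscillator_form omega ord0 psi + (mean psi (interaction V beta))%:E)%E.
  by rewrite /hamiltonian_form sumE iE.
have o0 : (0 <= oscillator_form omega ord0 psi)%E by exact: adde_ge0.
have [ooE|] := eqVneq (oscillator_form omega ord0 psi) +oo%E.
  by left; rewrite HE ooE gt0_muley ?addye// lte_fin ltr0n.
rewrite -ltey => ofin; right.
have oE : oscillator_form omega ord0 psi = (fine (oscillator_form omega ord0 psi))%:E.
  by rewrite fineK// ge0_fin_numE.
have Go : (gradient_form ord0 psi <= oscillator_form omega ord0 psi)%E by exact: leeDl.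
have GE : gradient_form ord0 psi = (fine (gradient_form ord0 psi))%:E.
  by rewrite fineK// ge0_fin_numE//; exact: le_lt_trans ofin.
move: o0 Go G0 GE; rewrite HE oE; set o := fine _; set G := fine (gradient_form _ _).
move=> o0 Go G0 GE; move: Go G0; rewrite GE !lee_fin => Go G0.
exists o, (n.+1%:R * o + mean psi (interaction V beta)); split => //.
have := interaction_mean_ge beta n0 bV Ve V0 mg g0 Vg gk d0 k0 C0 gnC kC sym GE SE G0.
set t := n.+1%:R `^ beta; have t0 : 0 < t by apply: powR_gt0; rewrite ltr0n.
have -> : n.+1%:R `^ (2 * beta) = t ^+ 2.
  by rewrite -powR_mulrn ?powR_ge0// -powRrM mulrC.
have -> : (d / t) ^- 2 = d ^- 2 * t ^+ 2 by field; rewrite !gt_eqF.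
have : alpha * (n.+1%:R * G) <= alpha * (n.+1%:R * o).
  by rewrite ler_wpM2l// ler_wpM2l.
rewrite mulrBl mul1r [(_ - _) * o]mulrBl -!mulrA; lra.
Qed.

Lemma powR_double_le (beta : R) (N : nat) : 0 < beta -> beta < 6^-1 -> (0 < N)%N ->
  (N%:R `^ (2 * beta)) * Num.sqrt N%:R <= N%:R.
Proof.
move=> b0 b1 N0; have N1 : 1 <= N%:R :> R by rewrite ler1n.
rewrite -(powR12_sqrt (ler0n _ N)) -powRD; last first.
  by apply/implyP => _; rewrite gt_eqF// ltr0n.
rewrite -[leRHS]powRr1// ler_powR//; lra.
Qed.

End stability.

Theorem theorem2p1 (R : realType) (V : 'rV[R]_2 -> R) (omega beta alpha : R)
    (V_schwartz : schwartz V) (V_even : forall x, V (- x) = V x)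
    (V_nonpos : forall x, V x <= 0)
    (omega_gt0 : 0 < omega) (beta_gt0 : 0 < beta) (beta_lt : beta < 6^-1)
    (alpha_gt0 : 0 < alpha) (alpha_lt1 : alpha < 1)
    (V_L1 : ('N[leb 1]_1[EFin \o V] < (2 * alpha / Cgn R ^+ 4)%:E)%E) :
  (exists N0 : R -> nat,
    (N0 C0 @[C0 --> 0^'+] --> \oo) /\
    forall C0 : R, 0 < C0 -> (0 < N0 C0)%N /\
      forall (N : nat) (N_gt0 : (0 < N)%N), (N0 C0 < N)%N ->
      forall S1 : operator N, is_sqrt_op S1 (oscillator omega (Ordinal N_gt0)) ->
      forall psi : 'M[R]_(N, 2) -> R[i], L2_sym psi ->
      (N%:R^-1%:E * hamiltonian_form V omega beta psi + C0%:E * sqnorm psi >=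
       (1 - alpha)%:E * op_sqnorm S1 psi)%E)
  /\
  (exists (C : R) (N1 : nat),
    forall N : nat, (N1 < N)%N ->
    forall psi : 'M[R]_(N, 2) -> R[i], L2_sym psi ->
    (hamiltonian_form V omega beta psi >= (- (C * N%:R))%:E * sqnorm psi)%E).
Proof.
have VE : 'N[leb 1]_1[EFin \o V]%E = (\int[leb 1]_z (- V z)%:E)%E.
  rewrite Lnorm1; apply: eq_integral => z _.
  by rewrite /= ler0_norm.
have I0 : (0 <= \int[leb 1]_z (- V z)%:E)%E.
  by apply: integral_ge0 => z _; rewrite lee_fin oppr_ge0.
move: V_L1; rewrite VE => V_L1.
have vE : (\int[leb 1]_z (- V z)%:E)%E = (fine (\int[leb 1]_z (- V z)%:E))%:E.
  by rewrite fineK// ge0_fin_numE//; apply: lt_trans V_L1 (ltry _).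
set v := fine _ in vE; move: V_L1 I0; rewrite vE lte_fin lee_fin => V_L1 v0.
have [k [C [vk C0 gnC kC]]] := near_optimal_constant alpha_gt0 v0 V_L1.
have k0 : 0 <= k by exact/ltW/(le_lt_trans v0).
have [d [g [d0 mg g0 Vg gk]]] := schwartz_majorant V_schwartz V_nonpos vE vk.
have bV := schwartz_bounded V_schwartz.
pose kap := k * d ^- 2; have kap0 : 0 <= kap by rewrite mulr_ge0// invr_ge0 sqr_ge0.
have main n (psi : 'M[R]_(n.+1, 2) -> R[i]) S (n0 : (0 < n)%N) (sym : L2_sym psi)
    (SE : sqnorm psi = S%:E) :=
  hamiltonian_form_ge omega beta n0 bV V_even V_nonpos mg g0 Vg gk d0 k0 C0 gnC kC
    (ltW alpha_gt0) sym SE.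
have a1 : 0 <= 1 - alpha by rewrite subr_ge0 ltW.
split.
  (* The square makes the error [kap * N ^ (2 * beta)] at most [c * N]; the last
     term only makes the threshold tend to infinity, for instance when [kap] is 0. *)
  pose q (c : R) := (Num.truncn (kap / c)).+1.
  exists (fun c => (q c ^ 2 + Num.truncn c^-1).+2); split.
    apply/cvgnyPge => A; near=> c.
    have c0 : 0 < c by near: c; exact: nbhs_right_gt.
    apply: (@leq_trans (Num.truncn c^-1)); last exact: leqW (leqW (leq_addl _ _)).
    have cA : c < A.+1%:R^-1 by near: c; apply: nbhs_right_lt; rewrite invr_gt0 ltr0n.
    rewrite truncn_ge_nat ?invr_ge0 ?(ltW c0)//.
    apply: (@le_trans _ _ A.+1%:R); first by rewrite ler_nat.
    by rewrite -[leLHS]invrK lef_pV2 ?posrE ?invr_gt0 ?ltr0n// ltW.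
  move=> c c0; split => // N N_gt0 NN S1 S1P psi sym.
  case: N N_gt0 NN S1 S1P psi sym => // n N_gt0 NN S1 S1P psi sym.
  have Lpsi : is_L2 psi by case: sym.
  have n0 : (0 < n)%N by case: n NN {N_gt0 S1 S1P psi sym Lpsi}.
  have N0 : 0 < n.+1%:R :> R by rewrite ltr0n.
  have SE := sqnorm_dot Lpsi; set S := (X in X%:E) in SE.
  have S0 : 0 <= S by rewrite addr_ge0 ?dot_ge0.
  have opo := oscillator_form_ge omega_gt0 S1P Lpsi.
  rewrite (sym_oscillator omega (Ordinal N_gt0) ord0 sym) in opo.
  rewrite SE; have [-> | [w [h [wE w0 HE hge]]]] := main n psi S n0 sym SE.
    by rewrite gt0_muley ?lte_fin ?invr_gt0// -EFinM addye// leey.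
  rewrite HE; apply: (@le_trans _ _ ((1 - alpha)%:E * w%:E)%E).
    by apply: lee_wpmul2l; [rewrite lee_fin|rewrite -wE].
  rewrite -!EFinM -EFinD lee_fin.
  have sq : kap <= c * Num.sqrt n.+1%:R.
    have qs : (q c)%:R <= Num.sqrt n.+1%:R :> R.
      rewrite -[leLHS](ger0_norm (ler0n _ _)) -sqrtr_sqr ler_sqrt ?ler0n// -natrX ler_nat.
      exact: leq_trans (leqW (leqW (leq_addr _ _))) (ltnW NN).
    rewrite mulrC -ler_pdivrMr//; apply: le_trans qs; exact/ltW/truncnS_gt.
  have pw := powR_double_le beta_gt0 beta_lt (ltn0Sn n).
  have p0 : 0 <= n.+1%:R `^ (2 * beta) :> R by exact: powR_ge0.
  have key : kap * n.+1%:R `^ (2 * beta) <= c * n.+1%:R.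
    apply: le_trans (ler_wpM2r p0 sq) _; rewrite -mulrA ler_wpM2l ?(ltW c0)//.
    by rewrite mulrC.
  rewrite -(ler_pM2l N0) mulrDr mulVKf ?gt_eqF// mulrA.
  have := ler_wpM2r S0 key; move: hge; rewrite -/kap.
  by rewrite (mulrA _ c) [n.+1%:R * c]mulrC [n.+1%:R * (1 - alpha)]mulrC; lra.
exists kap, 1%N => N N1 psi sym.
case: N N1 psi sym => // n n0 psi sym.
have Lpsi : is_L2 psi by case: sym.
have SE := sqnorm_dot Lpsi; set S := (X in X%:E) in SE.
have S0 : 0 <= S by rewrite addr_ge0 ?dot_ge0.
rewrite SE; have [-> | [w [h [_ w0 HE hge]]]] := main n psi S n0 sym SE; first by rewrite leey.
rewrite HE -EFinM lee_fin; apply: le_trans hge.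
have N1 : 1 <= Num.sqrt n.+1%:R :> R by rewrite -[leLHS]sqrtr1 ler_sqrt// ler1n.
have p0 : 0 <= n.+1%:R `^ (2 * beta) :> R by exact: powR_ge0.
have pN : n.+1%:R `^ (2 * beta) <= n.+1%:R :> R.
  apply: le_trans (powR_double_le beta_gt0 beta_lt (ltn0Sn n)).
  by rewrite ler_peMr.
have : 0 <= (1 - alpha) * n.+1%:R * w by rewrite !mulr_ge0.
have := ler_wpM2r S0 (ler_wpM2l kap0 pN); rewrite -/kap mulNr; lra.
Unshelve. all: by end_near.
Qed.
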